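(* For every fixed integer $d\ge3$, there are constants $C=C(d)>0$ and $n_0=n_0(d)$ with the following property. Let $0\le\varepsilon\le1$, and let $G$ be a connected simple graph of order $n\ge n_0$ and minimum degree at least $d$, satisfying $$n^2\mu(G)\le(d-1)\pi^2+\varepsilon.$$ Put $\eta=(\varepsilon+n^{-1})^{1/3}$. Then all but at most $C\eta n$ vertices of $G$ belong to vertex-disjoint induced copies of $L_d$. Each copy has exactly two boundary edges, both bridges of $G$, one at each terminal, and the copies form at most $C\eta n$ chains. Moreover, $$\frac{3n}{d+1}-C\eta n\le\operatorname{diam}(G)\le3\left\lfloor\frac{n}{d+1}\right\rfloor-1.$$
   Context: All graphs are finite, simple and undirected. $\mu(G)$ is the algebraic connectivity (second smallest Laplacian eigenvalue); $\operatorname{diam}(G)$ is the diameter. $L_d=K_{d+1}-e$ is the complete graph on $d+1$ vertices with one edge $e$ removed; its terminals are the endpoints of $e$. A boundary edge of a copy is an edge of $G$ with exactly one endpoint in the copy; a bridge is an edge whose deletion disconnects $G$. A chain is a sequence of copies in which each copy is joined to the next by a bridge between a terminal of one and a terminal of the other (possibly a single copy). *)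

(* Defs.v *)
From mathcomp Require Import all_boot all_order all_algebra spectral.
From mathcomp Require Import boolp classical_sets reals.
From mathcomp Require Import complex.

Set Implicit Arguments.
Unset Strict Implicit.
Unset Printing Implicit Defensive.

Import Order.TTheory GRing.Theory Num.Theory.
Local Open Scope ring_scope.

Section Spectrum.
Variable R : realType.

Definition is_spectrum n (A : 'M[R]_n) (s : seq R) : Prop :=
  sorted <=%R s /\ char_poly A = \prod_(x <- s) ('X - x%:P).

(* The eigenvalues of A in nondecreasing order, with multiplicity; the default
   [::] is returned only when the characteristic polynomial does not split over
   R, which by spectrumP does not happen for symmetric A. *)
Definition spectrum n (A : 'M[R]_n) : seq R :=
  xget [::] [set s | is_spectrum A s]%classic.

Lemma char_poly_conj (F : fieldType) n (P D : 'M[F]_n) :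
  P \in unitmx -> char_poly (invmx P *m D *m P) = char_poly D.
Proof.
move=> Pu; pose Q := map_mx (@polyC F) P.
have Qu : map_mx (@polyC F) (invmx P) *m Q = 1%:M.
  by rewrite -map_mxM mulVmx // map_mx1.
have E : char_poly_mx (invmx P *m D *m P)
    = map_mx (@polyC F) (invmx P) *m char_poly_mx D *m Q :> 'M[{poly F}]_n.
  rewrite /char_poly_mx mulmxBr mulmxBl !map_mxM scalar_mxC.
  by rewrite -[_%:M *m _ *m _]mulmxA Qu mulmx1.
by rewrite /char_poly E !det_mulmx mulrAC -det_mulmx Qu det1 mul1r.
Qed.

Lemma spectrumP n (A : 'M[R]_n) : A^T = A -> is_spectrum A (spectrum A).
Proof.
move=> Asym; apply: (@xgetPex _ [::] [set s | is_spectrum A s]%classic).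
pose toC : {rmorphism R -> complex R} := real_complex R.
pose A' := map_mx toC A.
have A'herm : A' \is hermsymmx.
  apply: realsym_hermsym.
    apply/is_hermitianmxP; rewrite expr0 scale1r map_mx_id //.
    by rewrite /A' map_trmx Asym.
  by apply/mxOverP => i j; rewrite !mxE; apply/complex_realP; exists (A i j).
have spR := hermitian_spectral_diag_real A'herm.
have /orthomx_spectralP A'E := hermitian_normalmx A'herm.
pose r := [seq complex.Re (spectral_diag A' 0 i) | i <- enum 'I_n].
exists (sort <=%R r); split; first exact: sort_le_sorted.
rewrite (perm_big r) ?perm_sort //=.
apply: (map_poly_inj toC); rewrite map_char_poly -/A' A'E.
rewrite char_poly_conj ?spectral_unit // char_poly_trig ?diag_mx_is_trig //.
rewrite rmorph_prod big_map big_enum; apply: eq_bigr => i _.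
rewrite rmorphB /= map_polyX map_polyC /= !mxE eqxx mulr1n.
congr (_ - _%:P); apply/esym/RRe_real.
by move/mxOverP: spR; apply.
Qed.

End Spectrum.

(* A graph is given by its symmetric irreflexive adjacency relation e on a
   finType T; an edge is the two-element set of its endpoints. *)
Section Graph.
Variable T : finType.
Implicit Types (e : rel T) (x y : T) (A E : {set T}).

Definition degree e x : nat := #|[set y | e x y]|.

Definition connected_graph e : bool := [forall x, forall y, connect e x y].

Definition laplacian (R : realType) e : 'M[R]_#|T| :=
  \matrix_(i, j) ((degree e (enum_val i))%:R *+ (i == j)
                  - (e (enum_val i) (enum_val j))%:R).

Definition algebraic_connectivity (R : realType) e : R :=
  (spectrum (laplacian R e))`_1.

Definition has_walk e x y k : bool :=
  [exists p : k.-tuple T, path e x p && (last x p == y)].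

(* Least length of a walk from x to y; #|T| when there is none. *)
Definition graph_dist e x y : nat := find (has_walk e x y) (iota 0 #|T|).

Definition diameter e : nat := \max_x \max_y graph_dist e x y.

Definition edges e : {set {set T}} :=
  [set [set p.1; p.2] | p : T * T & e p.1 p.2].

Definition delete_edge e E : rel T :=
  fun x y => e x y && ([set x; y] != E).

Definition bridge e E : bool :=
  (E \in edges e) && ~~ connected_graph (delete_edge e E).

Definition boundary e A : {set {set T}} :=
  [set E in edges e | #|E :&: A| == 1%N].

End Graph.

Section Copies.
Variables (T : finType) (d : nat).
Implicit Types (e : rel T) (f g : {ffun 'I_d.+1 -> T}).

(* L_d : the complete graph on 'I_d.+1 minus the edge {ord0, ord_max}. *)
Definition L_adj : rel 'I_d.+1 :=
  fun i j => (i != j) && ([set i; j] != [set ord0; ord_max]).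

(* A copy of L_d in a graph on T is given by an embedding f. *)
Definition induced_L e f : Prop :=
  injective f /\ forall i j, e (f i) (f j) = L_adj i j.

Definition verts f : {set T} := f @: [set: 'I_d.+1].

Definition terminals f : {set T} := [set f ord0; f ord_max].

Definition has_terminal_bridges e f : Prop :=
  [/\ #|boundary e (verts f)| = 2,
      {in boundary e (verts f), forall E, bridge e E}
    & {in terminals f, forall t,
        #|[set E in boundary e (verts f) | t \in E]| = 1%N}].

Definition joined e f g : bool :=
  [exists u in terminals f, exists v in terminals g, bridge e [set u; v]].

Definition is_chain e (s : seq {ffun 'I_d.+1 -> T}) : bool :=
  (s != [::]) && sorted (joined e) s.

End Copies.

(* Main.v *)
(** Sort the vertices by a Fiedler vector, with values a_0 <= ... <= a_(n-1), and let
    S_i = - (a_0 + ... + a_(i-1)). Then S vanishes at both ends and is concave, and the edge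
    lengths |a_q - a_p| across the cut before position i add up to mu * S_i. Writing delta_k for
    the gaps of a, summation by parts gives sum a^2 = sum S_k delta_k, while Wirtinger's
    inequality gives sum a^2 >= 2 (1 - cos (pi / n)) sum S^2.

    To bound sum S_k delta_k from above, dualise: if weights y_i >= 0 on the cuts satisfy
    sum_i y_i c(i, k) >= 1 for every k, where c(i, k) counts the edges crossing both cuts i and k
    (and only nearby i are needed), then sum S_k delta_k <= mu * sum_i y_i S_i^2 up to a relative
    error O(1/n). Minimum degree d gives m (d + 1 - m) <= c_i + c_(i+m) for the cut sizes, so the
    cuts with 2 c_i < d are more than d apart and the cuts around them are large. This makes it
    possible to choose y equal to 1 / (d - 1) on average, and smaller by a fixed amount near every
    vertex that lies in no copy of L_d between two consecutive bridges. Comparing with the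
    hypothesis on mu, the sum of S^2 over these defects is O((eps + 1/n) n max S^2). As S is
    concave, S >= eta * max S at distance eta * n from the ends, so there are O(eta n) defects. *)
Require Import Defs.
From mathcomp Require Import boolp classical_sets reals topology normedtype derive.
From mathcomp Require Import all_boot all_order all_algebra perm spectral complex exp trigo.
From mathcomp Require Import zify ring lra.
Import Order.TTheory GRing.Theory Num.Theory.
Import numFieldNormedType.Exports.

Set Implicit Arguments.
Unset Strict Implicit.
Unset Printing Implicit Defensive.

(** * Cuts of a graph on the positions 0, ..., n-1; cut i separates p < i from p >= i *)

(** The constant d - 1 is an electrical resistance. Between its terminals [L_d] acts as d - 1
    parallel paths of length 2, so a block together with one bridge has resistance 2 / (d - 1) + 1 =
    (d + 1) / (d - 1), that is 1 / (d - 1) per vertex. The weights y_i are local resistances: along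
    a chain of copies they are 1 at a bridge, 1 / (d - 1) beside it and 0 elsewhere. The obstacle is
    that y_i may exceed 1 / (d - 1) locally, so the comparison holds only after averaging over
    windows of width about d. As S has Lipschitz constant n mu max S = O(max S / n), averaging costs
    a relative error O(1/n), and so does replacing 2 (1 - cos (pi / n)) by pi^2 / n^2; hence the
    term 1/n next to eps. The cube root balances two losses. With M = max S, the defects carry total
    energy O(eta^3 n M^2) and each one farther than eta n from both ends carries at least eta^2 M^2,
    which leaves O(eta n) of them; the two ends left out of this count have O(eta n) vertices
    too. *)

Section Cuts.
Variables (n : nat) (E : rel nat).
Hypothesis Esym : symmetric E.
Hypothesis Eirr : irreflexive E.

Definition cut2 i k : nat :=
  \sum_(p < n) \sum_(q < n) ((p < minn i k) && (maxn i k <= q) && E p q).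
Definition cut i : nat := cut2 i i.

Definition deg p : nat := \sum_(q < n) E p q.
Definition rdeg p : nat := \sum_(q < n) ((p < q) && E p q).
Definition ldeg p : nat := \sum_(q < n) ((q < p) && E p q).

Lemma cut0 : cut 0 = 0.
Proof. by rewrite /cut /cut2 big1 // => p _; rewrite big1 // => q _; rewrite minnn ltn0. Qed.

Lemma cutn : cut n = 0.
Proof.
rewrite /cut /cut2 big1 // => p _; rewrite big1 // => q _.
by rewrite maxnn [n <= q]leqNgt ltn_ord andbF.
Qed.

Lemma sum_interval m i j : \sum_(q < m) (i <= q < j) = minn m j - i.
Proof.
elim: m => [|m IH]; first by rewrite big_ord0; lia.
by rewrite big_ord_recr /= IH; case: (leqP i m); case: (ltnP m j); lia.
Qed.

Lemma sum_eq m i : i < m -> \sum_(q < m) (q == i :> nat) = 1.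
Proof.
move=> im; have := sum_interval m i i.+1.
rewrite (eq_bigr (fun q : 'I_m => (q == i :> nat) : nat)) => [->|q _]; first by lia.
by congr nat_of_bool; lia.
Qed.

Lemma sum_eq_le m i : \sum_(q < m) (q == i :> nat) <= 1.
Proof.
case: (ltnP i m) => [/sum_eq-> //|mi]; rewrite big1 // => q _.
by case: eqP => // qi; have := ltn_ord q; lia.
Qed.

Lemma sum2_le (F G : nat -> nat -> nat) :
  (forall p q, p < n -> q < n -> F p q <= G p q) ->
  \sum_(p < n) \sum_(q < n) F p q <= \sum_(p < n) \sum_(q < n) G p q.
Proof. by move=> FG; apply: leq_sum => p _; apply: leq_sum => q _; apply: FG. Qed.

Lemma sum2D (F G : nat -> nat -> nat) :
  \sum_(p < n) \sum_(q < n) (F p q + G p q) =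
  \sum_(p < n) \sum_(q < n) F p q + \sum_(p < n) \sum_(q < n) G p q.
Proof. by rewrite -big_split; apply: eq_bigr => p _; rewrite -big_split. Qed.

Lemma sum_row (F : nat -> nat -> nat) i : i < n ->
  \sum_(p < n) \sum_(q < n) ((p == i :> nat) * F p q) = \sum_(q < n) F i q.
Proof.
move=> lin; rewrite (bigD1 (Ordinal lin)) //= [X in _ + X]big1 => [|p /eqP pi].
  by rewrite addn0; apply: eq_bigr => q _; rewrite eqxx mul1n.
apply: big1 => q _; case: eqP => // pi'; case: pi; exact: val_inj.
Qed.

Lemma deg_split p : deg p = ldeg p + rdeg p.
Proof.
rewrite /deg /ldeg /rdeg -big_split; apply: eq_bigr => q _ /=.
by case: ltngtP => //= [|->]; rewrite ?addn0 // Eirr.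
Qed.

Lemma cutE i : cut i = \sum_(p < n) \sum_(q < n) ((p < i <= q) && E p q).
Proof. by rewrite /cut /cut2 minnn maxnn. Qed.

(** The m = j - i vertices between the cuts have degree sum at least m d. At most m (m - 1) of it is
    spent on edges among themselves, and every remaining edge crosses cut [i] or cut [j]. For m > d
    + 1 the truncated factor is 0. *)
Lemma cut_growth d i j : i <= j <= n -> (forall p, p < n -> d <= deg p) ->
  (j - i) * (d.+1 - (j - i)) <= cut i + cut j.
Proof.
move=> /andP[ij jn] dd.
have H1 : (j - i) * d <= \sum_(p < n) \sum_(q < n) ((i <= p < j) * E p q).
  have -> : (j - i) * d = \sum_(p < n) (i <= p < j) * d.
    by rewrite -big_distrl /= sum_interval; congr (_ * _); lia.
  apply: leq_sum => p _; rewrite -big_distrr /=; apply: leq_mul => //.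
  exact: dd.
have H2 : \sum_(p < n) \sum_(q < n) ((i <= p < j) * E p q) <=
    \sum_(p < n) \sum_(q < n) ((i <= p < j) * ((i <= q < j) && (p != q :> nat)) +
      (((q < i <= p) && E q p) + ((p < j <= q) && E p q))).
  apply: (sum2_le (F := fun p q => (i <= p < j) * E p q) (G := fun p q =>
    ((i <= p < j) * ((i <= q < j) && (p != q :> nat)) +
      (((q < i <= p) && E q p) + ((p < j <= q) && E p q))))) => p q _ _.
  rewrite [E q p]Esym; case Epq: (E p q); last by rewrite muln0.
  have : p != q by apply: contraTneq Epq => ->; rewrite Eirr.
  by case: (p =P q) => // _ _; case: (leqP i p); case: (ltnP p j); case: (leqP i q);
     case: (ltnP q j); rewrite ?muln0 ?mul0n ?mul1n ?andbT //=; lia.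
rewrite (sum2D (fun p q => ((i <= p < j) * ((i <= q < j) && (p != q :> nat))))
  (fun p q => (((q < i <= p) && E q p) + ((p < j <= q) && E p q)))) in H2.
rewrite (sum2D (fun p q => ((q < i <= p) && E q p))
   (fun p q => ((p < j <= q) && E p q))) -cutE in H2.
have H4 : \sum_(p < n) \sum_(q < n) ((q < i <= p) && E q p) = cut i.
  by rewrite exchange_big cutE.
rewrite H4 in H2.
have H3 : \sum_(p < n) \sum_(q < n) ((i <= p < j) * ((i <= q < j) && (p != q :> nat)))
   <= (j - i) * (j - i).-1.
  have -> : (j - i) * (j - i).-1 = \sum_(p < n) (i <= p < j) * (j - i).-1.
    by rewrite -big_distrl /= sum_interval; congr (_ * _); lia.
  apply: leq_sum => p _; rewrite -big_distrr /=.
  case: (boolP (i <= p < j)) => // pij; rewrite !mul1n.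
  have : \sum_(q < n) (i <= q < j) = \sum_(q < n) ((q == p :> nat) + ((i <= q < j) && (p != q :> nat))).
    by apply: eq_bigr => q _; move: pij; rewrite [p == q :> nat]eq_sym; case: (_ =P _ :> nat) => [-> -> //|_ _]; rewrite andbT.
  by rewrite big_split /= sum_eq // sum_interval; lia.
have := leq_trans H1 H2.
move: H3; set X := \sum_(_ < n) _ => H3 {}H4.
case: (leqP (j - i) d) => mi; last by rewrite (_ : d.+1 - (j - i) = 0) ?muln0 //; lia.
by move: (j - i) H3 H4 mi => m; nia.
Qed.

Lemma cut_adj k : cut k <= 1 + (cut2 k.-1 k + cut2 k.+1 k).
Proof.
have H : cut k <= \sum_(p < n) \sum_(q < n)
   ((p == k.-1 :> nat) * (q == k :> nat) + (((p < minn k.-1 k) && (maxn k.-1 k <= q) && E p q) +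
     ((p < minn k.+1 k) && (maxn k.+1 k <= q) && E p q))).
  rewrite cutE; apply: (sum2_le (F := fun p q => (p < k <= q) && E p q)
   (G := fun p q => (p == k.-1 :> nat) * (q == k :> nat) + (((p < minn k.-1 k) && (maxn k.-1 k <= q) && E p q) +
     ((p < minn k.+1 k) && (maxn k.+1 k <= q) && E p q)))) => p q _ _.
  case: (E p q); rewrite ?andbF // !andbT.
  case pk: (p < k); case kq: (k <= q) => //=.
  lia.
apply: (leq_trans H).
rewrite (sum2D (fun p q => (p == k.-1 :> nat) * (q == k :> nat))
  (fun p q => (((p < minn k.-1 k) && (maxn k.-1 k <= q) && E p q) +
     ((p < minn k.+1 k) && (maxn k.+1 k <= q) && E p q)))).
rewrite (sum2D (fun p q => ((p < minn k.-1 k) && (maxn k.-1 k <= q) && E p q))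
     (fun p q => ((p < minn k.+1 k) && (maxn k.+1 k <= q) && E p q))).
apply: leq_add => //.
rewrite (eq_bigr (fun p : 'I_n => (p == k.-1 :> nat) * \sum_(q < n) (q == k :> nat))).
  rewrite -big_distrl /= -[1]/(1 * 1); apply: leq_mul; exact: sum_eq_le.
by move=> p _; rewrite -big_distrr.
Qed.

Lemma ldeg_cut i : i < n -> ldeg i <= cut i.
Proof.
move=> lin; rewrite cutE exchange_big /= /ldeg.
rewrite -(sum_row (fun p q => (q < p) && E p q) lin).
apply: (sum2_le (F := fun p q => (p == i :> nat) * ((q < p) && E p q))
  (G := fun p q => (q < i <= p) && E q p)) => p q _ _.
by case: (p =P i) => // ->; rewrite mul1n leqnn andbT Esym.
Qed.

Lemma rdeg_cut i : i < n -> rdeg i <= cut i.+1.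
Proof.
move=> lin; rewrite cutE /rdeg.
rewrite -(sum_row (fun p q => (p < q) && E p q) lin).
apply: (sum2_le (F := fun p q => (p == i :> nat) * ((p < q) && E p q))
  (G := fun p q => (p < i.+1 <= q) && E p q)) => p q _ _.
by case: (p =P i) => // ->; rewrite mul1n ltnSn.
Qed.

(** At most k - i - 1 later neighbours of [i] lie before [k]; every other one gives an edge across
    both cuts. This is how the cut next to a small cut covers more distant gaps. *)
Lemma rdeg_cut2 i k : i < n -> i < k -> rdeg i <= cut2 i.+1 k + (k - i).-1.
Proof.
move=> lin ik.
have H : rdeg i <= \sum_(q < n) ((k <= q) && E i q) + \sum_(q < n) (i.+1 <= q < k).
  rewrite -big_split; apply: leq_sum => q _ /=.
  case: (E i q); rewrite ?andbF // !andbT.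
  by case: (ltnP i q) => //; case: (leqP k q).
apply: (leq_trans H); apply: leq_add; last by rewrite sum_interval; lia.
rewrite /cut2 -(sum_row (fun p q => (k <= q) && E p q) lin).
apply: (sum2_le (F := fun p q => (p == i :> nat) * ((k <= q) && E p q))
  (G := fun p q => (p < minn i.+1 k) && (maxn i.+1 k <= q) && E p q)) => p q _ _.
case: (p =P i) => // ->; rewrite mul1n; case: (E i q); rewrite ?andbF // !andbT.
by rewrite (_ : i < _); lia.
Qed.

Lemma ldeg_cut2 i k : i < n -> k <= i -> ldeg i <= cut2 i k + (i - k).
Proof.
move=> lin ki.
have H : ldeg i <= \sum_(q < n) ((q < k) && E i q) + \sum_(q < n) (k <= q < i).
  rewrite -big_split; apply: leq_sum => q _ /=.
  case: (E i q); rewrite ?andbF // !andbT.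
  by case: (ltnP q i) => //; case: (leqP k q).
apply: (leq_trans H); apply: leq_add; last by rewrite sum_interval; lia.
rewrite /cut2 exchange_big /= -(sum_row (fun p q => (q < k) && E p q) lin).
apply: (sum2_le (F := fun p q => (p == i :> nat) * ((q < k) && E p q))
  (G := fun p q => (q < minn i k) && (maxn i k <= p) && E q p)) => p q _ _.
case: (p =P i) => // ->; rewrite mul1n [E q i]Esym; case: (E i q); rewrite ?andbF // !andbT.
by rewrite (_ : maxn i k <= i); lia.
Qed.

End Cuts.

(** * Sums with few nonzero terms and sums over distances *)

Section SumLemmas.
Local Open Scope ring_scope.
Variable R : realDomainType.

Lemma sum_sparse m (P : pred nat) (F : nat -> R) :
    (forall i j, (i < m)%N -> (j < m)%N -> P i -> P j -> F i != 0 -> F j != 0 -> i = j) ->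
  \sum_(i < m | P i) F i = 0 \/
  exists i, [/\ (i < m)%N, P i, F i != 0 & \sum_(i < m | P i) F i = F i].
Proof.
move=> uF; case: (pickP (fun i : 'I_m => P i && (F i != 0))) => [i /andP[Pi Fi]|F0].
  right; exists i; split=> //; rewrite (bigD1 i) //= big1 ?addr0 // => j /andP[Pj /eqP ji].
  by have [//|Fj] := eqVneq (F j) 0; case: ji; apply: val_inj; apply: uF; rewrite ?ltn_ord.
by left; apply: big1 => i Pi; have := F0 i; rewrite Pi /= => /eqP.
Qed.

Lemma sum_ge_seq m (F : nat -> R) (s : seq nat) :
  uniq s -> all (fun i => (i < m)%N) s -> (forall i, (i < m)%N -> 0 <= F i) ->
  \sum_(i <- s) F i <= \sum_(i < m) F i.
Proof.
move=> us sm F0; rewrite -(big_mkord xpredT F) /index_iota subn0.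
rewrite [leRHS](bigID (mem s)) /=.
have -> : \sum_(i <- iota 0 m | i \in s) F i = \sum_(i <- s) F i.
  rewrite -big_filter; apply/perm_big/uniq_perm => //; first by rewrite filter_uniq ?iota_uniq.
  move=> x; rewrite mem_filter mem_iota add0n /=.
  by case xs: (x \in s) => //=; move/allP: sm => /(_ x xs).
rewrite lerDl big_seq_cond; apply: sumr_ge0 => i /andP[].
by rewrite mem_iota => /andP[_ im] _; apply: F0.
Qed.

Definition dist (i j : nat) : nat := ((i - j) + (j - i))%N.

Lemma sum_pick m (h : nat -> R) (t : nat) : (t < m)%N ->
  \sum_(i < m) h i * (i == t :> nat)%:R = h t.
Proof.
move=> tm; rewrite (bigD1 (Ordinal tm)) //= eqxx mulr1 big1 ?addr0 // => i /eqP it.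
case: eqP => // e; last by rewrite mulr0.
by case: it; apply: val_inj.
Qed.

Lemma sum_dist m (h : nat -> R) i K : (K <= i)%N -> (i + K < m)%N ->
    (forall t, (K < t)%N -> h t = 0) ->
  \sum_(g < m) h (dist i g) = h 0%N + 2 * \sum_(t < K) h t.+1.
Proof.
move=> Ki iK h0.
have E1 (g : nat) : h (dist i g) = h 0%N * (g == i)%:R +
   \sum_(t < K) h t.+1 * ((g == i + t.+1)%N%:R + (g == i - t.+1)%N%:R).
  case: (ltngtP g i) => gi.
  - rewrite mulr0 add0r; case: (leqP (i - g) K) => igK.
      rewrite (eq_bigr (fun t : 'I_K => h t.+1 * (t == (i - g).-1 :> nat)%:R)).
        rewrite (sum_pick (fun t => h t.+1)); last by lia.
        by congr h; rewrite /dist; lia.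
      move=> t _; congr (_ * _); rewrite (_ : (g == i + t.+1)%N = false) ?add0r; last by lia.
      by congr (nat_of_bool _)%:R; have := ltn_ord t; lia.
    rewrite h0 ?big1 //; last by rewrite /dist; lia.
    move=> t _; have := ltn_ord t => tK; rewrite (_ : (g == i + t.+1)%N = false); last by lia.
    by rewrite (_ : (g == i - t.+1)%N = false) ?addr0 ?mulr0 //; lia.
  - rewrite mulr0 add0r; case: (leqP (g - i) K) => igK.
      rewrite (eq_bigr (fun t : 'I_K => h t.+1 * (t == (g - i).-1 :> nat)%:R)).
        rewrite (sum_pick (fun t => h t.+1)); last by lia.
        by congr h; rewrite /dist; lia.
      move=> t _; congr (_ * _); rewrite (_ : (g == i - t.+1)%N = false) ?addr0; last by lia.
      by congr (nat_of_bool _)%:R; have := ltn_ord t; lia.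
    rewrite h0 ?big1 //; last by rewrite /dist; lia.
    move=> t _; have := ltn_ord t => tK; rewrite (_ : (g == i + t.+1)%N = false); last by lia.
    by rewrite (_ : (g == i - t.+1)%N = false) ?addr0 ?mulr0 //; lia.
  - rewrite gi mulr1 big1 ?addr0; first by congr h; rewrite /dist; lia.
    move=> t _; have := ltn_ord t => tK; rewrite (_ : (i == i + t.+1)%N = false); last by lia.
    by rewrite (_ : (i == i - t.+1)%N = false) ?addr0 ?mulr0 //; lia.
under eq_bigr => g _ do rewrite E1.
rewrite big_split /= (sum_pick (fun _ => h 0%N)); last by lia.
congr (_ + _); rewrite exchange_big /= mulr_sumr; apply: eq_bigr => t _.
have := ltn_ord t => tK; rewrite -mulr_sumr big_split /=.
have S1 j : (j < m)%N -> \sum_(i < m) (i == j :> nat)%:R = 1 :> R.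
  by move=> jm; rewrite -[RHS](sum_pick (fun=> 1) jm); apply: eq_bigr => ? _; rewrite mul1r.
rewrite !S1; [by rewrite mulrC|lia|lia].
Qed.

End SumLemmas.

(** * The multipliers *)

Section Multiplier.
Local Open Scope ring_scope.
Variables (R : realFieldType) (n d : nat) (E : rel nat).
Hypothesis Esym : symmetric E.
Hypothesis Eirr : irreflexive E.
Hypothesis d3 : (3 <= d)%N.
Hypothesis degE : forall p, (p < n)%N -> (d <= deg n E p)%N.
Hypothesis cut_gt0 : forall i, (0 < i < n)%N -> (0 < cut n E i)%N.

Local Notation c := (cut n E).

Definition small i := (0 < i < n)%N && (2 * c i < d)%N.
Definition room i := (d - c i)%N.

Lemma dist_growth i g : (i <= n)%N -> (g <= n)%N ->
  (dist i g * (d.+1 - dist i g) <= c i + c g)%N.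
Proof.
move=> lin lgn; case: (leqP i g) => ig.
  by rewrite (_ : dist i g = g - i)%N; [apply: cut_growth; rewrite ?ig|rewrite /dist; lia].
rewrite (_ : dist i g = i - g)%N ?[(c i + _)%N]addnC; last by rewrite /dist; lia.
by apply: cut_growth; rewrite ?(ltnW ig).
Qed.

Lemma small_lt i : small i -> (0 < i < n)%N. Proof. by case/andP. Qed.
Lemma small_cut i : small i -> (2 * c i < d)%N. Proof. by case/andP. Qed.
Lemma small_gt0 i : small i -> (0 < c i)%N. Proof. by move/small_lt/cut_gt0. Qed.

(** For 1 <= m <= d the product m (d + 1 - m) is at least d, while two small cuts have sizes adding
    up to less than d. *)
Lemma small_sep i j : small i -> small j -> i != j -> (d < dist i j)%N.
Proof.
move=> si sj ij; have := small_cut si; have := small_cut sj.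
have := small_lt si; have := small_lt sj => /andP[j0 jn] /andP[i0 lin].
have := dist_growth (ltnW lin) (ltnW jn).
have : (0 < dist i j)%N by rewrite /dist; lia.
by move: (dist i j) => m; case: (ltnP d m) => // md; nia.
Qed.

(** The argument of [small_sep] against the trivial cuts 0 and n, whose size is 0. *)
Lemma small_ends i : small i -> (d < i)%N /\ (i + d < n)%N.
Proof.
move=> si; have := small_cut si; have /andP[i0 lin] := small_lt si => ci.
have := dist_growth (ltnW lin) (leq0n n); have := dist_growth (ltnW lin) (leqnn n).
rewrite cut0 cutn (_ : dist i n = n - i)%N 1?(_ : dist i 0 = i)%N; try by rewrite /dist; lia.
move=> H1 H2; split.
  by case: (ltnP d i) => // id; nia.
have m0 : (0 < n - i)%N by lia.
suff : (d < n - i)%N by lia.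
by move: (n - i)%N H1 m0 => m {}H1 m0; case: (ltnP d m) => // id; nia.
Qed.

(** With a = c i, m the distance and u = d + 1 - m, one has m u = (m - 1) (u - 1) + d. Here m >= 2
    and u >= a give (m - 1) (u - 1) >= a - 1, so m u - a >= d - 1. *)
Lemma small_far i g : small i -> (g <= n)%N -> (2 <= dist i g <= (room i).+1)%N ->
  (d <= (c g).+1)%N.
Proof.
move=> si gn; have := small_cut si; have /andP[i0 lin] := small_lt si => ci.
have := dist_growth (ltnW lin) gn; have := small_gt0 si.
rewrite /room; move: (dist i g) (c i) (c g) ci => m a b ab a0.
move=> H /andP[m2 mK]; have -> : d = (m + (d.+1 - m)).-1 by lia.
have ua : (a <= d.+1 - m)%N by lia.
by move: (d.+1 - m)%N ua H => u ua H; nia.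
Qed.

Definition weight i g : R := ((room i).+1 - dist i g)%:R / (room i)%:R.
Definition beta g : R := \sum_(i < n.+1 | small i) weight i g.
(** One slack small enough for all four kinds of defect. The tightest demand, in [cov_isolated], is
    that it be at most the inverse of (d - 1)^2 (2 d - 3). *)
Definition kappa : R := (2 * d%:R ^+ 3)^-1.

(* Places where the multipliers have slack kappa: just after a bridge b with no small cut at
   b + d + 1; just after a bridge b whose right end has d later neighbours, as in a block K_(d+1);
   at a small cut of size at least 2; and at a large cut far from all small cuts. *)
Definition isolated_defect g :=
  [&& (1 < g)%N, small (g - 2), c (g - 2) == 1%N & ~~ small (g - 2 + d.+1)].
Definition complete_defect g :=
  [&& (0 < g)%N, small g.-1, c g.-1 == 1%N & (d <= rdeg n E g.-1)%N].
Definition wide_defect g := small g && (1 < c g)%N.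
Definition plain_defect g :=
  [&& (0 < g < n)%N, (d <= (c g.-1).+1)%N, (d <= (c g).+1)%N, (d <= (c g.+1).+1)%N &
      [forall i : 'I_n.+1, small i ==> (d < dist i g)%N]].
Definition defect g := [|| isolated_defect g, complete_defect g, wide_defect g | plain_defect g].

(* With a = c i and K = room i for a small cut i, each of the two vertices next to the cut has K
   neighbours on its own side of the cut, so the value 1 / K at i + 1 already covers the share
   (K + 1 - m) / K of the gap i + m (this is [weight], summed in [beta]); the remaining gaps only
   need to cover 1 - beta. Covering cut i itself then leaves (d + 1 - 2 a) / (a K) for it. *)
Definition mult g : R :=
  if small g then (d.+1 - 2 * c g)%:R / ((c g)%:R * (room g)%:R)
  else if small g.-1 then ((room g.-1)%:R)^-1 - kappa *+ complete_defect g
  else if small g.+1 then ((room g.+1)%:R)^-1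
  else (1 - beta g) / (d%:R - 1) - kappa *+ (isolated_defect g || plain_defect g).

Lemma d_ge3 : 3 <= d%:R :> R. Proof. by rewrite (ler_nat _ 3). Qed.

Lemma kappa_gt0 : 0 < kappa.
Proof. by have := d_ge3 => D3; rewrite invr_gt0 mulr_gt0 // exprn_gt0 //; lra. Qed.

Lemma room_bounds i : small i -> [/\ (0 < room i)%N, (room i < d)%N & (c i < room i)%N].
Proof. by move=> si; have := small_cut si; have := small_gt0 si; rewrite /room; split; lia. Qed.

Lemma roomE i : small i -> (room i)%:R = d%:R - (c i)%:R :> R.
Proof. by move/small_cut => ?; rewrite /room natrB //; lia. Qed.

Lemma weight_ge0 i g : 0 <= weight i g.
Proof. by rewrite mulr_ge0 ?invr_ge0 ?ler0n. Qed.

Lemma weightE i g : small i -> (dist i g <= (room i).+1)%N ->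
  weight i g = ((room i)%:R + 1 - (dist i g)%:R) / (room i)%:R.
Proof. by move=> si h; rewrite /weight natrB // -natr1. Qed.

Lemma weight_neq0 i g : weight i g != 0 -> (dist i g <= room i)%N.
Proof. by rewrite /weight; case: (leqP (dist i g) (room i)) => // /eqP ->; rewrite mul0r eqxx. Qed.

(** At distance t the weight is 1 - (t - 1) / K with K = room i; this increases with K, and K <= d -
    1. *)
Lemma weight_le i g : small i -> (1 <= dist i g <= room i)%N ->
  weight i g <= (d%:R - (dist i g)%:R) / (d%:R - 1).
Proof.
move=> si /andP[t1 tK]; rewrite weightE //; last exact: leqW.
have [K0 Kd _] := room_bounds si; have D3 := d_ge3.
have K0R : 0 < (room i)%:R :> R by rewrite ltr0n.
have KdR : (room i)%:R + 1 <= d%:R :> R by rewrite natr1 ler_nat.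
have t1R : 1 <= (dist i g)%:R :> R by rewrite (ler_nat _ 1).
rewrite ler_pdivlMr; last lra.
rewrite mulrAC ler_pdivrMr //.
move: (room i)%:R (dist i g)%:R d%:R K0R KdR t1R D3 => k t D K0R KdR t1R D3.
have : 0 <= (t - 1) * (D - 1 - k) by apply: mulr_ge0; lra.
nra.
Qed.

(** Nonzero weight means distance less than d, so two contributing small cuts on the same side of
    [g] would violate [small_sep]. *)
Lemma beta_left_cases g : (g <= n)%N ->
  \sum_(i < n.+1 | small i && (i < g)%N) weight i g = 0 \/
  exists i, [/\ small i, (i < g)%N, (dist i g <= room i)%N &
    \sum_(i < n.+1 | small i && (i < g)%N) weight i g = weight i g].
Proof.
move=> gn.
have [i j _ _ /andP[si ig] /andP[sj jg] /weight_neq0 wi /weight_neq0 wj|H|[i [_ /andP[si ig] /weight_neq0 wi E1]]] :=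
  @sum_sparse R n.+1 (fun i => small i && (i < g)%N) (weight^~ g).
- have [//|/(small_sep si sj)] := eqVneq i j.
  have [_ + _] := room_bounds si; have [_ + _] := room_bounds sj.
  by move: wi wj; rewrite /dist; lia.
- by left.
- by right; exists i.
Qed.

Lemma beta_right_cases g : (g <= n)%N -> ~~ small g ->
  \sum_(i < n.+1 | small i && ~~ (i < g)%N) weight i g = 0 \/
  exists i, [/\ small i, (g < i)%N, (dist i g <= room i)%N &
    \sum_(i < n.+1 | small i && ~~ (i < g)%N) weight i g = weight i g].
Proof.
move=> gn ng.
have [i j _ _ /andP[si ig] /andP[sj jg] /weight_neq0 wi /weight_neq0 wj|H|[i [_ /andP[si ig] /weight_neq0 wi E1]]] :=
  @sum_sparse R n.+1 (fun i => small i && ~~ (i < g)%N) (weight^~ g).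
- have [//|/(small_sep si sj)] := eqVneq i j.
  have [_ + _] := room_bounds si; have [_ + _] := room_bounds sj.
  by move: wi wj; rewrite /dist; lia.
- by left.
- right; exists i; split => //; rewrite ltn_neqAle leqNgt ig andbT.
  by apply: contraNneq ng => ->.
Qed.

Lemma betaE g : beta g = \sum_(i < n.+1 | small i && (i < g)%N) weight i g +
   \sum_(i < n.+1 | small i && ~~ (i < g)%N) weight i g.
Proof. by rewrite /beta (bigID (fun i : 'I_n.+1 => (i < g)%N)). Qed.

Lemma beta_ge0 g : 0 <= beta g.
Proof. by apply: sumr_ge0 => i _; apply: weight_ge0. Qed.

(** At most one small cut contributes on each side. If both do, at distances s and t, then s + t >=
    d + 1, and the bounds (d - s) / (d - 1) and (d - t) / (d - 1) add up to at most 1. *)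
Lemma beta_le1 g : (g <= n)%N -> ~~ small g -> beta g <= 1.
Proof.
move=> gn ng; have D3 := d_ge3; rewrite betaE.
have D1 : 0 < d%:R - 1 :> R by lra.
have H i t : small i -> dist i g = t -> (1 <= t <= room i)%N -> weight i g * (d%:R - 1) <= d%:R - t%:R.
  by move=> si e h; have := @weight_le i g si; rewrite e => /(_ h); rewrite ler_pdivlMr.
rewrite -(ler_pM2r D1) mul1r mulrDl.
have [->|[i [si ig iK ->]]] := beta_left_cases gn; have [->|[j [sj jg jK ->]]] := beta_right_cases gn ng.
- lra.
- have t1 : (1 <= dist j g)%N by rewrite /dist; lia.
  have := H j _ sj erefl; rewrite jK t1 => /(_ isT).
  have : 1 <= (dist j g)%:R :> R by rewrite (ler_nat _ 1).
  by move: (weight j g * _) => X; lra.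
- have t1 : (1 <= dist i g)%N by rewrite /dist; lia.
  have := H i _ si erefl; rewrite iK t1 => /(_ isT).
  have : 1 <= (dist i g)%:R :> R by rewrite (ler_nat _ 1).
  by move: (weight i g * _) => X; lra.
- have t1 : (1 <= dist i g)%N by rewrite /dist; lia.
  have t2 : (1 <= dist j g)%N by rewrite /dist; lia.
  have := H i _ si erefl; rewrite iK t1 => /(_ isT).
  have := H j _ sj erefl; rewrite jK t2 => /(_ isT).
  have : (d < dist i g + dist j g)%N.
    have ij : i != j by apply: contraTneq ig => ->; rewrite -leqNgt ltnW.
    by have := small_sep si sj ij; rewrite /dist; lia.
  rewrite -(ler_nat R) natrD -natr1.
  by move: (weight i g * _) (weight j g * _) => X Y; lra.
Qed.


Lemma beta_eq0 g : (forall i, small i -> (room i < dist i g)%N) -> beta g = 0.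
Proof.
move=> H; apply: big1 => i si; apply/eqP; apply: contraTT (H i si).
by rewrite -leqNgt; exact: weight_neq0.
Qed.

(** A small cut to the right of [g] within reach could only be at g - 2 + (d + 1), which is
    excluded; one on the left is at distance at least 2 and contributes at most (d - 2) / (d -
    1). *)
Lemma beta_isolated g : (g <= n)%N -> isolated_defect g -> ~~ small g ->
  beta g * (d%:R - 1) <= d%:R - 2.
Proof.
move=> gn /and4P[g2 sb /eqP cb nb] ng; have D3 := d_ge3.
have D1 : 0 < d%:R - 1 :> R by lra.
rewrite betaE mulrDl.
have -> : \sum_(i < n.+1 | small i && ~~ (i < g)%N) weight i g = 0.
  have [->//|[j [sj jg jK _]]] := beta_right_cases gn ng.
  have jb : j != (g - 2)%N by apply/eqP; lia.
  have [_ + _] := room_bounds sj => Kj.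
  have := small_sep sj sb jb; move: nb jK; rewrite /dist => nb jK bj.
  have ej : j = (g - 2 + d.+1)%N by lia.
  by rewrite -ej sj in nb.
rewrite mul0r addr0; have [->|[i [si ig iK ->]]] := beta_left_cases gn; first by lra.
have t1 : (2 <= dist i g)%N.
  have [ib|ib] := eqVneq i (g - 2)%N; first by rewrite /dist; lia.
  by have := small_sep si sb ib; rewrite /dist; lia.
have := @weight_le i g si; rewrite iK (ltnW t1) => /(_ isT).
rewrite ler_pdivlMr //; have : 2 <= (dist i g)%:R :> R by rewrite (ler_nat _ 2).
by move: (weight i g * _) => X; lra.
Qed.

Lemma isolated_defectP g : isolated_defect g -> ~~ small g /\ (g <= n)%N.
Proof.
move=> /and4P[g2 sb _ _]; have [_ gn] := small_ends sb; split; last by lia.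
apply/negP => sg; have := small_sep sb sg; rewrite /dist => /(_ ltac:(apply/eqP; lia)).
lia.
Qed.

Lemma plain_defectP g : plain_defect g -> forall i, small i -> (d < dist i g)%N.
Proof.
move=> /and5P[_ _ _ _ /forallP H] i si.
have /andP[_ lin] := small_lt si.
by have := H (Ordinal (ltnW lin : (i < n.+1)%N)); rewrite si.
Qed.

Lemma plain_defect_beta g : plain_defect g -> beta g = 0.
Proof.
move=> g5; apply: beta_eq0 => i si; have [_ Kd _] := room_bounds si.
exact: ltn_trans Kd (plain_defectP g5 si).
Qed.

Lemma kappa_le (x : R) : 0 < x -> x <= 2 * d%:R ^+ 3 -> kappa <= x^-1.
Proof.
have D3 := d_ge3; move=> x0 xd; rewrite /kappa lef_pV2 // posrE.
by rewrite mulr_gt0 // exprn_gt0 //; lra.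
Qed.

Lemma mult_far g : ~~ small g -> ~~ small g.-1 -> ~~ small g.+1 ->
  mult g = (1 - beta g) / (d%:R - 1) - kappa *+ (isolated_defect g || plain_defect g).
Proof. by rewrite /mult => /negbTE-> /negbTE-> /negbTE->. Qed.

Lemma mult_right i : small i -> mult i.+1 = ((room i)%:R)^-1 - kappa *+ complete_defect i.+1.
Proof.
move=> si; rewrite /mult /= si; case: ifP => // si'.
by have := small_sep si si'; rewrite /dist => /(_ ltac:(apply/eqP; lia)); lia.
Qed.

Lemma mult_left i : small i -> mult i.-1 = ((room i)%:R)^-1.
Proof.
move=> si; have /andP[i0 _] := small_lt si; rewrite /mult (prednK i0) si.
case: ifP => [si'|_].
  by have := small_sep si si'; rewrite /dist => /(_ ltac:(apply/eqP; lia)); lia.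
case: ifP => // si'; have /andP[i0' _] := small_lt si'.
by have := small_sep si si'; rewrite /dist => /(_ ltac:(apply/eqP; lia)); lia.
Qed.

Lemma inv_room_bounds i : small i -> [/\ 0 < ((room i)%:R)^-1 :> R, ((room i)%:R)^-1 <= 1 :> R
  & (d%:R - 1)^-1 <= ((room i)%:R)^-1 :> R].
Proof.
move=> si; have [K0 Kd _] := room_bounds si; have D3 := d_ge3.
have K0R : 1 <= (room i)%:R :> R by rewrite (ler_nat _ 1).
have KdR : (room i)%:R + 1 <= d%:R :> R by rewrite natr1 ler_nat.
split; first by rewrite invr_gt0; lra.
  by rewrite invf_le1; lra.
by rewrite lef_pV2 ?posrE; lra.
Qed.

Lemma kappa_le_invd : kappa <= (d%:R - 1)^-1 - d%:R^-1.
Proof.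
have D3 := d_ge3.
have -> : (d%:R - 1)^-1 - d%:R^-1 = (d%:R * (d%:R - 1))^-1 :> R.
  by field; apply/andP; split; apply/eqP; lra.
apply: kappa_le; first by apply: mulr_gt0; lra.
by move: d%:R D3 => D D3; nra.
Qed.

Lemma mult_bounds g : (g <= n)%N -> 0 <= mult g <= 1.
Proof.
move=> gn; have D3 := d_ge3; have k0 := kappa_gt0; have kd := kappa_le_invd.
have di0 : 0 < d%:R^-1 :> R by rewrite invr_gt0; lra.
have d1i0 : 0 < (d%:R - 1)^-1 :> R by rewrite invr_gt0; lra.
have d1i1 : (d%:R - 1)^-1 <= 1 :> R by rewrite invf_le1; lra.
rewrite {1 2}/mult; case: ifP => sg.
  rewrite mulr_ge0 ?invr_ge0 ?mulr_ge0 ?ler0n //=.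
  have := small_cut sg; have := small_gt0 sg; have [K0 _ cK] := room_bounds sg => c0 cd.
  rewrite -natrM ler_pdivrMr ?ltr0n ?muln_gt0 ?c0 // mul1r ler_nat.
  by move: K0 cK c0 cd; rewrite /room; nia.
case: ifP => sg1.
  have [i0 i1 i2] := inv_room_bounds sg1.
  by case: (complete_defect g); rewrite ?mulr1n ?mulr0n; apply/andP; split; lra.
case: ifP => sg2; first by have [i0 i1 i2] := inv_room_bounds sg2; apply/andP; split; lra.
have b1 := beta_le1 gn (negbT sg); have b0 := beta_ge0 g.
have Q : (1 - beta g) / (d%:R - 1) <= 1.
  by rewrite ler_pdivrMr; lra.
have Q0 : 0 <= (1 - beta g) / (d%:R - 1) by apply: mulr_ge0; lra.
case: (boolP (isolated_defect g)) => g1 /=; last first.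
  case: (boolP (plain_defect g)) => [/plain_defect_beta ->|_] /=; rewrite ?mulr1n ?mulr0n.
    by rewrite subr0 mul1r; apply/andP; split; lra.
  by apply/andP; split; lra.
have H := beta_isolated gn g1 (negbT sg).
rewrite mulr1n; apply/andP; split; last lra.
have : ((d%:R - 1)^+2)^-1 <= (1 - beta g) / (d%:R - 1).
  rewrite ler_pdivlMr; last lra.
  rewrite ler_pdivrMl; last by apply: exprn_gt0; lra.
  have -> : (d%:R - 1) ^+ 2 * (1 - beta g) = (d%:R - 1) * (d%:R - 1 - beta g * (d%:R - 1)) by ring.
  rewrite -[leLHS]mulr1; apply: ler_wpM2l; lra.
have : kappa <= ((d%:R - 1)^+2)^-1.
  apply: kappa_le; first by apply: exprn_gt0; lra.
  by move: d%:R D3 => D D3; nra.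
lra.
Qed.


Definition near_cut2 i k : nat := if (dist i k <= d)%N then cut2 n E i k else 0%N.
Definition coverage k : R := \sum_(i < n.+1) mult i * (near_cut2 i k)%:R.

Lemma near_cut2E i k : (dist i k <= d)%N -> near_cut2 i k = cut2 n E i k.
Proof. by rewrite /near_cut2 => ->. Qed.

Lemma near_cut2_diag k : near_cut2 k k = c k.
Proof. by rewrite near_cut2E // /dist; lia. Qed.

Lemma cov_ge (s : seq nat) k : uniq s -> all (fun i => (i < n.+1)%N) s ->
  \sum_(i <- s) mult i * (near_cut2 i k)%:R <= coverage k.
Proof.
move=> us sn; apply: (sum_ge_seq (F := fun i => mult i * (near_cut2 i k)%:R)) => // i lin.
by have /andP[y0 _] := mult_bounds (lin : (i <= n)%N); rewrite mulr_ge0 ?ler0n.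
Qed.

Lemma room_rdeg i : small i -> (room i <= rdeg n E i)%N.
Proof.
move=> si; have /andP[_ lin] := small_lt si.
have := degE lin; rewrite deg_split //; have := ldeg_cut Esym lin.
by rewrite /room; lia.
Qed.

Lemma room_ldeg i : small i -> (room i <= ldeg n E i.-1)%N.
Proof.
move=> si; have /andP[i0 lin] := small_lt si.
have lin' : (i.-1 < n)%N by lia.
have := degE lin'; rewrite deg_split //; have := rdeg_cut E lin'.
by rewrite (prednK i0) /room; lia.
Qed.

(** Vertex [i] has at least K = room i later neighbours, so at least K + 1 - t edges cross both
    cuts, where t = k - i. At a complete defect K = d - 1 and there are d later neighbours; the
    extra edge pays for the loss of [kappa]. *)
Lemma right_term i k : small i -> (i < k)%N -> (dist i k <= room i)%N ->
  weight i k <= mult i.+1 * (near_cut2 i.+1 k)%:R.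
Proof.
move=> si ik iK; have /andP[i0 lin] := small_lt si.
have [K0 Kd cK] := room_bounds si; have D3 := d_ge3; have kd := kappa_le_invd.
have D0 : 0 < d%:R :> R by lra.
have dk : dist i k = (k - i)%N by rewrite /dist; lia.
rewrite mult_right // weightE ?(leqW iK) // near_cut2E; last by move: iK; rewrite /dist; lia.
have H := rdeg_cut2 E lin ik; have HK := room_rdeg si.
have K0R : 0 < (room i)%:R :> R by rewrite ltr0n.
have t1 : 1 <= (dist i k)%:R :> R by rewrite (ler_nat _ 1) dk; lia.
case: (boolP (complete_defect i.+1)) => [/and4P[_ _ /eqP /= ci rd]|_]; rewrite ?mulr1n ?mulr0n.
  have C : d%:R + 1 - (dist i k)%:R <= (cut2 n E i.+1 k)%:R :> R.
    rewrite natr1 -natrB ?ler_nat; last by rewrite dk; lia.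
    by move: iK; rewrite dk; lia.
  have KE : (room i)%:R = d%:R - 1 :> R by rewrite roomE // ci.
  have tK : (dist i k)%:R <= (room i)%:R :> R by rewrite ler_nat.
  have A : d%:R^-1 * (d%:R + 1 - (dist i k)%:R) <=
           ((room i)%:R^-1 - kappa) * (cut2 n E i.+1 k)%:R.
    apply: ler_pM => //; [by rewrite invr_ge0; lra|lra|rewrite KE; lra].
  apply: le_trans A; rewrite ler_pdivrMr // -mulrA ler_pdivlMl // KE.
  by move: t1; move: (dist i k)%:R d%:R D3 => t D D3; nra.
rewrite subr0 mulrC ler_wpM2l ?invr_ge0 ?ler0n //.
rewrite natr1 -natrB ?ler_nat; [lia|exact: leqW].
Qed.

Lemma left_term i k : small i -> (k < i)%N -> (dist i k <= room i)%N ->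
  weight i k <= mult i.-1 * (near_cut2 i.-1 k)%:R.
Proof.
move=> si ik iK; have /andP[i0 lin] := small_lt si.
have [K0 Kd cK] := room_bounds si.
have dk : dist i k = (i - k)%N by rewrite /dist; lia.
rewrite mult_left // weightE ?(leqW iK) // near_cut2E; last by move: iK; rewrite /dist; lia.
have lin' : (i.-1 < n)%N by lia.
have ik' : (k <= i.-1)%N by lia.
have H := ldeg_cut2 Esym lin' ik'; have HK := room_ldeg si.
rewrite mulrC ler_wpM2l ?invr_ge0 ?ler0n //.
rewrite natr1 -natrB ?ler_nat; [lia|exact: leqW].
Qed.

(** The cuts next to the at most two small cuts in reach, on the side facing [k], contribute
    [beta k]; cut [k] itself contributes the other term. The hypotheses on [k.-1] and [k.+1] keep
    these indices distinct. *)
Lemma cov_far k : (0 < k < n)%N -> ~~ small k -> ~~ small k.-1 -> ~~ small k.+1 ->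
  mult k * (c k)%:R + beta k <= coverage k.
Proof.
move=> /andP[k0 kn] nk nk1 nk2; rewrite betaE.
have L i : small i -> (i < k)%N -> (i.+1 < k)%N.
  by move=> si ik; rewrite ltn_neqAle ik andbT; apply: contraNneq nk1 => <-.
have G i : small i -> (k < i)%N -> (k.+1 < i)%N.
  by move=> si ik; rewrite ltn_neqAle ik andbT; apply: contraNneq nk2 => ->.
have [->|[i [si ig iK ->]]] := beta_left_cases (ltnW kn); have [->|[j [sj jg jK ->]]] := beta_right_cases (ltnW kn) nk.
- have := @cov_ge [:: k] k isT; rewrite big_seq1 near_cut2_diag /= ltnS ltnW // => /(_ isT); lra.
- have := @cov_ge [:: k; j.-1] k; rewrite !big_cons big_nil near_cut2_diag /= !inE.
  have := left_term sj jg jK; have := G _ sj jg; have /andP[_ jn] := small_lt sj => jg2 lt.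
  rewrite (_ : (k == j.-1) = false) /=; last by lia.
  by rewrite (_ : (k < n.+1)%N && _) /= => [/(_ isT isT)|]; [lra|lia].
- have := @cov_ge [:: k; i.+1] k; rewrite !big_cons big_nil near_cut2_diag /= !inE.
  have := right_term si ig iK; have := L _ si ig => jg2 lt.
  rewrite (_ : (k == i.+1) = false) /=; last by lia.
  by rewrite (_ : (k < n.+1)%N && _) /= => [/(_ isT isT)|]; [lra|lia].
- have := @cov_ge [:: k; i.+1; j.-1] k; rewrite !big_cons big_nil near_cut2_diag /= !inE.
  have := left_term sj jg jK; have := G _ sj jg; have /andP[_ jn] := small_lt sj => jg2 lt.
  have := right_term si ig iK; have := L _ si ig => jg3 lt3.
  rewrite (_ : (_ == i.+1) || _ = false) /=; last by lia.
  rewrite (_ : (i.+1 == j.-1) = false) /=; last by lia.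
  by rewrite (_ : (k < n.+1)%N && _) /= => [/(_ isT isT)|]; [lra|lia].
Qed.

(* Every edge across cut k, except the one joining k - 1 to k, also crosses cut k - 1 or k + 1. *)
Lemma cov_adj k m : (0 < k < n)%N -> 0 <= m -> m <= mult k.-1 -> m <= mult k.+1 ->
  mult k * (c k)%:R + ((c k)%:R - 1) * m <= coverage k.
Proof.
move=> /andP[k0 kn] m0 m1 m2.
have := @cov_ge [:: k; k.-1; k.+1] k; rewrite !big_cons big_nil near_cut2_diag /= !inE.
rewrite (_ : _ || _ = false) /=; last by lia.
rewrite (_ : (k.-1 == k.+1) = false) /=; last by lia.
rewrite (_ : (k < n.+1)%N && _) /= => [/(_ isT isT)|]; last by lia.
rewrite !near_cut2E; try by rewrite /dist; lia.
have := cut_adj n E k; rewrite -(ler_nat R) !natrD.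
move: (cut2 n E k.-1 k) (cut2 n E k.+1 k) => a b H1 H2.
have A0 : 0 <= a%:R :> R by rewrite ler0n.
have B0 : 0 <= b%:R :> R by rewrite ler0n.
have A1 := ler_wpM2r A0 m1; have B1 := ler_wpM2r B0 m2.
have : ((c k)%:R - 1) * m <= (a%:R + b%:R) * m by apply: ler_wpM2r => //; lra.
lra.
Qed.

Lemma cov_own k : (0 < k < n)%N -> mult k * (c k)%:R <= coverage k.
Proof.
move=> /andP[k0 kn]; have := @cov_ge [:: k] k isT.
by rewrite big_seq1 near_cut2_diag /= ltnS ltnW // => /(_ isT).
Qed.


Lemma mult_plain g : (forall i, small i -> (room i < dist i g)%N /\ (1 < dist i g)%N) ->
  mult g = (d%:R - 1)^-1 - kappa *+ (isolated_defect g || plain_defect g).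
Proof.
move=> H; have N i : (dist i g <= 1)%N -> ~~ small i.
  by move=> ig; apply/negP => /H[_]; rewrite ltnNge ig.
rewrite mult_far ?N //; try by rewrite /dist; lia.
by rewrite beta_eq0 ?subr0 ?mul1r // => i /H[].
Qed.

Lemma cov_small k : small k -> 1 <= coverage k.
Proof.
move=> sk; have kn := small_lt sk; have [K0 Kd cK] := room_bounds sk.
have yk : mult k = (d.+1 - 2 * c k)%:R / ((c k)%:R * (room k)%:R) by rewrite /mult sk.
have c0 := small_gt0 sk; have cd := small_cut sk.
have c0R : 0 < (c k)%:R :> R by rewrite ltr0n.
have K0R : 0 < (room k)%:R :> R by rewrite ltr0n.
have dE : (d.+1 - 2 * c k)%:R = (room k)%:R + 1 - (c k)%:R :> R.
  rewrite roomE // natrB; last by lia.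
  by rewrite -natr1 natrM; ring.
have [i0 i1 _] := inv_room_bounds sk.
have [c1|c1] := eqVneq (c k) 1%N.
  apply: le_trans (cov_own kn); rewrite yk dE c1 mul1r.
  by rewrite le_eqVlt; apply/orP; left; apply/eqP; field; apply/eqP; lra.
have := @cov_adj k (room k)%:R^-1 kn (ltW i0); rewrite mult_left // mult_right //.
rewrite /complete_defect /= (negbTE c1) !andbF subr0 yk dE => /(_ (lexx _) (lexx _)).
apply: le_trans; rewrite le_eqVlt; apply/orP; left; apply/eqP.
by field; apply/andP; split; apply/eqP; lra.
Qed.

(** By [small_far] a cut of size below d - 1 has no small cut [i] within distance room i + 1. Hence
    [k] and its two neighbours all have multiplier 1 / (d - 1) without slack, and [cov_adj] gives (2
    c - 1) / (d - 1), where 2 c >= d because [k] is not small. *)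
Lemma cov_mid k : (0 < k < n)%N -> ~~ small k -> ~~ small k.-1 -> ~~ small k.+1 ->
  ((c k).+1 < d)%N -> 1 <= coverage k.
Proof.
move=> kn nk nk1 nk2 ck; have /andP[k0 lkn] := kn; have D3 := d_ge3.
have H i : small i -> ((room i).+1 < dist i k)%N.
  move=> si; rewrite ltnNge; apply/negP => ik.
  have [i0|i0] := ltnP (dist i k) 2.
    have : (i == k) || (i == k.-1) || (i == k.+1) by move: i0; rewrite /dist; lia.
    by move=> /orP[/orP[]|] /eqP ei; move: nk nk1 nk2; rewrite -ei si.
  by have := small_far si (ltnW lkn); rewrite i0 ik => /(_ isT); rewrite leqNgt ck.
have P g : (dist k g = 1)%N -> mult g = (d%:R - 1)^-1.
  move=> kg; rewrite mult_plain => [|i si]; last first.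
    by have := H i si; have [K0 _ _] := room_bounds si; move: kg; rewrite /dist; lia.
  rewrite (_ : isolated_defect g || plain_defect g = false) ?subr0 //; apply/negP => /orP[/and4P[g2 sg /eqP cg _]|/and5P[_ h1 h2 h3 _]].
    have := H _ sg; have [K0 _ _] := room_bounds sg; rewrite {1}/room cg.
    by move: kg; rewrite /dist; lia.
  have : (k == g.-1) || (k == g.+1) by move: kg; rewrite /dist; lia.
  by move=> /orP[] /eqP kE; move: h1 h3; rewrite -kE; lia.
have yk : mult k = (d%:R - 1)^-1.
  rewrite mult_plain => [|i si]; last first.
    by have := H i si; have [K0 _ _] := room_bounds si; rewrite /dist; lia.
  rewrite (_ : isolated_defect k || plain_defect k = false) ?subr0 //; apply/negP => /orP[/and4P[g2 sg /eqP cg _]|/and5P[_ h1 h2 h3 _]].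
    have := H _ sg; have [K0 _ _] := room_bounds sg; rewrite {1}/room cg.
    by rewrite /dist; lia.
  by move: ck; rewrite ltnNge h2.
have di : 0 < (d%:R - 1)^-1 :> R by rewrite invr_gt0; lra.
have := @cov_adj k (d%:R - 1)^-1 kn (ltW di); rewrite yk !P; try by rewrite /dist; lia.
move=> /(_ (lexx _) (lexx _)); apply: le_trans.
have -> : (d%:R - 1)^-1 * (c k)%:R + ((c k)%:R - 1) / (d%:R - 1) = (2 * (c k)%:R - 1) / (d%:R - 1) :> R by ring.
rewrite ler_pdivlMr; last lra.
rewrite mul1r; suff : d%:R <= 2 * (c k)%:R :> R by lra.
rewrite -natrM ler_nat leqNgt; apply: contra nk => ckd; rewrite /small kn; lia.
Qed.

(** Two steps after a bridge the cut has size at least 2 (d - 1) - 1 = 2 d - 3, about twice what is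
    needed. The surplus over 1 is (1 - beta) (d - 2) / (d - 1) - (2 d - 3) kappa, and 1 - beta >= 1
    / (d - 1) by [beta_isolated]. *)
Lemma cov_isolated k : (0 < k < n)%N -> isolated_defect k -> ~~ small k.-1 -> ~~ small k.+1 -> 1 <= coverage k.
Proof.
move=> kn g1 nk1 nk2; have /andP[k0 lkn] := kn; have D3 := d_ge3; have k00 := kappa_gt0.
have [nk _] := isolated_defectP g1; have b1 := beta_isolated (ltnW lkn) g1 nk.
apply: le_trans (cov_far kn nk nk1 nk2); rewrite mult_far // g1 /= mulr1n.
have [/and4P[g2 sg /eqP cg _]] : isolated_defect k by [].
have /andP[s0 sn] := small_lt sg.
have := dist_growth (ltnW sn) (ltnW lkn); rewrite cg (_ : dist _ _ = 2)%N; last by rewrite /dist; lia.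
move=> G; have C : 2 * d%:R - 3 <= (c k)%:R :> R.
  have : ((2 * d)%N%:R <= (c k + 3)%N%:R :> R) by rewrite ler_nat; lia.
  by rewrite natrD natrM; lra.
have kk : kappa <= ((d%:R - 1) ^+ 2 * (2 * d%:R - 3))^-1.
  have p0 : 0 < (d%:R - 1) ^+ 2 * (2 * d%:R - 3) :> R.
    by apply: mulr_gt0; [apply: exprn_gt0; lra|lra].
  apply: kappa_le => //.
  have h1 : (d%:R - 1) ^+ 2 <= d%:R ^+ 2 :> R by rewrite ler_sqr ?nnegrE; lra.
  have h2 : (d%:R - 1) ^+ 2 * (2 * d%:R - 3) <= d%:R ^+ 2 * (2 * d%:R) :> R.
    by apply: ler_pM => //; [apply: sqr_ge0|lra|lra].
  by rewrite (le_trans h2) // le_eqVlt; apply/orP; left; apply/eqP; ring.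
set b := beta k in b1 *; set D := d%:R in D3 C b1 kk *.
have E1 : (2 * D - 3) * kappa <= ((D - 1) ^+ 2)^-1.
  rewrite mulrC -ler_pdivlMr; last lra.
  by move: kk; rewrite invfM.
have i0 : 0 < (D - 1)^-1 by rewrite invr_gt0; lra.
have U : (D - 1)^-1 <= 1 - b.
  rewrite -[(D - 1)^-1]mul1r ler_pdivrMr; [lra|lra].
have V : 0 <= (1 - b) / (D - 1) - kappa.
  rewrite subr_ge0 (le_trans kk) // invfM exprS expr1 invfM.
  rewrite -[leRHS]mulr1; apply: ler_pM; [| | |].
  - by rewrite mulr_ge0 ?ltW.
  - by rewrite invr_ge0; lra.
  - by rewrite ler_pM2r.
  - by rewrite invf_le1; lra.
have W := ler_wpM2l V C.
have : 1 <= ((1 - b) / (D - 1) - kappa) * (2 * D - 3) + b.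
  have -> : ((1 - b) / (D - 1) - kappa) * (2 * D - 3) + b =
     1 + ((1 - b) * ((D - 2) * (D - 1)^-1) - (2 * D - 3) * kappa).
    by field; apply/eqP; lra.
  rewrite lerDl subr_ge0 (le_trans E1) // exprS expr1 invfM.
  apply: ler_pM => //; try exact: ltW.
  by rewrite -[leLHS]mul1r ler_pM2r; lra.
lra.
Qed.

(** With c k >= d - 1 the three cuts around [k] provide (2 d - 3) (1 / (d - 1) - kappa), which is at
    least 1. The sizes of the two neighbouring cuts enter in [cov_mid], where the multipliers next
    to a cut smaller than d - 1 must carry no slack. *)
Lemma cov_plain k : plain_defect k -> 1 <= coverage k.
Proof.
move=> g5; have /and5P[kn h1 h2 h3 _] := g5; have /andP[k0 lkn] := kn.
have dk : (dist k k <= 1)%N by rewrite /dist; lia.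
have dk1 : (dist k k.-1 <= 1)%N by rewrite /dist; lia.
have dk2 : (dist k k.+1 <= 1)%N by rewrite /dist; lia.
have D3 := d_ge3; have k00 := kappa_gt0; have H := plain_defectP g5.
have i0 : 0 < (d%:R - 1)^-1 :> R by rewrite invr_gt0; lra.
have di0 : 0 < d%:R^-1 :> R by rewrite invr_gt0; lra.
have kd := kappa_le_invd.
have P g : (dist k g <= 1)%N -> (d%:R - 1)^-1 - kappa <= mult g.
  move=> kg; rewrite mult_plain => [|i si]; first by case: (_ || _); rewrite ?mulr1n ?mulr0n; lra.
  by have := H i si; have [_ + _] := room_bounds si; move: kg; rewrite /dist; lia.
have := @cov_adj k ((d%:R - 1)^-1 - kappa) kn; rewrite !P //.
move=> /(_ _ isT isT) H1; apply: le_trans (H1 _); last by lra.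
have C : d%:R - 1 <= (c k)%:R :> R.
  by move: h2; rewrite -(ler_nat R) -natr1; lra.
have Q : 0 < (2 * d%:R - 3) :> R by lra.
have yk : (d%:R - 1)^-1 - kappa <= mult k by exact: P.
have kk : kappa <= (d%:R - 1)^-1 - (2 * d%:R - 3)^-1.
  apply: (le_trans kd); rewrite lerD2l lerN2 lef_pV2 ?posrE; lra.
have m0 : 0 < (d%:R - 1)^-1 - kappa by lra.
have : 1 <= ((d%:R - 1)^-1 - kappa) * (2 * d%:R - 3).
  by rewrite -ler_pdivrMr // mul1r; lra.
have c0 : 0 <= (c k)%:R :> R by rewrite ler0n.
have := ler_wpM2r c0 yk.
have : ((d%:R - 1)^-1 - kappa) * (2 * d%:R - 3) <= ((d%:R - 1)^-1 - kappa) * (2 * (c k)%:R - 1).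
  by apply: ler_wpM2l; lra.
lra.
Qed.

Lemma cov_ge1 k : (0 < k < n)%N -> 1 <= coverage k.
Proof.
move=> kn; have /andP[k0 lkn] := kn; have D3 := d_ge3.
case: (boolP (small k)) => [|nk]; first exact: cov_small.
case: (boolP (small k.-1)) => [sk|nk1].
  (* At distance 1 the weight of a small cut is K / K = 1, so the term of cut [k] alone suffices. *)
  have := @right_term k.-1 k sk; have [K0 Kd _] := room_bounds sk.
  have dk : dist k.-1 k = 1%N by rewrite /dist; lia.
  rewrite weightE ?dk; [|by []|by lia].
  rewrite (prednK k0) near_cut2_diag addrK divff ?pnatr_eq0 -?lt0n //.
  by move=> /(_ (leqnn _) K0) /le_trans; apply; apply: cov_own.
case: (boolP (small k.+1)) => [sk|nk2].
  have := @left_term k.+1 k sk; have [K0 Kd _] := room_bounds sk.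
  have dk : dist k.+1 k = 1%N by rewrite /dist; lia.
  rewrite weightE ?dk; [|by []|by lia].
  rewrite near_cut2_diag addrK divff ?pnatr_eq0 -?lt0n //.
  by move=> /(_ (ltnSn _) K0) /le_trans; apply; apply: cov_own.
case: (boolP (isolated_defect k)) => [|n1]; first by move=> ?; apply: cov_isolated.
case: (boolP (plain_defect k)) => [|n5]; first exact: cov_plain.
case: (ltnP (c k).+1 d) => [|ck]; first exact: cov_mid.
apply: le_trans (cov_far kn nk nk1 nk2).
(* No slack is taken here, and c k >= d - 1 makes the term of cut [k] at least 1 - beta. *)
rewrite mult_far // (negbTE n1) (negbTE n5) subr0.
have b1 := beta_le1 (ltnW lkn) nk.
have C : d%:R - 1 <= (c k)%:R :> R.
  by move: ck; rewrite -(ler_nat R) -natr1; lra.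
have D1 : 0 < d%:R - 1 :> R by lra.
rewrite mulrAC -lerBlDr ler_pdivlMr //; apply: ler_wpM2l => //; lra.
Qed.

(* What the small cut i adds to the default value 1 / (d - 1) of the multiplier at g. In the
   notation above the total is (d + 1) / (a K) - (K + 2) / (d - 1), which is 0 for a bridge and at
   most - kappa for a >= 2; this is why kappa can be added back at such cuts. *)
Definition transfer i g : R :=
  if dist i g == 0%N then
    (d.+1 - 2 * c i)%:R / ((c i)%:R * (room i)%:R) - (d%:R - 1)^-1 + kappa *+ (1 < c i)%N
  else if dist i g == 1%N then (room i)%:R^-1 - (d%:R - 1)^-1
  else - (weight i g / (d%:R - 1)).

Lemma transfer_far i g : (room i < dist i g)%N -> (1 < dist i g)%N -> transfer i g = 0.
Proof.
rewrite /transfer => h1 h2; rewrite (_ : (_ == 0%N) = false) 1?(_ : (_ == 1%N) = false); try lia.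
have [/eqP|/weight_neq0] := eqVneq (weight i g) 0; first by move=> /eqP ->; rewrite mul0r oppr0.
by rewrite leqNgt h1.
Qed.

Lemma transfer_single i g : small i -> (dist i g <= 1)%N ->
  \sum_(j < n.+1 | small j) transfer j g = transfer i g.
Proof.
move=> si ig; have /andP[_ lin] := small_lt si.
rewrite (bigD1 (Ordinal (ltnW lin : (i < n.+1)%N))) //= big1 ?addr0 // => j /andP[sj /eqP ji].
have ij : i != j by apply/eqP => e; apply: ji; apply: val_inj.
have := small_sep si sj ij; have [_ + _] := room_bounds sj => Kj dij.
by apply: transfer_far; move: ig dij; rewrite /dist; lia.
Qed.

Lemma defect_far g : ~~ small g -> ~~ small g.-1 -> defect g = isolated_defect g || plain_defect g.
Proof.
by move=> /negbTE n1 /negbTE n2; rewrite /defect /complete_defect /wide_defect n1 n2 andbF.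
Qed.

Lemma mult_le g : (g <= n)%N ->
  mult g <= (d%:R - 1)^-1 + \sum_(i < n.+1 | small i) transfer i g - kappa *+ defect g.
Proof.
move=> gn; have k0 := kappa_gt0.
case: (boolP (small g)) => sg.
  rewrite (transfer_single sg) /dist; last by lia.
  rewrite {1}/mult sg /transfer (_ : dist g g == 0%N); last by rewrite /dist; apply/eqP; lia.
  have -> : defect g = (1 < c g)%N.
    rewrite /defect /wide_defect sg /=; have -> : isolated_defect g = false.
      by apply/negP => /isolated_defectP[]; rewrite sg.
    have -> : plain_defect g = false.
      by apply/negP => /plain_defectP/(_ g sg); rewrite /dist; lia.
    rewrite orbF /=; case: (boolP (complete_defect g)) => // /and4P[g0 sg1 _ _].
    by have := small_sep sg sg1; rewrite /dist => /(_ ltac:(apply/eqP; lia)); lia.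
  lra.
case: (boolP (small g.-1)) => sg1.
  have g0 : (0 < g)%N by case/andP: (sg1); lia.
  have dg : dist g.-1 g = 1%N by rewrite /dist; lia.
  rewrite (transfer_single sg1) ?dg // /transfer dg /=.
  rewrite -{1}(prednK g0) (mult_right sg1) (prednK g0).
  have -> : defect g = complete_defect g.
    rewrite /defect /wide_defect (negbTE sg) /=; have -> : plain_defect g = false.
      by apply/negP => /plain_defectP/(_ _ sg1); rewrite dg; lia.
    case: (boolP (isolated_defect g)) => [/and4P[g2 sg2 _ _]|]; last by rewrite orbF.
    by have := small_sep sg1 sg2; rewrite /dist => /(_ ltac:(apply/eqP; lia)); lia.
  lra.
case: (boolP (small g.+1)) => sg2.
  have dg : dist g.+1 g = 1%N by rewrite /dist; lia.
  rewrite (transfer_single sg2) ?dg // /transfer dg /= (mult_left sg2).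
  have -> : defect g = false.
    rewrite /defect /complete_defect /wide_defect (negbTE sg) (negbTE sg1) andbF /=.
    have -> : plain_defect g = false by apply/negP => /plain_defectP/(_ _ sg2); rewrite dg; lia.
    rewrite orbF; apply/negP => /and4P[g2 sg3 _ _].
    by have := small_sep sg3 sg2; rewrite /dist => /(_ ltac:(apply/eqP; lia)); lia.
  rewrite subr0; lra.
rewrite mult_far // defect_far // (eq_bigr (fun i : 'I_n.+1 => - (weight i g / (d%:R - 1)))).
  rewrite sumrN -mulr_suml -/(beta g); lra.
move=> i si; rewrite /transfer; case: eqP => [ig|_].
  by move: sg; rewrite (_ : g = i) ?si //; move: ig; rewrite /dist; lia.
case: eqP => [ig|//].
have : (i == g.-1 :> nat) || (i == g.+1 :> nat) by move: ig; rewrite /dist; lia.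
by move=> /orP[] /eqP ei; move: sg1 sg2; rewrite -ei si.
Qed.

Lemma transfer_sum i : small i -> \sum_(g < n.+1) transfer i g <= 0.
Proof.
move=> si; have [K0 Kd cK] := room_bounds si; have D3 := d_ge3; have k0 := kappa_gt0.
have [di lin] := small_ends si; have c0 := small_gt0 si; have cd := small_cut si.
pose h t : R := if t == 0%N then
    (d.+1 - 2 * c i)%:R / ((c i)%:R * (room i)%:R) - (d%:R - 1)^-1 + kappa *+ (1 < c i)%N
  else if t == 1%N then (room i)%:R^-1 - (d%:R - 1)^-1
  else - (((room i).+1 - t)%:R / (room i)%:R / (d%:R - 1)).
have K1 : (1 < room i)%N by lia.
have := @sum_dist R n.+1 h i (room i); rewrite (_ : (room i <= i)%N); last by lia.
rewrite (_ : (i + room i < n.+1)%N); last by lia.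
rewrite [X in X = _]/= => -> //; last first.
  move=> t tK; rewrite /h (_ : (t == 0%N) = false) 1?(_ : (t == 1%N) = false); try lia.
  by rewrite (_ : ((room i).+1 - t = 0)%N) ?mul0r ?oppr0 //; lia.
rewrite (_ : room i = (room i).-1.+1) ?big_ord_recl /=; last by lia.
rewrite {1 2}/h /=.
have -> : \sum_(j < (room i).-1) h (bump 0 j).+1 = - ((room i)%:R - 1) / 2 / (d%:R - 1).
  have -> : \sum_(j < (room i).-1) h (bump 0 j).+1 =
     \sum_(j < (room i).-1) ((j%:R - ((room i)%:R - 1)) / (room i)%:R / (d%:R - 1)).
    apply: eq_bigr => j _; rewrite /h /= /bump /=; have := ltn_ord j => jK.
    rewrite -!mulNr; congr (_ / _ / _).
    rewrite natrB; last by lia.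
    by rewrite -!natr1; ring.
  rewrite -!mulr_suml; congr (_ / _).
  have K0R : (room i)%:R != 0 :> R by rewrite pnatr_eq0 -lt0n.
  apply: (mulIf K0R); rewrite divfK //.
  have : forall m, \sum_(j < m) (j%:R - ((m.+1)%:R - 1)) = - m%:R * (m.+1)%:R / 2 :> R.
    move=> m; rewrite -natr1 addrK sumrB sumr_const card_ord -mulr_natr.
    have -> : \sum_(j < m) j%:R = m%:R * (m%:R - 1) / 2 :> R.
      elim: m => [|m IH]; first by rewrite big_ord0 !mul0r.
      by rewrite big_ord_recr /= IH -natr1; field.
    by field.
  move=> /(_ (room i).-1); rewrite (prednK K0) => ->.
  have -> : (room i).-1%:R = (room i)%:R - 1 :> R by rewrite -{2}(prednK K0) -natr1 addrK.
  by field.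
have KE := roomE si.
rewrite natrB; last by lia.
rewrite -natr1 natrM.
have c0R : 1 <= (c i)%:R :> R by rewrite (ler_nat _ 1).
have cKR : (c i)%:R + 1 <= (room i)%:R :> R by rewrite natr1 ler_nat.
(* With a = c i and d = a + K, the numerator equals (a - 1) K^2 - a^2 + 1. It is 0 for a = 1, where
   K = d - 1 and [kappa] is absent, and at least 1 for a >= 2 because K > a. *)
have kE : kappa *+ (1 < c i)%N <=
  (((c i)%:R * (room i)%:R * ((room i)%:R + 2)) - (d%:R^+2 - 1)) / ((c i)%:R * (room i)%:R * (d%:R - 1)).
  have dE : d%:R = (c i)%:R + (room i)%:R :> R by rewrite KE; ring.
  have [c1|c1] := ltnP 1 (c i); last first.
    have -> : (c i)%:R = 1 :> R by rewrite (_ : c i = 1%N) //; lia.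
    rewrite mulr0n mulr_ge0 ?invr_ge0 //.
      by rewrite dE (_ : (c i)%:R = 1 :> R); [nra|rewrite (_ : c i = 1%N) //; lia].
    by rewrite mul1r mulr_ge0 ?ler0n //; lra.
  rewrite mulr1n; have c2R : 2 <= (c i)%:R :> R by rewrite (ler_nat _ 2).
  have p0 : 0 < (c i)%:R * (room i)%:R * (d%:R - 1) :> R by rewrite !mulr_gt0 //; lra.
  have kk : kappa <= ((c i)%:R * (room i)%:R * (d%:R - 1))^-1.
    apply: kappa_le => //.
    have -> : 2 * d%:R ^+ 3 = d%:R * d%:R * (2 * d%:R) :> R by ring.
    by apply: ler_pM; [rewrite mulr_ge0; lra|lra|apply: ler_pM; lra|lra].
  apply: (le_trans kk); rewrite -[leLHS]mul1r ler_pM2r ?invr_gt0 //.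
  rewrite dE; move: c2R cKR; move: (c i)%:R (room i)%:R => a k a2 ak.
  have : 0 <= (a - 2) * (k ^+ 2 - a) by apply: mulr_ge0; [lra|nra].
  nra.
have K0R : 0 < (room i)%:R :> R by lra.
have -> : (d%:R + 1 - 2 * (c i)%:R) / ((c i)%:R * (room i)%:R) - (d%:R - 1)^-1 + kappa *+ (1 < c i)%N +
  2 * ((room i)%:R^-1 - (d%:R - 1)^-1 + - ((room i)%:R - 1) / 2 / (d%:R - 1)) =
  kappa *+ (1 < c i)%N - (((c i)%:R * (room i)%:R * ((room i)%:R + 2)) - (d%:R^+2 - 1)) / ((c i)%:R * (room i)%:R * (d%:R - 1)) :> R.
  move: (kappa *+ _) => k; rewrite KE; field.
  by apply/and3P; split; apply/eqP; lra.
lra.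
Qed.

Lemma transfer_norm i g : small i -> `|transfer i g| <= (dist i g <= d)%N%:R.
Proof.
move=> si; have [K0 Kd cK] := room_bounds si.
have far : (d < dist i g)%N -> transfer i g = 0 by move=> dig; apply: transfer_far; lia.
have w2 : dist i g <> 0%N -> weight i g <= 1.
  by move=> t0; rewrite /weight ler_pdivrMr ?ltr0n // mul1r ler_nat; lia.
have D3 := d_ge3; have k0 := kappa_gt0.
have [i0 i1 i2] := inv_room_bounds si; have kd := kappa_le_invd.
have di0 : 0 < d%:R^-1 :> R by rewrite invr_gt0; lra.
have d1i0 : 0 < (d%:R - 1)^-1 :> R by rewrite invr_gt0; lra.
have d1i1 : (d%:R - 1)^-1 <= 1 :> R by rewrite invf_le1; lra.
case: (leqP (dist i g) d) => dig; last by rewrite far ?normr0.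
rewrite /transfer ler_norml mulr1n; case: eqP => [_|t0].
  have /andP[_ lin] := small_lt si; have := mult_bounds (ltnW lin); rewrite /mult si => /andP[y0 y1].
  by case: (1 < c i)%N; rewrite ?mulr1n ?mulr0n; apply/andP; split; lra.
case: eqP => [_|t1]; first by apply/andP; split; lra.
have w1 : 0 <= weight i g by apply: weight_ge0.
have {}w2 := w2 t0.
have w3 : (d%:R - 1)^-1 * weight i g <= (d%:R - 1)^-1 * 1 by rewrite ler_wpM2l // ltW.
have w4 : 0 <= (d%:R - 1)^-1 * weight i g by apply: mulr_ge0; lra.
by apply/andP; split; lra.
Qed.

Lemma count_near i : small i -> \sum_(g < n.+1) (dist i g <= d)%N%:R = 2 * d%:R + 1 :> R.
Proof.
move=> si; have [di lin] := small_ends si.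
have := @sum_dist R n.+1 (fun t => (t <= d)%N%:R) i d; rewrite (ltnW di).
rewrite (_ : (i + d < n.+1)%N); last by lia.
move=> -> //; last by move=> t td; rewrite leqNgt td.
rewrite (eq_bigr (fun=> 1)) => [|t _]; last by rewrite (ltn_ord t).
by rewrite sumr_const card_ord /= addrC.
Qed.

(** Since [transfer] has nonpositive sum and is supported on 2 d + 1 indices with values in [-1, 1],
    only the variation of [X] near [i] can make the weighted sum positive. *)
Lemma transfer_weighted i (X : nat -> R) eta : small i -> 0 <= X i ->
    (forall g, (g <= n)%N -> (dist i g <= d)%N -> `|X g - X i| <= eta) ->
  \sum_(g < n.+1) transfer i g * X g <= (2 * d%:R + 1) * eta.
Proof.
move=> si X0 HX.
have -> : \sum_(g < n.+1) transfer i g * X g =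
  (\sum_(g < n.+1) transfer i g) * X i + \sum_(g < n.+1) transfer i g * (X g - X i).
  by rewrite mulr_suml -big_split; apply: eq_bigr => g _ /=; ring.
have H1 : (\sum_(g < n.+1) transfer i g) * X i <= 0.
  by rewrite mulr_le0_ge0 // transfer_sum.
suff : \sum_(g < n.+1) transfer i g * (X g - X i) <= (2 * d%:R + 1) * eta by lra.
rewrite -(count_near si) mulr_suml; apply: ler_sum => g _.
apply: le_trans (ler_norm _) _; rewrite normrM.
have := transfer_norm g si; case: (leqP (dist i g) d) => dg tn.
  by apply: ler_pM => //; apply: HX => //; rewrite -ltnS.
have -> : transfer i g = 0 by apply/eqP; rewrite -normr_le0.
by rewrite normr0 !mul0r.
Qed.

Lemma multiplier_bound (S : nat -> R) (M Delta : R) : 0 <= Delta -> 0 <= M ->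
    (forall i, (i <= n)%N -> 0 <= S i <= M) ->
    (forall i g, (i <= n)%N -> (g <= n)%N -> `|S g - S i| <= Delta * (dist i g)%:R) ->
  \sum_(g < n.+1) mult g * S g ^+ 2 <=
  (d%:R - 1)^-1 * \sum_(g < n.+1) S g ^+ 2 +
  n.+1%:R * ((2 * d%:R + 1) * (2 * M * d%:R * Delta)) -
  kappa * \sum_(g < n.+1 | defect g) S g ^+ 2.
Proof.
move=> De0 M0 SM SL; have D3 := d_ge3.
have H1 : \sum_(g < n.+1) mult g * S g ^+ 2 <=
  \sum_(g < n.+1) ((d%:R - 1)^-1 * S g ^+ 2 + (\sum_(i < n.+1 | small i) transfer i g * S g ^+ 2)
     - kappa * (S g ^+ 2 *+ defect g)).
  apply: ler_sum => g _; have := mult_le (ltn_ord g : (g <= n)%N).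
  rewrite -mulr_suml => H.
  have -> : forall A B (b : bool), A * S g ^+ 2 + B * S g ^+ 2 - kappa * (S g ^+ 2 *+ b) =
    (A + B - kappa *+ b) * S g ^+ 2 by move=> A B []; rewrite ?mulr1n ?mulr0n; ring.
  by rewrite ler_wpM2r // sqr_ge0.
have -> : \sum_(g < n.+1 | defect g) S g ^+ 2 = \sum_(g < n.+1) (S g ^+ 2 *+ defect g).
  by rewrite big_mkcond; apply: eq_bigr => g _; case: (defect g).
apply: (le_trans H1); rewrite !big_split /= sumrN -!mulr_sumr.
rewrite lerD2r lerD2l exchange_big /=.
apply: le_trans (_ : \sum_(i < n.+1 | small i) (2 * d%:R + 1) * (2 * M * d%:R * Delta) <= _).
  apply: ler_sum => i si; apply: (@transfer_weighted i (fun g => S g ^+ 2)) => //; first exact: sqr_ge0.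
  move=> g gn dg; have lin := ltn_ord i : (i <= n)%N.
  have /andP[a1 a2] := SM _ lin; have /andP[b1 b2] := SM _ gn.
  rewrite subr_sqr normrM mulrC.
  have -> : 2 * M * d%:R * Delta = 2 * M * (Delta * d%:R) by ring.
  apply: ler_pM => //; first by rewrite ger0_norm; lra.
  by apply: le_trans (SL _ _ lin gn) _; rewrite ler_wpM2l // ler_nat.
rewrite sumr_const -[_ *+ #|_|]mulr_natl; apply: ler_wpM2r.
  by rewrite !mulr_ge0 //; lra.
by rewrite ler_nat -[leqRHS]card_ord max_card.
Qed.

(* Weak duality: sum S_k delta_k <= sum_k S_k delta_k coverage_k, and exchanging the sums gives
   mult_i times the flux mu * S_i through cut i, with S_k replaced by S_i for |i - k| <= d. *)
Lemma energy_bound (S delta : nat -> R) (mu M Delta : R) :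
    0 <= mu -> 0 <= Delta -> 0 <= M ->
    (forall i, (i <= n)%N -> 0 <= S i <= M) ->
    (forall i g, (i <= n)%N -> (g <= n)%N -> `|S g - S i| <= Delta * (dist i g)%:R) ->
    (forall k, 0 <= delta k) -> (forall k, ~~ (0 < k < n)%N -> delta k = 0) ->
    (forall i, (i <= n)%N -> \sum_(k < n.+1) (cut2 n E i k)%:R * delta k <= mu * S i) ->
  \sum_(k < n.+1) S k * delta k <=
  mu * ((d%:R - 1)^-1 * \sum_(g < n.+1) S g ^+ 2 +
  n.+1%:R * ((2 * d%:R + 1) * (2 * M * d%:R * Delta) + M * (d%:R * Delta)) -
  kappa * \sum_(g < n.+1 | defect g) S g ^+ 2).
Proof.
move=> mu0 De0 M0 SM SL de0 den flux.
have H1 : \sum_(k < n.+1) S k * delta k <= \sum_(k < n.+1) S k * delta k * coverage k.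
  apply: ler_sum => k _; have /andP[s0 _] := SM _ (ltn_ord k : (k <= n)%N).
  case: (boolP (0 < k < n)%N) => [kn|/den ->]; last by rewrite mulr0 mul0r.
  by rewrite -[leLHS]mulr1 ler_wpM2l ?cov_ge1 // mulr_ge0.
have H2 : \sum_(k < n.+1) S k * delta k * coverage k =
  \sum_(i < n.+1) mult i * \sum_(k < n.+1) (near_cut2 i k)%:R * (S k * delta k).
  rewrite /coverage; under eq_bigr do rewrite mulr_sumr.
  rewrite exchange_big; apply: eq_bigr => i _; rewrite mulr_sumr.
  by apply: eq_bigr => k _; ring.
have H3 : \sum_(k < n.+1) S k * delta k * coverage k <=
  \sum_(i < n.+1) mult i * ((S i + d%:R * Delta) * (mu * S i)).
  rewrite H2; apply: ler_sum => i _; have lin := ltn_ord i : (i <= n)%N.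
  have /andP[y0 _] := mult_bounds lin; apply: ler_wpM2l => //.
  have /andP[s0 _] := SM _ lin.
  have p0 : 0 <= S i + d%:R * Delta by rewrite addr_ge0 // mulr_ge0 ?ler0n.
  apply: le_trans (ler_wpM2l p0 (flux i lin)); rewrite mulr_sumr; apply: ler_sum => k _.
  rewrite /near_cut2; case: leqP => dk; last first.
    by rewrite mul0r !mulr_ge0 ?ler0n.
  rewrite mulrCA; apply: ler_wpM2r; first by rewrite mulr_ge0 ?ler0n.
  have := SL i k lin (ltn_ord k); rewrite ler_norml => /andP[_].
  have : Delta * (dist i k)%:R <= Delta * d%:R by rewrite ler_wpM2l // ler_nat.
  lra.
apply: (le_trans H1); apply: (le_trans H3).
have H4 := multiplier_bound De0 M0 SM SL.
have H5 : \sum_(i < n.+1) mult i * S i <= n.+1%:R * M.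
  rewrite -[X in _ <= X%:R * _]card_ord mulr_natl -sumr_const; apply: ler_sum => i _.
  have lin := ltn_ord i : (i <= n)%N.
  have /andP[y0 y1] := mult_bounds lin; have /andP[s0 s1] := SM _ lin.
  by rewrite -[M]mul1r; apply: ler_pM.
have -> : \sum_(i < n.+1) mult i * ((S i + d%:R * Delta) * (mu * S i)) =
  mu * (\sum_(i < n.+1) mult i * S i ^+ 2 + d%:R * Delta * \sum_(i < n.+1) mult i * S i).
  rewrite [X in _ + X]mulr_sumr -big_split /= mulr_sumr; apply: eq_bigr => i _; ring.
apply: ler_wpM2l => //.
have p0 : 0 <= d%:R * Delta by rewrite mulr_ge0 ?ler0n.
have := ler_wpM2l p0 H5; lra.
Qed.

End Multiplier.

(** * Every vertex outside the good blocks has a defect nearby *)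

Section Blocks.
Local Open Scope ring_scope.
Variables (n d : nat) (E : rel nat).
Hypothesis Esym : symmetric E.
Hypothesis Eirr : irreflexive E.
Hypothesis d3 : (3 <= d)%N.
Hypothesis degE : forall p, (p < n)%N -> (d <= deg n E p)%N.
Hypothesis cut_gt0 : forall i, (0 < i < n)%N -> (0 < cut n E i)%N.

Local Notation c := (cut n E).
Local Notation small := (small n d E).

Definition complete_block b :=
  [forall i : 'I_d.+1, forall j : 'I_d.+1, (i != j) ==> E (b + i)%N (b + j)%N].

Definition good b :=
  [&& small b, c b == 1%N, small (b + d.+1), c (b + d.+1) == 1%N & ~~ complete_block b].

Definition bad p := ~~ [exists b : 'I_n, good b && (b <= p <= b + d)%N].

Lemma complete_rdeg b : (b + d < n)%N -> complete_block b -> (d <= rdeg n E b)%N.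
Proof.
move=> bn /forallP cb.
have <- : (\sum_(q < n) (b.+1 <= q < b + d.+1) = d)%N by rewrite sum_interval; lia.
apply: leq_sum => q _; case: (boolP (b < q < b + d.+1)%N) => // /andP[bq qb].
have qd : (q - b < d.+1)%N by lia.
have := cb ord0 => /forallP/(_ (Ordinal qd)); rewrite addn0 /= subnKC ?(ltnW bq) // => /implyP ->.
  by rewrite bq.
by apply/eqP => /(congr1 val) /=; lia.
Qed.

(** For m = 2 or 3 the product m (d + 1 - m) is at least 2 d - 3, as d >= 3, so two cuts at such a
    distance cannot both be smaller than d - 1. *)
Lemma nonbig_dist i j : (i <= n)%N -> (j <= n)%N -> (2 <= dist i j <= 3)%N ->
  ((c i).+1 < d)%N -> (d <= (c j).+1)%N.
Proof.
move=> lin ljn ij ci; have := dist_growth Esym Eirr d3 degE lin ljn.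
move: (dist i j) ij => m ij; have : m = 2%N \/ m = 3%N by lia.
by case=> ->; lia.
Qed.

(** If cut j is smaller than d - 1, then j + 2 and j + 3 are not. Either j + 1 completes the triple
    on the left, or j + 1 is itself smaller than d - 1, which makes j + 4 large. *)
Lemma big_triple_exists x : (x + 6 <= n)%N -> exists g, [/\ (x < g <= x + 5)%N,
  (d <= (c g.-1).+1)%N, (d <= (c g).+1)%N & (d <= (c g.+1).+1)%N].
Proof.
move=> xn.
have H j : (x <= j <= x + 2)%N -> ((c j).+1 < d)%N -> exists g, [/\ (x < g <= x + 5)%N,
  (d <= (c g.-1).+1)%N, (d <= (c g).+1)%N & (d <= (c g.+1).+1)%N].
  move=> jx cj.
  have c2 : (d <= (c j.+2).+1)%N by apply: (@nonbig_dist j); rewrite ?/dist; lia.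
  have c3 : (d <= (c j.+3).+1)%N by apply: (@nonbig_dist j); rewrite ?/dist; lia.
  case: (leqP d (c j.+1).+1) => c1; first by exists j.+2; split=> //; lia.
  exists j.+3; split=> //; first by lia.
  by apply: (@nonbig_dist j.+1); rewrite ?/dist; lia.
case: (leqP d (c x).+1) => c0; last by apply: (H x) => //; lia.
case: (leqP d (c x.+1).+1) => c1; last by apply: (H x.+1) => //; lia.
case: (leqP d (c x.+2).+1) => c2; last by apply: (H x.+2) => //; lia.
by exists x.+1; split=> //; lia.
Qed.

(** Let b be the last small cut at or before [p], within distance 2 d + 4. Every way in which the
    block starting at b can fail to be a good block containing [p] is one of the first three
    defects; if no such b exists, there is a plain defect. *)
Lemma bad_defect p : (2 * d + 5 <= p)%N -> (p + (2 * d + 5) <= n)%N -> bad p ->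
  exists q, [/\ defect n d E q, (q <= n)%N & (dist p q <= 2 * d + 5)%N].
Proof.
move=> lp pn badp.
pose W b := [&& small b, (b <= p)%N & (p < b + (2 * d + 5))%N].
have [ex|nex] := pselect (exists b, W b).
  have ub b : W b -> (b <= p)%N by case/and3P.
  case: (ex_maxnP ex ub) => b /and3P[sb bp pb] bmax.
  have [db bn] := small_ends Esym Eirr d3 degE sb.
  have c0 := small_gt0 cut_gt0 sb.
  have [c1|c1] := ltnP 1 (c b).
    exists b; split; [by rewrite /defect /wide_defect sb c1 !orbT|lia|rewrite /dist; lia].
  have cb : c b = 1%N by lia.
  have [sb'|nsb'] := boolP (small (b + d.+1)); last first.
    exists b.+2; split; [|lia|rewrite /dist; lia].
    by rewrite /defect /isolated_defect subn2 /= sb cb nsb'.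
  have bp' : (p < b + d.+1)%N.
    rewrite ltnNge; apply/negP => H.
    by have := bmax (b + d.+1)%N; rewrite /W sb' H /=; lia.
  have [_ bn'] := small_ends Esym Eirr d3 degE sb'.
  have c0' := small_gt0 cut_gt0 sb'.
  have [c1'|c1'] := ltnP 1 (c (b + d.+1)).
    exists (b + d.+1)%N; split; [by rewrite /defect /wide_defect sb' c1' !orbT|lia|rewrite /dist; lia].
  have cb' : c (b + d.+1) = 1%N by lia.
  have [cpl|ncpl] := boolP (complete_block b).
    exists b.+1; split; [|lia|rewrite /dist; lia].
    by rewrite /defect /complete_defect /= sb cb (complete_rdeg _ cpl) ?orbT //; lia.
  have bln : (b < n)%N by lia.
  case/negP: badp; apply/existsP; exists (Ordinal bln) => /=.
  by rewrite /good sb cb sb' cb' ncpl; lia.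
(* This puts g between p - d - 4 and p - d, so any cut within distance d of g lies between p - 2 d -
   4 and p, exactly the window of [W]; hence the radius 2 d + 5. *)
have [g [gx g1 g2 g3]] := @big_triple_exists (p - d - 5) ltac:(lia).
exists g; split; [|lia|rewrite /dist; lia].
apply/or4P/Or44; apply/and5P; split=> //; first by lia.
apply/forallP => i; apply/implyP => si; rewrite ltnNge; apply/negP => ig.
by apply: nex; exists i; rewrite /W si; move: ig; rewrite /dist; lia.
Qed.

End Blocks.

(** * Counting the bad positions *)

Section Counting.
Local Open Scope ring_scope.
Variable R : realFieldType.

Lemma count_lt m (r : R) : 0 <= r -> \sum_(p < m) (p%:R < r)%R%:R <= r + 1.
Proof.
(* The trivial bound by m is carried along: when m < r the new term counts, and m + 1 <= r + 1
   closes the induction. *)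
move=> r0; suff [] : \sum_(p < m) (p%:R < r)%R%:R <= r + 1 /\
   \sum_(p < m) (p%:R < r)%R%:R <= m%:R :> R by [].
elim: m => [|m [IH1 IH2]]; first by rewrite big_ord0; split; [lra|].
rewrite big_ord_recr /= -natr1.
by case: ltP => mr; split; rewrite ?mulr1n ?mulr0n; lra.
Qed.

Lemma count_gt m (r : R) : 0 <= r -> \sum_(p < m) (m%:R < p%:R + r)%R%:R <= r.
Proof.
move=> r0; rewrite (reindex_inj rev_ord_inj) /=.
have -> : \sum_(p < m) (m%:R < (m - p.+1)%:R + r)%R%:R = \sum_(p < m) (p.+1%:R < r)%R%:R :> R.
  apply: eq_bigr => p _; congr (nat_of_bool _)%:R; rewrite natrB //.
  by apply/idP/idP; lra.
suff [] : \sum_(p < m) (p.+1%:R < r)%R%:R <= r /\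
   \sum_(p < m) (p.+1%:R < r)%R%:R <= m%:R :> R by [].
elim: m => [|m [IH1 IH2]]; first by rewrite big_ord0; split; [lra|].
rewrite big_ord_recr /= -natr1.
by case: ltP => mr; split; rewrite ?mulr1n ?mulr0n; lra.
Qed.

Lemma count_dist m q L : \sum_(p < m) (dist p q <= L)%N%:R <= (2 * L + 1)%:R :> R.
Proof.
rewrite -natr_sum ler_nat.
rewrite (eq_bigr (fun p : 'I_m => (q - L <= p < q + L.+1)%N : nat)).
  by rewrite sum_interval; lia.
by move=> p _; congr nat_of_bool; rewrite /dist; lia.
Qed.

Variables (n d : nat) (E : rel nat).
Hypothesis Esym : symmetric E.
Hypothesis Eirr : irreflexive E.
Hypothesis d3 : (3 <= d)%N.
Hypothesis degE : forall p, (p < n)%N -> (d <= deg n E p)%N.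
Hypothesis cut_gt0 : forall i, (0 < i < n)%N -> (0 < cut n E i)%N.

(** Markov's inequality for [F p], the energy of the defects within distance L of p. Away from the
    ends a bad p has a defect nearby with S >= eta M, so F p >= eta^2 M^2; each defect is counted
    for at most 2 L + 1 positions. *)
Lemma bad_count (S : nat -> R) (M C eta : R) : (0 < n)%N ->
    0 < M -> 0 < eta ->
    (forall q, (q <= n)%N -> M * (minn q (n - q))%:R <= n%:R * S q) ->
    \sum_(g < n.+1 | defect n d E g) S g ^+ 2 <= C * eta ^+ 3 * n%:R * M ^+ 2 ->
  \sum_(p < n) (bad n d E p)%:R <=
  ((2 * (2 * d + 5) + 1)%N%:R * C + 2) * (eta * n%:R) + (2 * (2 * d + 5) + 1)%N%:R.
Proof.
move=> n0 M0 e0 SM X.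
have near_dist p q m : (dist p q <= m)%N -> (p <= q + m)%N /\ (q <= p + m)%N.
  by rewrite /dist; lia.
set L := (2 * d + 5)%N; set t := eta * n%:R.
have nR : 0 < n%:R :> R by rewrite ltr0n.
have t0 : 0 < t by rewrite mulr_gt0.
have eM : 0 < eta ^+ 2 * M ^+ 2 by rewrite mulr_gt0 // exprn_gt0.
pose F p : R := \sum_(q < n.+1 | defect n d E q) (dist p q <= L)%N%:R * S q ^+ 2.
have F0 p : 0 <= F p.
  by apply: sumr_ge0 => q _; rewrite mulr_ge0 ?ler0n ?sqr_ge0.
have H (p : 'I_n) : (bad n d E p)%:R <= (p%:R < t + L%:R)%R%:R + (n%:R < p%:R + (t + L%:R))%R%:R
    + (eta ^+ 2 * M ^+ 2)^-1 * F p.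
  have G0 : 0 <= (eta ^+ 2 * M ^+ 2)^-1 * F p by rewrite mulr_ge0 // invr_ge0 ltW.
  case: (boolP (bad n d E p)) => badp; last by rewrite !addr_ge0 ?ler0n.
  case: ltP => [_|h1]; first by rewrite mulr1n; have := ler0n R (n%:R < p%:R + (t + L%:R))%R; lra.
  case: ltP => [_|h2]; first by rewrite /=; lra.
  have p1 : (L <= p)%N by rewrite -(ler_nat R); lra.
  have p2 : (p + L <= n)%N by rewrite -(ler_nat R) natrD; lra.
  have [q [dq qn pq]] := bad_defect Esym Eirr d3 degE cut_gt0 p1 p2 badp.
  have q1 : t <= (minn q (n - q))%:R.
    have [] : (p <= q + L)%N /\ (q <= p + L)%N := near_dist _ _ _ pq.
    rewrite -!(ler_nat R) (natrD R q L) (natrD R p L) => a1 a2.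
    case: (leqP q (n - q)) => _; first by lra.
    rewrite natrB //; lra.
  have Sq : eta * M <= S q.
    rewrite -(ler_pM2l nR); apply: le_trans (SM q qn).
    by have := ler_wpM2l (ltW M0) q1; rewrite /t; lra.
  have Fq : eta ^+ 2 * M ^+ 2 <= F p.
    rewrite /F (bigD1 (Ordinal (qn : (q < n.+1)%N))) //= pq mul1r -[leLHS]addr0.
    apply: lerD; first by rewrite -exprMn ler_sqr ?nnegrE ?mulr_ge0 ?(le_trans _ Sq) ?mulr_ge0 // ltW.
    by apply: sumr_ge0 => j _; rewrite mulr_ge0 ?ler0n ?sqr_ge0.
  rewrite !mulr0n add0r add0r mulrC ler_pdivlMr // mul1r //.
have L0 : 0 <= L%:R :> R by rewrite ler0n.
have tL : 0 <= t + L%:R by lra.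
have H1 := count_lt n tL; have H2 := count_gt n tL.
have H3 : (eta ^+ 2 * M ^+ 2)^-1 * \sum_(p < n) F p <= (2 * L + 1)%:R * C * t.
  rewrite mulrC ler_pdivrMr //.
  have E1 : \sum_(p < n) F p <= (2 * L + 1)%:R * \sum_(q < n.+1 | defect n d E q) S q ^+ 2.
    rewrite /F exchange_big /= mulr_sumr; apply: ler_sum => q _.
    by rewrite -mulr_suml ler_wpM2r ?sqr_ge0 // count_dist.
  apply: (le_trans E1); apply: le_trans (ler_wpM2l (ler0n _ _) X) _.
  by rewrite le_eqVlt; apply/orP; left; apply/eqP; rewrite /t; ring.
apply: le_trans (ler_sum _ (fun p _ => H p)) _.
rewrite !big_split /= -mulr_sumr natrD natrM in H3 *; lra.
Qed.

End Counting.

(** * Distances and the diameter *)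

Section Distance.
Variables (T : finType) (e : rel T).

Lemma graph_dist_le x y k : has_walk e x y k -> graph_dist e x y <= k.
Proof.
move=> w; rewrite /graph_dist; case: (ltnP k #|T|) => kT.
  rewrite leqNgt; apply/negP => /(before_find 0).
  by rewrite nth_iota // add0n w.
by apply: leq_trans (find_size _ _) _; rewrite size_iota.
Qed.

Lemma graph_dist_walk x y : graph_dist e x y < #|T| -> has_walk e x y (graph_dist e x y).
Proof.
rewrite /graph_dist => H; have hs : has (has_walk e x y) (iota 0 #|T|).
  by rewrite has_find size_iota.
by have := nth_find 0 hs; rewrite nth_iota.
Qed.

(** A height that rises by at most 1 along edges bounds walk lengths from below; the second
    hypothesis handles the default value [#|T|]. *)
Lemma graph_dist_ge (h : T -> nat) x y :
  (forall u w, e u w -> h w <= (h u).+1) -> h y <= h x + #|T| ->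
  h y <= h x + graph_dist e x y.
Proof.
move=> lip hT; case: (ltnP (graph_dist e x y) #|T|) => H; last first.
  by apply: leq_trans hT _; rewrite leq_add2l.
have /existsP[p /andP[pp /eqP ly]] := graph_dist_walk H.
move: (size_tuple p) pp ly; move: (tval p) => q <- + <- {p hT H}.
elim: q x => [|z q IH] x /=; first by rewrite addn0.
by move=> /andP[/lip xz /IH]; lia.
Qed.

Lemma graph_distxx x : graph_dist e x x = 0.
Proof.
apply/eqP; rewrite -leqn0; apply: graph_dist_le.
by apply/existsP; exists [tuple]; rewrite /= eqxx.
Qed.

Lemma graph_dist_edge x u w : e u w -> graph_dist e x w <= (graph_dist e x u).+1.
Proof.
move=> uw; case: (ltnP (graph_dist e x u) #|T|) => H; last first.
  by apply: (@leq_trans #|T|); [rewrite /graph_dist -[X in _ <= X](size_iota 0) find_size|lia].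
have /existsP[p /andP[pp /eqP ly]] := graph_dist_walk H.
apply: graph_dist_le; apply/existsP; exists [tuple of rcons p w].
by rewrite /= rcons_path pp ly uw last_rcons eqxx.
Qed.

Lemma graph_dist_diameter x y : graph_dist e x y <= diameter e.
Proof.
by apply: leq_trans (leq_bigmax (F := fun x => \max_y graph_dist e x y) x); apply: leq_bigmax.
Qed.

Lemma diameter_attained (x0 : T) : exists x y, diameter e = graph_dist e x y.
Proof.
have T0 : 0 < #|T| by apply/card_gt0P; exists x0.
have [x xE] := bigop.eq_bigmax (fun x => \max_y graph_dist e x y) T0.
have [y yE] := bigop.eq_bigmax (fun y => graph_dist e x y) T0.
by exists x, y; rewrite /diameter xE yE.
Qed.

Hypothesis econ : connected_graph e.
Hypothesis eC : symmetric e.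
Hypothesis eirr : irreflexive e.

(** Discrete intermediate values: along a walk from [x] the distance to [x] grows by at most 1 per
    step. *)
Lemma graph_dist_onto x y j : j <= graph_dist e x y -> exists z, graph_dist e x z = j.
Proof.
have /forallP/(_ x)/forallP/(_ y)/connectP[p pp ->] := econ.
suff H u : path e u p -> graph_dist e x u <= j -> j <= graph_dist e x (last u p) ->
    exists z, graph_dist e x z = j by apply: H => //; rewrite graph_distxx.
elim: p u {pp} => [|z p IH] u /=; first by move=> _ h1 h2; exists u; lia.
move=> /andP[uz pz] uj jl; case: (leqP (graph_dist e x z) j) => zj; first exact: IH pz zj jl.
by exists u; have := graph_dist_edge x uz; lia.
Qed.

(* The closed neighbourhood of a vertex at distance 3j from x lies in the layers
   3j-1, 3j, 3j+1, so these neighbourhoods are disjoint for distinct j. *)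
Lemma diameter_lt d (x0 : T) : (forall x, d <= degree e x) ->
  (diameter e).+1 <= 3 * (#|T| %/ d.+1).
Proof.
move=> dd; have [x [y ->]] := diameter_attained x0.
pose g := graph_dist e x; set D := graph_dist e x y.
have layer j : j < (D %/ 3).+1 -> d.+1 <= \sum_(w : T) ((g w).+1 %/ 3 == j).
  move=> jD; have [z zj] : exists z, graph_dist e x z = 3 * j.
    by apply: (@graph_dist_onto x y); rewrite -/D; lia.
  have near w : (w == z) || e z w -> (g w).+1 %/ 3 = j.
    rewrite /g => /orP[/eqP ->|zw]; first by rewrite zj; lia.
    have := graph_dist_edge x zw; have := graph_dist_edge x (eq_trans (eC w z) zw).
    by rewrite zj; lia.
  have -> : \sum_(w : T) ((g w).+1 %/ 3 == j) = #|[set w | (g w).+1 %/ 3 == j]|.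
    rewrite -sum1_card [RHS]big_mkcond; apply: eq_bigr => w _.
    by rewrite inE; case: eqP.
  apply: (@leq_trans #|z |: [set w | e z w]|).
    by rewrite cardsU1 inE eirr add1n ltnS; apply: dd.
  by apply/subset_leq_card/subsetP => w; rewrite !inE => /near ->.
have tot : (D %/ 3).+1 * d.+1 <= #|T|.
  apply: (@leq_trans (\sum_(j < (D %/ 3).+1) \sum_(w : T) ((g w).+1 %/ 3 == j))).
    rewrite -[X in X * _]card_ord -sum_nat_const; apply: leq_sum => j _; exact: layer.
  rewrite exchange_big -sum1_card; apply: leq_sum => w _.
  set k := (g w).+1 %/ 3; rewrite (eq_bigr (fun j : 'I_(D %/ 3).+1 => (j == k :> nat) : nat)).
    case: (ltnP k (D %/ 3).+1) => kD.
      rewrite (bigD1 (Ordinal kD)) //= eqxx big1 // => j /eqP jk.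
      by case: eqP => // jE; case: jk; apply: val_inj.
    by rewrite big1 // => j _; case: eqP => // jE; have := ltn_ord j; lia.
  by move=> j _; rewrite eq_sym.
have : (D %/ 3).+1 <= #|T| %/ d.+1 by rewrite leq_divRL.
lia.
Qed.

End Distance.

(** * Grouping block positions into maximal runs of step k *)

Section Runs.
Variable k : nat.

Fixpoint runs (s : seq nat) : seq (seq nat) :=
  if s is b :: s' then
    if runs s' is (b' :: r) :: rs then
      if b' == b + k then (b :: b' :: r) :: rs else [:: b] :: (b' :: r) :: rs
    else [:: [:: b]]
  else [::].

Lemma runs_cons b s : exists r rs, runs (b :: s) = (b :: r) :: rs.
Proof.
by rewrite /=; case: (runs s) => [|[|b' r] rs]; [| |case: eqP]; eexists; eexists.
Qed.

Lemma flatten_runs s : flatten (runs s) = s.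
Proof.
elim: s => [//|b [|b' s] IH] //; have [r [rs E]] := runs_cons b' s.
by rewrite E in IH; rewrite [runs _]/= -/(runs (b' :: s)) E -IH; case: eqP.
Qed.

Lemma runs_sorted s :
  all (fun r => (r != [::]) && sorted (fun b b' => b' == b + k) r) (runs s).
Proof.
elim: s => [//|b [|b' s] IH] //; have [r [rs E]] := runs_cons b' s.
rewrite E in IH; rewrite [runs _]/= -/(runs (b' :: s)) E.
by case: eqP => [bE|_] //=; move: IH => /= /andP[-> ->]; rewrite bE eqxx.
Qed.

(** Charge each run to its last element b: its successor b + k is absent, since in a list with steps
    at least k it would be the next entry and would continue the run. *)
Lemma size_runs s : 0 < k -> sorted (fun b b' => b + k <= b') s ->
  size (runs s) <= count (fun b => b + k \notin s) s.
Proof.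
move=> k0; have tr : transitive (fun b b' => b + k <= b') by move=> y x z; lia.
elim: s => [//|b [|b' s] IH] srt; first by rewrite /= inE; case: eqP => //; lia.
have [r [rs E]] := runs_cons b' s.
have {}IH := IH (path_sorted srt).
have lt x : x \in b' :: s -> b + k <= x.
  by move: x; apply/allP; apply: (order_path_min tr srt).
have cntE : count (fun x => x + k \notin b :: b' :: s) (b' :: s) =
    count (fun x => x + k \notin b' :: s) (b' :: s).
  apply: eq_in_count => x /lt bx; rewrite [in LHS]inE.
  by rewrite (_ : (x + k == b) = false) //; apply/eqP; lia.
rewrite [runs _]/= -/(runs (b' :: s)) E -[count _ (b :: _)]/(_ + count _ (b' :: s)) cntE.
rewrite E in IH; case: eqP => [bE|bN]; first by apply: leq_trans IH (leq_addl _ _).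
rewrite (_ : b + k \notin b :: b' :: s) ?add1n ?ltnS //.
rewrite !inE negb_or (_ : (b + k == b) = false); last by apply/eqP; lia.
apply/negP => /= /orP[/eqP h|bs]; first by case: bN.
have bb' := lt b' (mem_head _ _).
have : b' + k <= b + k; last by lia.
by have /allP := order_path_min tr (path_sorted srt : path _ b' s); apply.
Qed.

End Runs.

(** * From good blocks to copies of L_d *)

Section Numbered.
Variables (T : finType) (e : rel T) (d : nat) (v : nat -> T) (idx : T -> nat) (n : nat).
Hypothesis eC : symmetric e.
Hypothesis eirr : irreflexive e.
Hypothesis econ : connected_graph e.
Hypothesis d3 : 3 <= d.
Hypothesis edeg : forall x, d <= degree e x.
Hypothesis cardT : #|T| = n.
Hypothesis idx_lt : forall x, idx x < n.
Hypothesis idxK : forall x, v (idx x) = x.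
Hypothesis vK : forall p, p < n -> idx (v p) = p.

Definition adj p q := [&& p < n, q < n & e (v p) (v q)].
Local Notation c := (cut n adj).
Local Notation small := (small n d adj).
Local Notation good := (good n d adj).
Local Notation bad := (bad n d adj).

Lemma adjC : symmetric adj.
Proof. by move=> p q; rewrite /adj eC andbCA. Qed.

Lemma adj_irr : irreflexive adj.
Proof. by move=> p; rewrite /adj eirr !andbF. Qed.

Lemma adj_idx x y : adj (idx x) (idx y) = e x y.
Proof. by rewrite /adj !idx_lt !idxK. Qed.

Lemma v_bij : bijective (fun p : 'I_n => v p).
Proof.
exists (fun x => Ordinal (idx_lt x)); first by move=> p; apply: val_inj; rewrite /= vK.
by move=> x /=.
Qed.

Lemma adj_deg p : p < n -> d <= deg n adj p.
Proof.
move=> pn; apply: leq_trans (edeg (v p)) _; rewrite /deg /degree -sum1_card.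
rewrite big_mkcond (reindex _ (onW_bij _ v_bij)) leq_eqVlt; apply/orP; left; apply/eqP.
by apply: eq_bigr => q _; rewrite inE /adj pn ltn_ord; case: (e _ _).
Qed.

Lemma connected_closed (A : pred T) x y : closed e A -> (x \in A) = (y \in A).
Proof.
move=> cA; have /forallP/(_ x)/forallP/(_ y) := econ.
exact: closed_connect.
Qed.

Lemma adj_cut i : 0 < i < n -> 0 < c i.
Proof.
move=> /andP[i0 lin]; rewrite lt0n; apply/eqP => ci.
have z p q : p < i -> i <= q -> q < n -> adj p q = false.
  move=> pi iq qn; have pn : p < n by lia.
  move: ci; rewrite cutE => /eqP; rewrite sum_nat_eq0 => /forallP/(_ (Ordinal pn)).
  rewrite /= sum_nat_eq0 => /forallP/(_ (Ordinal qn)) /=.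
  by rewrite pi iq; case: adj.
have cA : closed e [pred x | idx x < i].
  move=> x y exy; rewrite !inE; case: (ltnP (idx x) i) => hx; case: (ltnP (idx y) i) => hy //.
    by have := z _ _ hx hy (idx_lt y); rewrite adj_idx exy.
  by have := z _ _ hy hx (idx_lt x); rewrite adj_idx eC exy.
have := connected_closed (v 0) (v i) cA; rewrite !inE !vK //; last by lia.
by rewrite i0 ltnn.
Qed.

Lemma cut1_uniq i p q p' q' : c i = 1 -> p < i -> i <= q -> adj p q ->
  p' < i -> i <= q' -> adj p' q' -> p = p' /\ q = q'.
Proof.
move=> ci pi iq apq pi' iq' apq'.
have [pn qn _] := and3P apq; have [pn' qn' _] := and3P apq'.
move: ci; rewrite cutE; set F := fun p q => nat_of_bool ((p < i <= q) && adj p q).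
have F1 : F p q = 1 by rewrite /F pi iq apq.
have F1' : F p' q' = 1 by rewrite /F pi' iq' apq'.
move=> S1; have [pE|pN] := eqVneq p p'.
  split=> //; subst p'; apply/eqP/negPn/negP => qN.
  have : 2 <= \sum_(p < n) \sum_(q < n) F p q; last by rewrite S1.
  rewrite (bigD1 (Ordinal pn)) //= (bigD1 (Ordinal qn)) //= (bigD1 (Ordinal qn')) /=; last first.
    by move: qN; apply: contraNN => /eqP[->].
  by rewrite F1 F1'; lia.
have : 2 <= \sum_(p < n) \sum_(q < n) F p q; last by rewrite S1.
rewrite (bigD1 (Ordinal pn)) //= [X in _ + X](bigD1 (Ordinal pn')) /=; last first.
  by move: pN; apply: contraNN => /eqP[->].
have a1 : 0 < \sum_(q < n) F p q by rewrite (bigD1 (Ordinal qn)) //= F1; lia.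
have a2 : 0 < \sum_(q < n) F p' q by rewrite (bigD1 (Ordinal qn')) //= F1'; lia.
exact: (leq_add a1 (leq_trans a2 (leq_addr _ _))).
Qed.

Lemma cut1_bridge i p q : c i = 1 -> p < i -> i <= q -> adj p q -> bridge e [set v p; v q].
Proof.
move=> ci pi iq apq; have [pn qn epq] := and3P apq.
apply/andP; split; first by apply/imsetP; exists (v p, v q); rewrite ?inE.
apply/negP => con; have /forallP/(_ (v p))/forallP/(_ (v q)) := con.
have cA : closed (delete_edge e [set v p; v q]) [pred x | idx x < i].
  move=> x y /andP[exy ne]; rewrite !inE.
  case: (ltnP (idx x) i) => hx; case: (ltnP (idx y) i) => hy //.
    have := @cut1_uniq i p q (idx x) (idx y) ci pi iq apq hx hy; rewrite adj_idx exy.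
    by case=> // pE qE; move: ne; rewrite pE qE !idxK eqxx.
  have := @cut1_uniq i p q (idx y) (idx x) ci pi iq apq hy hx; rewrite adj_idx eC exy.
  by case=> // pE qE; move: ne; rewrite pE qE !idxK setUC eqxx.
by move=> /(closed_connect cA); rewrite !inE !vK // pi ltnNge iq.
Qed.

(* s and t are the terminals of the block, p and r their neighbours before and after it. *)
Record block_shape b s t p r : Prop := BlockShape {
  bs_s : b <= s <= b + d; bs_t : b <= t <= b + d; bs_st : s != t;
  bs_p : p < b; bs_r : b + d < r;
  bs_ps : adj p s; bs_tr : adj t r; bs_nst : ~~ adj s t;
  bs_in : forall i j, b <= i <= b + d -> b <= j <= b + d -> i != j -> ~~ adj i j ->
    (i = s /\ j = t) \/ (i = t /\ j = s);
  bs_out : forall i j, b <= i <= b + d -> ~~ (b <= j <= b + d) -> adj i j ->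
    (i = s /\ j = p) \/ (i = t /\ j = r) }.

(** Missing [j] and itself, [i] has at most d - 1 neighbours among the d + 1 block positions, fewer
    than its degree. *)
Lemma out_neighbour b i j : b <= i <= b + d -> b <= j <= b + d -> b + d < n -> i != j -> ~~ adj i j ->
  exists2 k, adj i k & ~~ (b <= k <= b + d).
Proof.
move=> ib jb bn ij nij; have lin : i < n by lia.
have [//|nk] := pselect (exists2 k, adj i k & ~~ (b <= k <= b + d)).
have H : deg n adj i + 2 <= \sum_(q < n) (b <= q < b + d.+1).
  have -> : 2 = \sum_(q < n) (q == i :> nat) + \sum_(q < n) (q == j :> nat).
    by rewrite !sum_eq //; lia.
  rewrite -!big_split; apply: leq_sum => q _ /=.
  case: (boolP (adj i q)) => iq /=.
    have qb : b <= q <= b + d by apply: contrapT => /negP qb; apply: nk; exists q.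
    rewrite (_ : b <= q < b + d.+1); last by lia.
    have [qi|_] := eqVneq (q : nat) i; first by move: iq; rewrite qi adj_irr.
    by have [qj|_] := eqVneq (q : nat) j; first by rewrite -qj iq in nij.
  have [qi|_] := eqVneq (q : nat) i.
    by rewrite qi (negbTE ij); lia.
  by have [->|_] := eqVneq (q : nat) j; first by lia.
by have := adj_deg lin; move: H; rewrite sum_interval; lia.
Qed.

(** Only one edge leaves the block on each side. Both members of a nonadjacent pair need an outside
    neighbour, so they share these two edges between them: one is the end of the left bridge, the
    other of the right one. Every nonadjacent pair is therefore the same pair. *)
Lemma good_shape b : good b -> exists s t p r, block_shape b s t p r.
Proof.
move=> /and5P[sb /eqP cb sb' /eqP cb' ncpl].
have [_ bn] := small_ends adjC adj_irr d3 adj_deg sb'.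
have [i0 [j0 [i0b j0b ij0 nij0]]] : exists i j, [/\ b <= i <= b + d, b <= j <= b + d, i != j & ~~ adj i j].
  move: ncpl; rewrite negb_forall => /existsP[x]; rewrite negb_forall => /existsP[z].
  rewrite negb_imply => /andP[ij nij]; exists (b + x), (b + z).
  have := ltn_ord x; have := ltn_ord z => hj hi; split=> //; try lia.
  by apply: contraNN ij => /eqP ij; apply/eqP/val_inj => /=; lia.
have bn' : b + d < n by lia.
have side i k : b <= i <= b + d -> ~~ (b <= k <= b + d) -> adj i k ->
    (k < b /\ adj k i) \/ b + d < k.
  by move=> ib kb ik; case: (ltnP k b) => kb'; [left; rewrite adjC|right; lia].
have uL k1 i1 k2 i2 : b <= i1 -> b <= i2 -> k1 < b -> k2 < b -> adj k1 i1 -> adj k2 i2 ->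
    i1 = i2 /\ k1 = k2.
  by move=> h1 h2 h3 h4 h5 h6; have [-> ->] := cut1_uniq cb h3 h1 h5 h4 h2 h6.
have uR k1 i1 k2 i2 : i1 <= b + d -> i2 <= b + d -> b + d < k1 -> b + d < k2 ->
    adj i1 k1 -> adj i2 k2 -> i1 = i2 /\ k1 = k2.
  move=> h1 h2 h3 h4 h5 h6.
  have w i : i <= b + d -> i < b + d.+1 by rewrite addnS ltnS.
  have w' k : b + d < k -> b + d.+1 <= k by rewrite addnS.
  exact: cut1_uniq cb' (w _ h1) (w' _ h3) h5 (w _ h2) (w' _ h4) h6.
have [s [t [p [r [sb0 tb st [pb rb ps tr nst]]]]]] : exists s t p r,
    [/\ b <= s <= b + d, b <= t <= b + d, s != t & [/\ p < b, b + d < r, adj p s, adj t r & ~~ adj s t]].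
  have [k ik kb] := out_neighbour i0b j0b bn' ij0 nij0.
  have nji0 : ~~ adj j0 i0 by rewrite adjC.
  have ji0 : j0 != i0 by rewrite eq_sym.
  have [l jl lb] := out_neighbour j0b i0b bn' ji0 nji0.
  case: (side _ _ i0b kb ik) => [[k1 k2]|k1]; case: (side _ _ j0b lb jl) => [[l1 l2]|l1].
  - have [ijE _] := uL k i0 l j0 (proj1 (andP i0b)) (proj1 (andP j0b)) k1 l1 k2 l2.
    by rewrite ijE eqxx in ij0.
  - by exists i0, j0, k, l; split.
  - by exists j0, i0, l, k; split.
  - have [ijE _] := uR k i0 l j0 (proj2 (andP i0b)) (proj2 (andP j0b)) k1 l1 ik jl.
    by rewrite ijE eqxx in ij0.
have out i j : b <= i <= b + d -> ~~ (b <= j <= b + d) -> adj i j ->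
    (i = s /\ j = p) \/ (i = t /\ j = r).
  move=> ib jb ij; case: (side _ _ ib jb ij) => [[j1 j2]|j1].
    by left; have [-> ->] := uL j i p s (proj1 (andP ib)) (proj1 (andP sb0)) j1 pb j2 ps.
  by right; have [-> ->] := uR j i r t (proj2 (andP ib)) (proj2 (andP tb)) j1 rb ij tr.
exists s, t, p, r; split=> // i j ib jb ij nij.
have st_in k l : b <= k <= b + d -> b <= l <= b + d -> k != l -> ~~ adj k l -> k = s \/ k = t.
  move=> kb lb kl nkl; have [m km mb] := out_neighbour kb lb bn' kl nkl.
  by case: (out _ _ kb mb km) => -[-> _]; [left|right].
have nji : ~~ adj j i by rewrite adjC.
have ji : j != i by rewrite eq_sym.
have := st_in _ _ ib jb ij nij; have := st_in _ _ jb ib ji nji.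
by move=> [jE|jE] [iE|iE]; subst; rewrite ?eqxx // in ij *; [right|left].
Qed.


Lemma v_inj p q : p < n -> q < n -> v p = v q -> p = q.
Proof. by move=> pn qn /(congr1 idx); rewrite !vK. Qed.

Lemma set2_eq (U : finType) (i j k l : U) : [set i; j] = [set k; l] -> i != j ->
  (i = k /\ j = l) \/ (i = l /\ j = k).
Proof.
move=> E ij; have := set21 i j; have := set22 i j; rewrite E !inE.
by move=> /orP[] /eqP jE /orP[] /eqP iE; subst; rewrite ?eqxx // in ij *; [right|left].
Qed.

Definition block b : {set T} := [set x | b <= idx x <= b + d].

Definition copy_at b (f : {ffun 'I_d.+1 -> T}) : Prop :=
  [/\ induced_L e f, verts f = block b, has_terminal_bridges e f &
    exists s t p r, [/\ block_shape b s t p r, f ord0 = v s & f ord_max = v t]].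

Lemma embedding_exists b s t p r : b + d < n -> block_shape b s t p r ->
  exists f : {ffun 'I_d.+1 -> T}, [/\ induced_L e f, verts f = block b, f ord0 = v s & f ord_max = v t].
Proof.
move=> bn [bs bt st _ _ _ _ nst bin _].
have xd : s - b < d.+1 by lia.
have yd : t - b < d.+1 by lia.
pose x := Ordinal xd; pose y := Ordinal yd.
(* The first transposition sends [ord0] to x; the second moves the image of [ord_max] to y and fixes
   x. *)
pose sg : {perm 'I_d.+1} := (tperm ord0 x * tperm (tperm ord0 x ord_max) y)%g.
have sg0 : sg ord0 = x.
  have yx : y != x by apply/eqP => /(congr1 val) /=; lia.
  have zx : tperm ord0 x ord_max != x.
    rewrite -[X in _ != X](tpermL ord0 x) (inj_eq perm_inj).
    by apply/eqP => /(congr1 val) /=; lia.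
  by rewrite permM tpermL; apply: tpermD.
have sgm : sg ord_max = y by rewrite permM tpermL.
pose f := [ffun j => v (b + sg j)] : {ffun 'I_d.+1 -> T}.
have sgn j : b + sg j < n by have := ltn_ord (sg j); lia.
have finj : injective f.
  move=> i j; rewrite !ffunE => /v_inj h; apply: (@perm_inj _ sg); apply: val_inj.
  by have /addnI := h (sgn i) (sgn j).
exists f; split.
- split=> // i j; have [<-|ij] := eqVneq i j; first by rewrite eirr /L_adj eqxx.
  rewrite /L_adj ij /= !ffunE.
  have -> : e (v (b + sg i)) (v (b + sg j)) = adj (b + sg i) (b + sg j) by rewrite /adj !sgn.
  have [E|NE] := eqVneq [set i; j] [set ord0; ord_max].
    have sE : b + sg ord0 = s by rewrite sg0 /=; lia.
    have tE : b + sg ord_max = t by rewrite sgm /=; lia.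
    by case: (set2_eq E ij) => -[-> ->]; rewrite sE tE; apply/negbTE; rewrite // adjC.
  apply/negPn/negP => nij.
  have h k : b <= b + sg k <= b + d by have := ltn_ord (sg k); lia.
  have hij : b + sg i != b + sg j.
    by rewrite eqn_add2l; apply: contraNN ij => /eqP/val_inj/perm_inj ->.
  have inv k z : b + sg k = b + val z -> k = (sg^-1)%g z.
    by move=> /addnI/val_inj <-; rewrite permK.
  have s0 : (sg^-1)%g x = ord0 by rewrite -sg0 permK.
  have s1 : (sg^-1)%g y = ord_max by rewrite -sgm permK.
  case: (bin _ _ (h i) (h j) hij nij) => -[e1 e2].
    have i0 : i = ord0 by rewrite -s0; apply: inv; rewrite e1 /=; lia.
    have j0 : j = ord_max by rewrite -s1; apply: inv; rewrite e2 /=; lia.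
    by rewrite i0 j0 eqxx in NE.
  have i0 : i = ord_max by rewrite -s1; apply: inv; rewrite e1 /=; lia.
  have j0 : j = ord0 by rewrite -s0; apply: inv; rewrite e2 /=; lia.
  by rewrite i0 j0 setUC eqxx in NE.
- apply/setP => z; rewrite inE; apply/imsetP/idP => [[j _ ->]|zb].
    by rewrite ffunE vK //; have := ltn_ord (sg j); lia.
  have zd : idx z - b < d.+1 by lia.
  exists ((sg^-1)%g (Ordinal zd)); first by rewrite inE.
  by rewrite ffunE permKV /= subnKC ?idxK //; lia.
- by rewrite ffunE sg0 /= subnKC //; lia.
- by rewrite ffunE sgm /= subnKC //; lia.
Qed.

Lemma good_cuts b : good b -> [/\ c b = 1, c (b + d.+1) = 1, 0 < b & b + d.+1 < n].
Proof.
by move=> /and5P[/andP[/andP[b0 _] _] /eqP cb /andP[/andP[_ bn] _] /eqP cb' _]; split.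
Qed.

Lemma shape_boundary b s t p r : b + d < n -> block_shape b s t p r ->
  boundary e (block b) = [set [set v p; v s]; [set v t; v r]].
Proof.
move=> bn [bs bt st pb rb aps atr nst bin bout].
have [pn sn eps] := and3P aps; have [tn rn etr] := and3P atr.
have one x y : x \in block b -> y \notin block b -> #|[set x; y] :&: block b| = 1.
  move=> xb yb; rewrite (_ : _ :&: _ = [set x]) ?cards1 //; apply/setP => z; rewrite !inE.
  have [->|zx] := eqVneq z x; first by rewrite inE in xb; rewrite xb.
  by rewrite /=; have [->|//] := eqVneq z y; rewrite inE in yb; rewrite (negbTE yb).
apply/setP => E; rewrite inE; apply/idP/idP.
  move=> /andP[/imsetP[[x y]]]; rewrite inE /= => exy ->.
  have side z w : z \in block b -> w \notin block b -> e z w ->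
      [set z; w] \in [set [set v p; v s]; [set v t; v r]].
    rewrite !inE => zb wb; rewrite -adj_idx => /(bout _ _ zb wb)[] [ez ew].
      by rewrite -(idxK z) -(idxK w) ez ew setUC eqxx.
    by rewrite -(idxK z) -(idxK w) ez ew eqxx orbT.
  have [xb|xb] := boolP (x \in block b); have [yb|yb] := boolP (y \in block b) => k1.
  - have xy : x != y by apply: contraTneq exy => ->; rewrite eirr.
    move: k1; rewrite (setIidPl _) ?cards2 ?xy //.
    by apply/subsetP => z; rewrite !inE => /orP[] /eqP ->; [move: xb|move: yb]; rewrite inE.
  - exact: side.
  - by rewrite setUC; apply: side => //; rewrite eC.
  - move: k1; rewrite (_ : _ :&: _ = set0) ?cards0 //; apply/setP => z; rewrite !inE.
    by apply/negP => /andP[/orP[] /eqP ->]; [move: xb|move: yb]; rewrite inE => /negbTE ->.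
rewrite !inE => /orP[] /eqP ->; apply/andP; split.
- by apply/imsetP; exists (v p, v s); rewrite ?inE.
- by rewrite setUC one // inE vK //; lia.
- by apply/imsetP; exists (v t, v r); rewrite ?inE.
- by rewrite one // inE vK //; lia.
Qed.

Lemma copy_exists b : good b -> exists f, copy_at b f.
Proof.
move=> gb; have [cb cb' b0 bn] := good_cuts gb.
have [s [t [p [r bsh]]]] := good_shape gb.
have bn' : b + d < n by lia.
have [f [fL fv f0 fm]] := embedding_exists bn' bsh.
exists f; split=> //; last by exists s, t, p, r.
have bE := shape_boundary bn' bsh.
have [bs bt st pb rb aps atr nst _ _] := bsh.
have [pn sn eps] := and3P aps; have [tn rn etr] := and3P atr.
have nv i j : i < n -> j < n -> i != j -> v i != v j.
  by move=> lin jn; apply: contraNneq => /v_inj ->.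
have vsr : v s != v r by apply: nv => //; lia.
have vtp : v t != v p by apply: nv => //; lia.
have vst : v s != v t by apply: nv.
have ne : [set v p; v s] != [set v t; v r].
  apply/eqP => /setP/(_ (v s)); rewrite !inE eqxx orbT.
  by rewrite (negbTE vst) (negbTE vsr).
rewrite /has_terminal_bridges fv bE; split.
- by rewrite cards2 ne.
- move=> E; rewrite !inE => /orP[] /eqP ->.
    exact: cut1_bridge cb pb (proj1 (andP bs)) aps.
  have tb' : t < b + d.+1 by rewrite addnS ltnS; case/andP: bt.
  by apply: cut1_bridge cb' tb' _ atr; rewrite addnS.
- move=> x; rewrite !inE f0 fm => /orP[] /eqP ->.
    rewrite (_ : [set _ | _ & _] = [set [set v p; v s]]) ?cards1 //; apply/setP => E; rewrite !inE.
    have [->|_] := eqVneq E [set v p; v s]; first by rewrite !inE eqxx orbT.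
    by have [->|//] := eqVneq E [set v t; v r]; rewrite !inE (negbTE vst) (negbTE vsr).
  rewrite (_ : [set _ | _ & _] = [set [set v t; v r]]) ?cards1 //; apply/setP => E; rewrite !inE.
  have [->|_] := eqVneq E [set v t; v r]; first by rewrite !inE eqxx orbT.
  by have [->|//] := eqVneq E [set v p; v s]; rewrite !inE (negbTE vtp) eq_sym (negbTE vst).
Qed.

(** The single edge across cut b + d + 1 is both the right bridge of one block and the left bridge
    of the next. *)
Lemma copies_joined b f g : good b -> copy_at b f -> copy_at (b + d.+1) g -> joined e f g.
Proof.
move=> gb [_ _ _ [s [t [p [r [bsh f0 fm]]]]]] [_ _ _ [s' [t' [p' [r' [bsh' g0 gm]]]]]].
have [cb cb' b0 bn] := good_cuts gb.
have [_ bt _ _ rb _ atr _ _ _] := bsh.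
have [bs' _ _ pb' _ aps' _ _ _ _] := bsh'.
have tb : t < b + d.+1 by rewrite addnS ltnS; case/andP: bt.
have rb' : b + d.+1 <= r by rewrite addnS.
have [tE rE] := cut1_uniq cb' tb rb' atr pb' (proj1 (andP bs')) aps'.
apply/existsP; exists (v t); rewrite !inE fm eqxx orbT /=.
apply/existsP; exists (v r); rewrite !inE g0 rE eqxx /= -rE.
exact: cut1_bridge cb' tb rb' atr.
Qed.


Lemma good_sep b b' : good b -> good b' -> b != b' -> d < dist b b'.
Proof. by move=> /andP[sb _] /andP[sb' _]; apply: (small_sep adjC adj_irr d3 adj_deg). Qed.

Definition goods := [seq b <- iota 0 n | good b].

Lemma mem_goods b : (b \in goods) = good b.
Proof.
rewrite mem_filter mem_iota add0n /=; case: (boolP (good b)) => //= gb.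
by have [_ _ _ bn] := good_cuts gb; apply: leq_ltn_trans bn; apply: leq_addr.
Qed.

Lemma uniq_goods : uniq goods.
Proof. by rewrite filter_uniq ?iota_uniq. Qed.

Lemma sorted_goods : sorted (fun b b' => b + d.+1 <= b') goods.
Proof.
have : sorted ltn goods.
  by apply: sorted_filter (iota_ltn_sorted 0 n) => y x z; apply: ltn_trans.
apply: (sub_in_sorted (P := good)); last by apply/allP => b; rewrite mem_goods.
move=> b b' gb gb' lt; have bb' : b < b' := lt.
have ne : b != b' by rewrite neq_ltn bb'.
by have := good_sep gb gb' ne; rewrite /dist; lia.
Qed.

Lemma badP p : reflect (exists2 b, good b & b <= p <= b + d) (~~ bad p).
Proof.
rewrite negbK; apply: (iffP existsP) => [[b /andP[gb bp]]|[b gb bp]]; first by exists b.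
have [_ _ _ bn] := good_cuts gb; have bn' : b < n by lia.
by exists (Ordinal bn'); rewrite /= gb.
Qed.

Lemma chain_end_bad b : good b -> b + d.+1 \notin goods -> bad (b + d.+1).
Proof.
move=> gb; rewrite mem_goods => ng; apply: contraNT ng => /badP[b' gb' bb'].
have [/andP[sb _] /andP[sb' _]] := (gb, gb').
have sB : small (b + d.+1) by move: gb => /and5P[].
have [->//|ne] := eqVneq (b + d.+1) b'.
by have := small_sep adjC adj_irr d3 adj_deg sB sb' ne; move: bb'; rewrite /dist; lia.
Qed.

(** By [chain_end_bad] the position right after the last block of a run is bad, and distinct runs
    give distinct positions. *)
Lemma size_chains : size (runs d.+1 goods) <= \sum_(p < n) bad p.
Proof.
apply: leq_trans (size_runs _ sorted_goods) _ => //.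
rewrite -size_filter -(size_map (addn^~ d.+1)).
have -> : \sum_(p < n) bad p = size [seq p <- iota 0 n | bad p].
  rewrite -(big_mkord xpredT (fun p => nat_of_bool (bad p))) /index_iota subn0.
  by rewrite size_filter -sum1_count [RHS]big_mkcond; apply: eq_bigr => p _; case: (bad p).
apply: uniq_leq_size.
  rewrite map_inj_uniq => [|x z /addIn //]; exact: (filter_uniq _ uniq_goods).
move=> z /mapP[b]; rewrite mem_filter => /andP[nb bg] ->.
have gb : good b by rewrite -mem_goods.
rewrite mem_filter mem_iota add0n chain_end_bad //=.
by have [_ _ _ bn] := good_cuts gb.
Qed.

Lemma goods_cover : n <= \sum_(p < n) bad p + size goods * d.+1.
Proof.
have H p : 1 <= bad p + \sum_(b <- goods) (b <= p < b + d.+1).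
  case: (boolP (bad p)) => // /badP[b gb bp].
  rewrite (big_rem b) ?mem_goods //= (_ : b <= p < b + d.+1) //; lia.
rewrite -[X in X <= _]card_ord -sum1_card.
apply: (@leq_trans (\sum_(p < n) (bad p + \sum_(b <- goods) (b <= p < b + d.+1)))).
  by apply: leq_sum => p _; apply: H.
rewrite big_split leq_add2l exchange_big /= -sum1_size big_distrl /=.
by apply: leq_sum => b _; rewrite sum_interval mul1n; lia.
Qed.

Lemma chain_decomposition :
  exists (F : {set {ffun 'I_d.+1 -> T}}) (chains : seq (seq {ffun 'I_d.+1 -> T})),
   [/\ {in F, forall f, induced_L e f},
       {in F &, forall f g, f != g -> [disjoint verts f & verts g]},
       #|~: \bigcup_(f in F) verts f| <= \sum_(p < n) bad p,
       {in F, forall f, has_terminal_bridges e f}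
     & [/\ uniq (flatten chains), flatten chains =i F,
           all (is_chain e) chains
         & size chains <= \sum_(p < n) bad p]].
Proof.
have [emb embP] : exists emb : nat -> {ffun 'I_d.+1 -> T}, forall b, good b -> copy_at b (emb b).
  have [b|emb embP] := @choice _ _ (fun b (f : {ffun 'I_d.+1 -> T}) => good b -> copy_at b f).
    case: (boolP (good b)) => [/copy_exists[f fP]|]; first by exists f.
    by exists [ffun=> v 0].
  by exists emb.
have disj b b' : good b -> good b' -> b != b' -> [disjoint verts (emb b) & verts (emb b')].
  move=> gb gb' ne; have [_ -> _ _] := embP b gb; have [_ -> _ _] := embP b' gb'.
  rewrite disjoint_subset; apply/subsetP => x; rewrite !inE.
  by have := good_sep gb gb' ne; rewrite /dist; lia.
have emb_inj : {in goods &, injective emb}.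
  move=> b b'; rewrite !mem_goods => gb gb' E; apply/eqP/negPn/negP => ne.
  have := disj _ _ gb gb' ne; rewrite -E -setI_eq0 setIid => /eqP E0.
  have : emb b ord0 \in verts (emb b) by apply: imset_f; rewrite inE.
  by rewrite E0 inE.
pose F := [set f in map emb goods].
have FP f : f \in F -> exists2 b, good b & f = emb b.
  by rewrite inE => /mapP[b]; rewrite mem_goods => gb ->; exists b.
exists F, (map (map emb) (runs d.+1 goods)).
have flE : flatten (map (map emb) (runs d.+1 goods)) = map emb goods.
  by rewrite -map_flatten flatten_runs.
split.
- by move=> f /FP[b gb ->]; have [] := embP b gb.
- move=> f g /FP[b gb ->] /FP[b' gb' ->] ne; apply: disj => //.
  by apply: contraNneq ne => ->.
- have -> : \sum_(p < n) bad p = #|[set x | bad (idx x)]|.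
    rewrite -sum1_card [RHS]big_mkcond [RHS](reindex _ (onW_bij _ v_bij)).
    by apply: eq_bigr => p _; rewrite inE /= vK //; case: (bad p).
  apply/subset_leq_card/subsetP => x; rewrite !inE; apply: contraNT => /badP[b gb bx].
  apply/bigcupP; exists (emb b); first by rewrite inE map_f // mem_goods.
  by have [_ -> _ _] := embP b gb; rewrite inE.
- by move=> f /FP[b gb ->]; have [] := embP b gb.
- split.
  + by rewrite flE map_inj_in_uniq ?uniq_goods.
  + by move=> f; rewrite flE inE.
  + apply/allP => _ /mapP[r rr ->]; have /allP/(_ r rr) := runs_sorted d.+1 goods.
    have rg b : b \in r -> good b.
      by move=> br; rewrite -mem_goods -(flatten_runs d.+1 goods); apply/flattenP; exists r.
    move=> /andP[r0 srt]; rewrite /is_chain -size_eq0 size_map size_eq0 r0 /=.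
    rewrite sorted_map; move: srt; apply: (sub_in_sorted (P := good)); last by apply/allP.
    move=> b b' gb gb' /eqP bE; rewrite /=; apply: copies_joined (embP _ gb) _ => //.
    by rewrite -bE; apply: embP.
  + by rewrite size_map size_chains.
Qed.


Lemma goods_disjoint p : \sum_(b <- goods) (b <= p <= b + d) <= 1.
Proof.
case: (boolP (has (fun b => b <= p <= b + d) goods)) => [/hasP[b bg bp]|/hasPn nh].
  rewrite (bigD1_seq b) ?uniq_goods //= bp big_seq_cond big1 ?addn0 // => b' /andP[b'g ne].
  move: bg b'g; rewrite !mem_goods => gb gb'.
  apply/eqP; rewrite eqb0; apply/negP => b'p.
  by have := good_sep gb' gb ne; rewrite /dist; lia.
by rewrite big_seq big1 // => b /nh /negbTE ->.
Qed.

Lemma goods_size : size goods * d.+1 <= n.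
Proof.
have <- : \sum_(b <- goods) \sum_(p < n) (b <= p < b + d.+1) = size goods * d.+1.
  rewrite -sum1_size big_distrl big_seq [RHS]big_seq; apply: eq_bigr => b /=.
  rewrite mem_goods => gb; have [_ _ _ bn] := good_cuts gb.
  by rewrite sum_interval mul1n; lia.
rewrite exchange_big /= -[X in _ <= X]card_ord -sum1_card; apply: leq_sum => p _.
apply: leq_trans (goods_disjoint p); apply: leq_sum => b _.
by rewrite addnS ltnS.
Qed.

(* The height rises by 3 across each copy, in steps of at most 1 along edges: it is 0 up to the
   first terminal, 1 on the middle vertices, 2 on the second terminal and 3 beyond. *)
Lemma diameter_ge : 0 < n -> 3 * size goods <= diameter e.
Proof.
move=> n0.
have [st stP] : exists st : nat -> nat * nat, forall b, good b ->
    exists p r, block_shape b (st b).1 (st b).2 p r.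
  have [b|st stP] := @choice _ _ (fun b (x : nat * nat) => good b -> exists p r, block_shape b x.1 x.2 p r).
    case: (boolP (good b)) => [/good_shape[s [t [p [r H]]]]|]; first by exists (s, t) => _; exists p, r.
    by exists (0, 0).
  by exists st.
pose ht b p := if p < b then 0 else if b + d < p then 3 else
  if p == (st b).1 then 0 else if p == (st b).2 then 2 else 1.
(* The height of a block rises only along edges whose smaller end lies in that block. Blocks are
   disjoint, so the sum of all heights rises by at most 1 along an edge. *)
have ht_step b p q : good b -> adj p q -> ht b q <= ht b p + (b <= minn p q <= b + d).
  move=> gb apq; have [cb _ b0 bn] := good_cuts gb.
  have [pp [r [bs bt /negbTE st_ne pb rb aps atr nst _ bout]]] := stP b gb.
  rewrite /ht; case: (ltnP p b) => pb0.
    case: (ltnP q b) => qb0 //; case: (ltnP (b + d) q) => qb1.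
      have [_ qE] := @cut1_uniq b p q pp (st b).1 cb pb0 qb0 apq pb ltac:(lia) aps.
      by exfalso; lia.
    rewrite adjC in apq; case: (bout q p ltac:(lia) ltac:(lia) apq) => -[qE pE].
      by rewrite qE eqxx.
    by exfalso; lia.
  case: (ltnP (b + d) p) => pb1.
    by case: ifP => // _; case: ifP => // _; case: ifP => // _; case: ifP.
  case: (ltnP q b) => qb0 //; case: (ltnP (b + d) q) => qb1.
    rewrite (_ : b <= minn p q <= b + d); last by lia.
    case: (bout p q ltac:(lia) ltac:(lia) apq) => -[pE qE]; first by exfalso; lia.
    by rewrite pE eq_sym st_ne eqxx.
  rewrite (_ : b <= minn p q <= b + d); last by lia.
  case: eqP => [//|qs]; case: eqP => [qt|qt].
    case: eqP => [ps|ps]; last by case: eqP.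
    by move: nst; rewrite -ps -qt apq.
  by case: eqP => //; case: eqP.
pose h x := \sum_(b <- goods) ht b (idx x).
have lip u w : e u w -> h w <= (h u).+1.
  rewrite -adj_idx => uw.
  apply: leq_trans (_ : h u + \sum_(b <- goods) (b <= minn (idx u) (idx w) <= b + d) <= _).
    rewrite -big_split /h big_seq [X in _ <= X]big_seq; apply: leq_sum => b.
    by rewrite mem_goods => gb; apply: ht_step.
  by rewrite -addn1 leq_add2l goods_disjoint.
have h0 : h (v 0) = 0.
  rewrite /h vK // big_seq big1 // => b; rewrite mem_goods => gb.
  by have [_ _ b0 _] := good_cuts gb; rewrite /ht b0.
have h1 : h (v n.-1) = 3 * size goods.
  rewrite /h vK; last by lia.
  rewrite -sum1_size big_distrr big_seq [RHS]big_seq; apply: eq_bigr => b.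
  rewrite mem_goods => gb; have [_ _ b0 bn] := good_cuts gb.
  have bn1 : b <= n.-1 by lia.
  have bn2 : b + d < n.-1 by lia.
  by rewrite /ht ltnNge bn1 bn2.
apply: leq_trans (graph_dist_diameter e (v 0) (v n.-1)).
have := @graph_dist_ge _ e h (v 0) (v n.-1) lip; rewrite h0 h1 !add0n cardT; apply.
by have := goods_size; nia.
Qed.

End Numbered.

(** * The Fiedler vector *)

Section Fiedler.
Local Open Scope ring_scope.
Variables (R : realType) (T : finType) (e : rel T).
Hypothesis eC : symmetric e.
Hypothesis eirr : irreflexive e.
Hypothesis econ : connected_graph e.

Let L := laplacian R e.

Lemma laplacian_sym : L^T = L.
Proof.
apply/matrixP => i j; rewrite !mxE eC eq_sym.
by case: eqP => [->|].
Qed.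

Definition of_row (v : 'rV[R]_#|T|) (x : T) : R := v 0 (enum_rank x).

Lemma mul_laplacian (v : 'rV[R]_#|T|) x :
  (v *m L) 0 (enum_rank x) = \sum_y (e x y)%:R * (of_row v x - of_row v y).
Proof.
rewrite mxE (reindex_onto enum_rank enum_val) => [|i _]; last by rewrite enum_valK.
rewrite (eq_bigl xpredT) => [|y]; last by rewrite enum_rankK eqxx.
under eq_bigr => y _ do rewrite mxE !enum_rankK (inj_eq enum_rank_inj) -/(of_row v y) mulrBr.
rewrite sumrB (bigD1 x) //= eqxx mulr1n big1 ?addr0 => [|y /negbTE ->]; last by rewrite mulr0n mulr0.
have -> : (degree e x)%:R = \sum_y (e x y)%:R :> R.
  rewrite /degree -sum1_card natr_sum big_mkcond /=; apply: eq_bigr => y _.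
  by rewrite inE; case: (e x y).
rewrite mulr_sumr -sumrB; apply: eq_bigr => y _; rewrite eC; ring.
Qed.

Lemma laplacian_energy (f : T -> R) :
  2 * \sum_x f x * \sum_y (e x y)%:R * (f x - f y) =
  \sum_x \sum_y (e x y)%:R * (f x - f y) ^+ 2.
Proof.
have E1 : \sum_x f x * \sum_y (e x y)%:R * (f x - f y) =
  \sum_x \sum_y (e x y)%:R * (f x * (f x - f y)).
  by apply: eq_bigr => x _; rewrite mulr_sumr; apply: eq_bigr => y _; ring.
have E2 : \sum_x f x * \sum_y (e x y)%:R * (f x - f y) =
  \sum_x \sum_y (e x y)%:R * (f y * (f y - f x)).
  by rewrite E1 exchange_big; apply: eq_bigr => x _; apply: eq_bigr => y _; rewrite eC.
rewrite mulr2n mulrDl mul1r {1}E1 E2 -big_split; apply: eq_bigr => x _ /=.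
by rewrite -big_split; apply: eq_bigr => y _ /=; ring.
Qed.

Lemma harmonic_const (f : T -> R) :
  (forall x, \sum_y (e x y)%:R * (f x - f y) = 0) -> forall x y, f x = f y.
Proof.
move=> H.
have edge x y : e x y -> f x = f y.
  move=> exy; have := laplacian_energy f.
  rewrite big1 ?mulr0 => [|z _]; last by rewrite H mulr0.
  move=> /esym/eqP; rewrite psumr_eq0 => [|z _]; last first.
    by apply: sumr_ge0 => w _; rewrite mulr_ge0 ?ler0n ?sqr_ge0.
  move=> /allP/(_ x); rewrite mem_index_enum => /(_ isT).
  rewrite psumr_eq0 => [|z _]; last by rewrite mulr_ge0 ?ler0n ?sqr_ge0.
  move=> /allP/(_ y); rewrite mem_index_enum => /(_ isT).
  by rewrite exy mul1r sqrf_eq0 subr_eq0 => /eqP.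
move=> x y; have /forallP/(_ x)/forallP/(_ y)/connectP[p] := econ.
elim: p x => [|z p IH] x /=; first by move=> _ ->.
by move=> /andP[/edge -> pz] ey; apply: IH.
Qed.

Lemma eigenvalue_laplacian a : eigenvalue L a ->
  exists f : T -> R, (exists x, f x != 0) /\
    forall x, \sum_y (e x y)%:R * (f x - f y) = a * f x.
Proof.
move=> /eigenvalueP[v vL v0]; exists (of_row v); split.
  have /rV0Pn[i vi] := v0; exists (enum_val i).
  by rewrite /of_row enum_valK.
by move=> x; rewrite -mul_laplacian vL mxE.
Qed.

Lemma eigenvalue_ge0 a : eigenvalue L a -> 0 <= a.
Proof.
move=> /eigenvalue_laplacian[f [[x fx] fL]]; have := laplacian_energy f.
under eq_bigr => z _ do rewrite fL.
have -> : \sum_z f z * (a * f z) = a * \sum_z f z ^+ 2.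
  by rewrite mulr_sumr; apply: eq_bigr => z _; ring.
set Q := \sum_z f z ^+ 2; have Q0 : 0 < Q.
  rewrite /Q (bigD1 x) //= ltr_wpDr ?exprn_even_gt0 //.
  by apply: sumr_ge0 => z _; apply: sqr_ge0.
have : 0 <= \sum_z \sum_w (e z w)%:R * (f z - f w) ^+ 2.
  by apply: sumr_ge0 => z _; apply: sumr_ge0 => w _; rewrite mulr_ge0 ?ler0n ?sqr_ge0.
move=> + E; rewrite -E mulrA pmulr_lge0 //; lra.
Qed.

Lemma spectrum_eigenvalue a : a \in spectrum L -> eigenvalue L a.
Proof.
have [_ chL] := spectrumP laplacian_sym.
by rewrite eigenvalue_root_char chL root_prod_XsubC.
Qed.

Lemma size_spectrum : size (spectrum L) = #|T|.
Proof.
have [_ chL] := spectrumP laplacian_sym.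
by have := size_char_poly L; rewrite chL size_prod_XsubC => -[].
Qed.

Lemma null_row_const (a : 'rV[complex R]_#|T|) :
  a *m map_mx (real_complex R) L = 0 -> forall i j, a 0 i = a 0 j.
Proof.
move=> aL i j.
have part (h : {additive complex R -> R}) :
    (forall (x : R) z, h (z * (real_complex R x)) = h z * x) -> h (a 0 i) = h (a 0 j).
  move=> hM; pose v := map_mx h a.
  have vL : v *m L = 0.
    apply/rowP => k; have /rowP/(_ k) := aL; rewrite !mxE => /(congr1 h).
    rewrite raddf_sum raddf0 => hE; apply: etrans _ hE.
    by apply: eq_bigr => l _; rewrite !mxE hM.
  have := @harmonic_const (of_row v).
  have H x : \sum_y (e x y)%:R * (of_row v x - of_row v y) = 0.
    by rewrite -mul_laplacian vL mxE.
  move=> /(_ H (enum_val i) (enum_val j)).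
  by rewrite /of_row !enum_valK !mxE.

apply/eqP; rewrite eq_complex; apply/andP; split; apply/eqP.
  by apply: (part (@complex.Re R)) => x [u w] /=; rewrite mulr0 subr0.
by apply: (part (@complex.Im R)) => x [u w] /=; rewrite mulr0 add0r.
Qed.


(* Two zero diagonal entries in the spectral decomposition would give two null rows of the unitary
   matrix; both are constant because the graph is connected, contradicting invertibility. *)
Lemma spectrum_zero_simple : (count_mem 0%R (spectrum L) <= 1)%N.
Proof.
pose toC : {rmorphism R -> complex R} := real_complex R.
pose A := map_mx toC L.
have Aherm : A \is hermsymmx.
  apply: realsym_hermsym.
    apply/is_hermitianmxP; rewrite expr0 scale1r map_mx_id //.
    by rewrite /A map_trmx laplacian_sym.
  by apply/mxOverP => i j; rewrite mxE; apply/complex_realP; exists (L i j).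
have /orthomx_spectralP AE := hermitian_normalmx Aherm.
set P := spectralmx A in AE; set D := spectral_diag A in AE.
have Pu : P \in unitmx by apply: spectral_unit.
have [_ chL] := spectrumP laplacian_sym.
have prE : perm_eq (map toC (spectrum L)) [seq D 0 i | i <- enum 'I_#|T|].
  apply: prod_XsubC_eq; transitivity (char_poly A).
    rewrite -map_char_poly chL rmorph_prod big_map; apply: eq_bigr => x _.
    by rewrite rmorphB /= map_polyX map_polyC.
  rewrite AE char_poly_conj // char_poly_trig ?diag_mx_is_trig //.
  rewrite big_map big_enum; apply: eq_bigr => i _.
  by rewrite !mxE eqxx mulr1n.
have -> : count_mem 0%R (spectrum L) = count_mem 0%R [seq D 0 i | i <- enum 'I_#|T|].
  rewrite -(seq.permP prE) count_map; apply: eq_count => x /=.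
  by rewrite -(rmorph0 toC) (inj_eq (fmorph_inj toC)).
rewrite count_map leqNgt; apply/negP.
have -> : count (preim (fun i => D 0 i) (pred1 0)) (enum 'I_#|T|) = #|[pred i | D 0 i == 0]|.
  by rewrite -sum1_count big_enum_cond /= -[RHS]sum1_card; apply: eq_bigl => i; rewrite inE.
move=> /card_gt1P[i [j [/eqP Di /eqP Dj ij]]].
have rowA k : D 0 k = 0 -> row k P *m A = 0.
  move=> Dk; rewrite rowE AE !mulmxA mulmxK //.
  rewrite -rowE (_ : row k (diag_mx D) = 0) ?mul0mx //.
  by apply/rowP => l; rewrite !mxE Dk mul0rn.
have ci := null_row_const (rowA i Di); have cj := null_row_const (rowA j Dj).
have lin : P j i *: row i P - P i i *: row j P = 0.
  apply/rowP => k; have := ci k i; have := cj k i; rewrite !mxE => -> ->; ring.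
have unitC (u : 'rV[complex R]_#|T|) : u *m P = 0 -> u = 0.
  by move=> uP; rewrite -(mulmxK Pu u) uP mul0mx.
have H : P j i *: delta_mx 0 i - P i i *: delta_mx 0 j = 0 :> 'rV[complex R]_#|T|.
  by apply: unitC; rewrite mulmxBl -!scalemxAl -!rowE.
have Pji : P j i = 0.
  have /rowP/(_ i) := H; rewrite !mxE !eqxx (negbTE ij) /= mulr1 mulr0 subr0; exact.
have : delta_mx 0 j = 0 :> 'rV[complex R]_#|T|.
  apply: unitC; rewrite -rowE; apply/rowP => k; have := cj k i.
  by rewrite !mxE Pji.
move=> /rowP/(_ j); rewrite !mxE !eqxx /= => /eqP; by rewrite oner_eq0.
Qed.

Lemma algebraic_connectivity_gt0 : (1 < #|T|)%N -> 0 < algebraic_connectivity R e.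
Proof.
move=> T1; rewrite /algebraic_connectivity -/L.
have [srt _] := spectrumP laplacian_sym; rewrite -/L in srt.
have := spectrum_zero_simple; have := size_spectrum; have := @spectrum_eigenvalue.
move: (spectrum L) srt => [|s0 [|s1 s]] /=; try by move=> _ _ sz; rewrite -sz in T1.
move=> /andP[s01 _] ev sz cnt.
have p0 : 0 <= s0 by apply/eigenvalue_ge0/ev; rewrite inE eqxx.
rewrite lt_neqAle (le_trans p0 s01) andbT; apply/eqP => s1E.
have s0E : s0 = 0 by apply/eqP; rewrite eq_le p0 s1E s01.
by move: cnt; rewrite -s1E s0E !eqxx.
Qed.

(** Summed over all vertices, the left side of the eigenvalue equation cancels by antisymmetry; a
    positive eigenvalue then forces zero mean. *)
Lemma fiedler_exists : (1 < #|T|)%N -> exists f : T -> R,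
  [/\ exists x, f x != 0, \sum_x f x = 0 &
    forall x, \sum_y (e x y)%:R * (f x - f y) = algebraic_connectivity R e * f x].
Proof.
move=> T1; have mu0 := algebraic_connectivity_gt0 T1.
have : eigenvalue L (algebraic_connectivity R e).
  by apply: spectrum_eigenvalue; apply: mem_nth; rewrite size_spectrum.
move=> /eigenvalue_laplacian[f [fn0 fL]]; exists f; split=> //.
have : \sum_x \sum_y (e x y)%:R * (f x - f y) = 0.
  apply/eqP; rewrite -[_ == 0](mulrn_eq0 _ 2) /= mulr2n.
  rewrite {2}exchange_big -big_split big1 //= => x _.
  by rewrite -big_split big1 //= => y _; rewrite eC; ring.
under eq_bigr => x _ do rewrite fL.
by rewrite -mulr_sumr => /eqP; rewrite mulf_eq0 gt_eqF //= => /eqP.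
Qed.

End Fiedler.

(** * The one-dimensional comparison *)

Section Trig.
Local Open Scope ring_scope.
Variable R : realType.

Lemma cos_ge_sub (x : R) : 0 <= x -> 1 - x <= cos x.
Proof.
move=> x0; have [x00|x1] := eqVneq x 0; first by rewrite x00 cos0; lra.
have xp : 0 < x by rewrite lt_neqAle eq_sym x1.
have [z _ E] := @MVT R cos (fun t => - sin t) 0 x xp (fun t _ => is_derive_cos t)
   ltac:(apply: continuous_subspaceT; exact: continuous_cos).
have := sin_le1 z; move: E; rewrite cos0 subr0 => E s1.
have : sin z * x <= 1 * x by rewrite ler_wpM2r.
lra.
Qed.

Lemma sin_ge_quad (x : R) : 0 <= x -> x * (1 - x) <= sin x.
Proof.
move=> x0; have [x00|x1] := eqVneq x 0; first by rewrite x00 sin0; lra.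
have xp : 0 < x by rewrite lt_neqAle eq_sym x1.
have [z /andP[z0 zx] E] := @MVT R sin cos 0 x xp (fun t _ => is_derive_sin t)
   ltac:(apply: continuous_subspaceT; exact: continuous_sin).
move: E; rewrite sin0 !subr0 => ->; rewrite mulrC ler_wpM2r //.
by apply: le_trans (cos_ge_sub _); move: z0 zx; rewrite /= !bnd_simp; lra.
Qed.

(** With z = pi / (2 n) the right side is 4 n^2 sin(z)^2, and sin z >= z (1 - z) gives at least 4
    n^2 z^2 (1 - 2 z). The crude loss pi / n is harmless, as errors of order 1/n occur anyway. *)
Lemma cos_gap (n : nat) : (4 <= n)%N ->
  pi ^+ 2 * (1 - pi / n%:R) <= n%:R ^+ 2 * (2 * (1 - cos (pi / n%:R))) :> R.
Proof.
move=> n4; have n4R : 4 <= n%:R :> R by rewrite (ler_nat _ 4).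
have p0 := pi_gt0 R; have p4 : pi <= 4 :> R by have := pihalf_lt2 R; lra.
pose z : R := pi / (2 * n%:R).
have z0 : 0 <= z by rewrite divr_ge0; lra.
have z1 : z <= 1 by rewrite /z ler_pdivrMr; lra.
have -> : pi / n%:R = z *+ 2 :> R by rewrite mulr2n /z; field; apply/eqP; lra.
rewrite cos_mulr2n.
have -> : cos z ^+ 2 = 1 - sin z ^+ 2 by have := cos2Dsin2 z; lra.
have := sin_ge_quad z0; have : 0 <= z * (1 - z) by apply: mulr_ge0; lra.
move: (sin z) => s q0 qs.
have : (z * (1 - z)) ^+ 2 <= s ^+ 2 by rewrite ler_sqr ?nnegrE; lra.
have piE : pi = 2 * n%:R * z :> R by rewrite /z; field; apply/eqP; lra.
clearbody z; move=> H; have : n%:R ^+ 2 * (z * (1 - z)) ^+ 2 <= n%:R ^+ 2 * s ^+ 2 :> R.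
  by rewrite ler_wpM2l ?sqr_ge0.
rewrite [pi]piE => H2.
have Z4 : 0 <= n%:R ^+ 2 * z ^+ 4 :> R by rewrite mulr_ge0 ?exprn_ge0 ?ler0n.
have -> : n%:R ^+ 2 * (2 * (1 - ((1 - s ^+ 2) *+ 2 - 1))) = 4 * (n%:R ^+ 2 * s ^+ 2) by ring.
have -> : (2 * n%:R * z) ^+ 2 * (1 - z *+ 2) =
  4 * (n%:R ^+ 2 * (z * (1 - z)) ^+ 2) - 4 * (n%:R ^+ 2 * z ^+ 4) by ring.
move: (n%:R ^+ 2 * (z * (1 - z)) ^+ 2) (n%:R ^+ 2 * s ^+ 2) (n%:R ^+ 2 * z ^+ 4) H2 Z4 => X Y Z.
by move=> H2 Z4; lra.
Qed.

End Trig.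

Section Wirtinger.
Local Open Scope ring_scope.
Variable R : realType.

Lemma sum_shift n (G : nat -> R) : G 0%N = 0 ->
  \sum_(i < n) G i.+1 = \sum_(i < n.+1) G i.
Proof. by move=> G0; rewrite big_ord_recl /= G0 add0r. Qed.

(* Picone: with phi i = sin (i pi / n), AM-GM gives
   2 S_i S_(i+1) <= S_i^2 phi_(i+1) / phi_i + S_(i+1)^2 phi_i / phi_(i+1),
   and the coefficient of S_i^2 in the sum is (phi_(i+1) + phi_(i-1)) / phi_i = 2 cos (pi / n).
   The terms with i = 0 or i + 1 = n vanish because x / 0 = 0. *)
Lemma wirtinger n (S : nat -> R) : (0 < n)%N -> S 0%N = 0 -> S n = 0 ->
  2 * (1 - cos (pi / n%:R)) * \sum_(i < n.+1) S i ^+ 2 <= \sum_(i < n) (S i.+1 - S i) ^+ 2.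
Proof.
move=> n0 S0 Sn; pose th : R := pi / n%:R; pose phi (i : nat) : R := sin (th * i%:R).
have nR : 0 < n%:R :> R by rewrite ltr0n.
have p0 := pi_gt0 R; have th0 : 0 < th by rewrite divr_gt0.
have thn : th * n%:R = pi by rewrite /th divfK // gt_eqF.
have phi0 i : (0 < i < n)%N -> 0 < phi i.
  move=> /andP[i0 lin]; apply: sin_gt0_pi; rewrite mulr_gt0 ?ltr0n //=.
  by rewrite -thn ltr_pM2l // ltr_nat.
have rec i : (0 < i)%N -> phi i.+1 + phi i.-1 = 2 * cos th * phi i.
  move=> i0; have -> : phi i.+1 = sin (th * i%:R + th) by rewrite /phi -natr1; congr sin; ring.
  have -> : phi i.-1 = sin (th * i%:R - th).
    by rewrite /phi -{2}(prednK i0) -natr1; congr sin; ring.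
  by rewrite sinD sinB /phi; ring.
pose H i : R := S i ^+ 2 * (phi i.+1 / phi i).
pose G i : R := S i ^+ 2 * (phi i.-1 / phi i).
have amgm i : (i < n)%N -> 2 * (S i * S i.+1) <= H i + G i.+1.
  move=> lin; rewrite /H /G /=; case: (posnP i) => [->|i0].
    have -> : phi 0%N = 0 by rewrite /phi mulr0 sin0.
    by rewrite S0 mul0r mulr0 expr0n /= !mul0r mulr0 addr0.
  have [iN|iN] := eqVneq i.+1 n.
    have -> : phi i.+1 = 0 by rewrite /phi iN thn sinpi.
    by rewrite iN Sn mulr0 mulr0 mul0r mulr0 expr0n /= mul0r addr0.
  have f0 : 0 < phi i by apply: phi0; rewrite i0.
  have f1 : 0 < phi i.+1 by apply: phi0; lia.
  rewrite -subr_ge0.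
  have -> : S i ^+ 2 * (phi i.+1 / phi i) + S i.+1 ^+ 2 * (phi i / phi i.+1) - 2 * (S i * S i.+1) =
     (S i * phi i.+1 - S i.+1 * phi i) ^+ 2 / (phi i * phi i.+1).
    by field; rewrite !gt_eqF.
  by rewrite mulr_ge0 ?sqr_ge0 // invr_ge0 mulr_ge0 // ltW.
have E1 : \sum_(i < n) (S i.+1 - S i) ^+ 2 =
    2 * \sum_(i < n.+1) S i ^+ 2 - \sum_(i < n) 2 * (S i * S i.+1).
  have A : \sum_(i < n) S i.+1 ^+ 2 = \sum_(i < n.+1) S i ^+ 2.
    by apply: (@sum_shift n (fun i => S i ^+ 2)); rewrite S0 expr0n.
  have B : \sum_(i < n) S i ^+ 2 = \sum_(i < n.+1) S i ^+ 2.
    by rewrite big_ord_recr /= Sn expr0n addr0.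
  rewrite mulr2n mulrDl mul1r -{1}A -B -big_split -sumrB; apply: eq_bigr => i _ /=; ring.
have E2 : \sum_(i < n) (H i + G i.+1) = 2 * cos th * \sum_(i < n.+1) S i ^+ 2.
  rewrite big_split /= (@sum_shift n G); last by rewrite /G S0 expr0n mul0r.
  have -> : \sum_(i < n) H i = \sum_(i < n.+1) H i.
    by rewrite big_ord_recr /= /H Sn expr0n mul0r addr0.
  rewrite -big_split mulr_sumr; apply: eq_bigr => i _ /=.
  rewrite /H /G; case: (posnP i) => [->|i0]; first by rewrite S0 expr0n /= !mul0r mulr0 addr0.
  have [->|iN] := eqVneq (i : nat) n; first by rewrite Sn expr0n /= !mul0r mulr0 addr0.
  have f0 : 0 < phi i by apply: phi0; have := ltn_ord i; lia.
  by rewrite -mulrDr -mulrDl rec // mulfK ?gt_eqF // mulrC.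
have : \sum_(i < n) 2 * (S i * S i.+1) <= \sum_(i < n) (H i + G i.+1).
  by apply: ler_sum => i _; apply: amgm.
rewrite E1 E2 -/th; lra.
Qed.

End Wirtinger.

(** * Partial sums of a sorted sequence with zero sum *)

Section Concave.
Local Open Scope ring_scope.
Variables (R : realFieldType) (n : nat) (a : nat -> R).
Hypothesis n0 : (0 < n)%N.
Hypothesis amono : forall i j, (i <= j)%N -> (j < n)%N -> a i <= a j.
Hypothesis asum : \sum_(i < n) a i = 0.

Definition psum i : R := - \sum_(j < i) a j.

Lemma psum0 : psum 0 = 0. Proof. by rewrite /psum big_ord0 oppr0. Qed.
Lemma psumn : psum n = 0. Proof. by rewrite /psum asum oppr0. Qed.
Lemma psumS i : psum i.+1 = psum i - a i.
Proof. by rewrite /psum big_ord_recr /= opprD. Qed.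

Lemma psum_lower i j : (i <= j)%N -> (j < n)%N -> psum i - (j - i)%:R * a j <= psum j.
Proof.
move=> ij jn.
have : forall l, (i + l <= j)%N -> psum i - l%:R * a j <= psum (i + l).
  elim=> [|l IH] il; first by rewrite addn0 mul0r subr0.
  rewrite addnS psumS -natr1 mulrDl mul1r.
  have := IH ltac:(lia); have := @amono (i + l) j ltac:(lia) jn; lra.
by move=> /(_ (j - i)%N); rewrite subnKC //; exact.
Qed.

Lemma psum_upper j k : (j <= k)%N -> (k <= n)%N -> psum k <= psum j - (k - j)%:R * a j.
Proof.
move=> jk kn.
have : forall l, (j + l <= k)%N -> psum (j + l) <= psum j - l%:R * a j.
  elim=> [|l IH] il; first by rewrite addn0 mul0r subr0.
  rewrite addnS psumS -natr1 mulrDl mul1r.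
  have := IH ltac:(lia); have := @amono j (j + l) ltac:(lia) ltac:(lia); lra.
by move=> /(_ (k - j)%N); rewrite subnKC //; exact.
Qed.

(** By monotonicity of [a] the line of slope - a j through (j, psum j) lies above [psum] on both
    sides; the weights k - j and j - i cancel the slope. *)
Lemma psum_concave i j k : (i <= j)%N -> (j <= k)%N -> (k <= n)%N ->
  (k - j)%:R * psum i + (j - i)%:R * psum k <= (k - i)%:R * psum j.
Proof.
move=> ij jk kn; have -> : (k - i = (k - j) + (j - i))%N by lia.
rewrite natrD; case: (ltnP j n) => jn; last first.
  rewrite (_ : k = j); last by lia.
  by rewrite subnn !mul0r !add0r lexx.
have x0 : 0 <= (k - j)%:R :> R by rewrite ler0n.
have y0 : 0 <= (j - i)%:R :> R by rewrite ler0n.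
have := ler_wpM2l x0 (psum_lower ij jn); have := ler_wpM2l y0 (psum_upper jk kn).
lra.
Qed.

Lemma psum_ge0 q : (q <= n)%N -> 0 <= psum q.
Proof.
move=> qn; have := psum_concave (leq0n q) qn (leqnn n).
rewrite psum0 psumn !mulr0 addr0 subn0 pmulr_rge0 // ltr0n //.
Qed.

Lemma psum_max : exists2 m, (m <= n)%N & forall q, (q <= n)%N -> psum q <= psum m.
Proof.
have := @arg_maxP _ R _ (ord0 : 'I_n.+1) xpredT (fun i => psum i) isT.
case=> m _ H; exists m; first by rewrite -ltnS.
by move=> q qn; apply: (H (Ordinal (qn : (q < n.+1)%N))).
Qed.

(** Concavity puts [psum q] above the chord from (m, psum m) to the end (0, 0) or (n, 0) on the side
    of [q], and that chord spans a length at most n. *)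
Lemma psum_linear m q : (m <= n)%N -> (q <= n)%N ->
  psum m * (minn q (n - q))%:R <= n%:R * psum q.
Proof.
move=> mn qn; have s0 := psum_ge0 mn; have t0 := psum_ge0 qn.
case: (leqP q m) => qm.
  have := psum_concave (leq0n q) qm mn; rewrite psum0 mulr0 add0r !subn0 => H.
  have : psum m * (minn q (n - q))%:R <= psum m * q%:R by rewrite ler_wpM2l // ler_nat geq_minl.
  have : m%:R * psum q <= n%:R * psum q by rewrite ler_wpM2r // ler_nat.
  lra.
have := psum_concave (ltnW qm) qn (leqnn n); rewrite psumn mulr0 addr0 => H.
have : psum m * (minn q (n - q))%:R <= psum m * (n - q)%:R by rewrite ler_wpM2l // ler_nat geq_minr.
have : (n - m)%:R * psum q <= n%:R * psum q by rewrite ler_wpM2r // ler_nat leq_subr.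
lra.
Qed.

Lemma endpoint_signs : a 0 <= 0 /\ 0 <= a n.-1.
Proof.
have H0 := psum_upper (leq0n n) (leqnn n); have H1 := @psum_lower 0 n.-1 (leq0n _) ltac:(lia).
have H2 := psumS n.-1; rewrite (prednK n0) psumn in H2.
move: H0 H1; rewrite psum0 psumn subn0 subn0 sub0r => H0 H1.
have nR : 0 < n%:R :> R by rewrite ltr0n.
split; first by rewrite -(pmulr_rle0 _ nR); lra.
have : 0 <= (n.-1%:R + 1) * a n.-1 by rewrite mulrDl mul1r; lra.
by rewrite natr1 (prednK n0) pmulr_rge0.
Qed.

Definition gap k : R := if (0 < k < n)%N then a k - a k.-1 else 0.

Lemma gap_ge0 k : 0 <= gap k.
Proof.
rewrite /gap; case: ifP => // /andP[k0 kn]; rewrite subr_ge0 amono //; lia.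
Qed.

Lemma sum_psum_gap : \sum_(k < n.+1) psum k * gap k = \sum_(i < n) a i ^+ 2.
Proof.
have H m : (m < n)%N ->
    \sum_(k < m.+1) psum k * gap k = psum m.+1 * a m + \sum_(i < m.+1) a i ^+ 2.
  elim: m => [|m IH] mn.
    rewrite !big_ord_recr !big_ord0 /= psum0 psumS psum0; ring.
  rewrite big_ord_recr /= IH ?(ltnW mn) // [in RHS]big_ord_recr /= (psumS m.+1) /gap mn /=; ring.
rewrite big_ord_recr /= psumn mul0r addr0.
by have := H n.-1 ltac:(lia); rewrite (prednK n0) psumn mul0r add0r.
Qed.

Lemma sum_gap p q : (p < q)%N -> (q < n)%N ->
  \sum_(k < n.+1) (p < k <= q)%N%:R * gap k = a q - a p.
Proof.
move=> pq qn.
have H m : (m <= n)%N -> \sum_(k < m) (p < k <= q)%N%:R * gap k =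
   if (m <= p)%N then 0 else a (minn m.-1 q) - a p.
  elim: m => [|m IH] mn; first by rewrite big_ord0.
  rewrite big_ord_recr /= IH ?(ltnW mn) //.
  case: (ltngtP p m) => pm /=.
  - case: (leqP m q) => mq; last first.
      by rewrite mul0r addr0 /=; congr (a _ - _); lia.
    rewrite mul1r /gap (_ : (0 < m < n)%N); last by lia.
    by rewrite (_ : minn m.-1 q = m.-1) 1?(_ : minn m q = m); try lia; ring.
  - by rewrite mul0r addr0.
  - by rewrite mul0r addr0 -pm (_ : minn p q = p) ?subrr //; lia.
rewrite big_ord_recr /= H // [gap n]/gap ltnn andbF mulr0 addr0.
by rewrite leqNgt (ltn_trans pq qn) /=; congr (a _ - _); lia.
Qed.

End Concave.

Section Flux.
Local Open Scope ring_scope.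
Variables (R : realFieldType) (n : nat) (E : rel nat) (a : nat -> R) (mu : R).
Hypothesis n0 : (0 < n)%N.
Hypothesis Esym : symmetric E.
Hypothesis harm : forall p, (p < n)%N -> \sum_(q < n) (E p q)%:R * (a p - a q) = mu * a p.

(** Sum the eigenvalue equation over the positions before [i]. Edges with both ends there cancel,
    which leaves the lengths a q - a p of the edges across the cut; each length is the sum of the
    gaps that the edge spans. *)
Lemma flux i : (i <= n)%N ->
  \sum_(k < n.+1) (cut2 n E i k)%:R * gap n a k = mu * psum a i.
Proof.
move=> lin.
have E1 : \sum_(k < n.+1) (cut2 n E i k)%:R * gap n a k =
    \sum_(p < n) \sum_(q < n) ((p < i <= q)%N && E p q)%:R * (a q - a p).
  under eq_bigr => k _.
    rewrite /cut2 natr_sum mulr_suml.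
    under eq_bigr => p _ do rewrite natr_sum mulr_suml.
    over.
  rewrite exchange_big; apply: eq_bigr => p _ /=.
  rewrite exchange_big; apply: eq_bigr => q _ /=.
  case: (boolP (p < i <= q)%N) => piq; last first.
    rewrite mul0r big1 // => k _; rewrite (_ : _ && _ && _ = false) ?mul0r //.
    by apply: contraNF piq => /andP[]; lia.
  case: (E p q); last by rewrite mul0r big1 // => k _; rewrite andbF mul0r.
  rewrite mul1r -(@sum_gap R n a n0 p q) //; last by lia.
  by apply: eq_bigr => k _; congr ((nat_of_bool _)%:R * _); rewrite andbT; lia.
have E2 : mu * psum a i =
    \sum_(p < n) \sum_(q < n) ((p < i)%N && E p q)%:R * (a q - a p).
  rewrite /psum mulrN mulr_sumr -sumrN (big_ord_widen n (fun p => - (mu * a p)) lin).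
  rewrite big_mkcond; apply: eq_bigr => p _; case: (p < i)%N => /=; last first.
    by rewrite big1 // => q _; rewrite mul0r.
  by rewrite -harm // -sumrN; apply: eq_bigr => q _; rewrite -mulrN opprB.
have E3 : \sum_(p < n) \sum_(q < n) ((p < i)%N && (q < i)%N && E p q)%:R * (a q - a p) = 0.
  set X := LHS; have : X = - X.
    rewrite {1}/X exchange_big /X -sumrN; apply: eq_bigr => p _ /=; rewrite -sumrN.
    by apply: eq_bigr => q _; rewrite Esym [(q < i)%N && _]andbC -mulrN opprB.
  lra.
rewrite E1 E2 -[LHS]addr0 -[X in _ + X]E3 -big_split; apply: eq_bigr => p _ /=.
rewrite -big_split; apply: eq_bigr => q _ /=; rewrite -mulrDl -natrD; congr (_%:R * _).
by case: (p < i)%N => //=; case: (ltnP q i); case: (E p q).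
Qed.

End Flux.

(** * The energy of the defects *)

Section Energy.
Local Open Scope ring_scope.
Variables (R : realType) (d : nat).
Hypothesis d3 : (3 <= d)%N.

Let P : R := (d%:R - 1) * pi ^+ 2.
Let C1 : R := 2 * ((2 * d%:R + 1) * (2 * d%:R) + d%:R) * (P + 1).

(** The numerator collects the excess eps, the loss pi^3 / n of [cos_gap], and the Lipschitz error
    of [energy_bound], which is at most [C1] times M^2 because (n + 1) n mu <= 2 (P + 1). The
    denominator is the gain per unit of defect energy. *)
Definition defect_const : R :=
  (2 * (d%:R - 1)^-1 + 2 * pi ^+ 3 + (P + 1) * C1) / (P * kappa R d).

Lemma const_facts : [/\ 3 <= d%:R :> R, 0 < pi :> R, 0 < P & 0 < C1].
Proof.
have D3 : 3 <= d%:R :> R by rewrite (ler_nat _ 3).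
have pi0 : 0 < pi :> R := pi_gt0 R.
have P0 : 0 < P by rewrite /P mulr_gt0 ?exprn_gt0 //; lra.
split=> //; rewrite /C1 mulr_gt0 //; last exact: addr_gt0.
by rewrite mulr_gt0 // addr_gt0 ?mulr_gt0 // ?addr_gt0 ?mulr_gt0 //; lra.
Qed.

Lemma defect_const_gt0 : 0 < defect_const.
Proof.
have [D3 pi0 P0 C10] := const_facts; have P10 : 0 < P + 1 by exact: addr_gt0.
have di : 0 < (d%:R - 1)^-1 :> R by rewrite invr_gt0; lra.
have p3 : 0 < pi ^+ 3 :> R by rewrite exprn_gt0.
have pc : 0 < (P + 1) * C1 by apply: mulr_gt0.
rewrite /defect_const; apply: mulr_gt0; first by lra.
by rewrite invr_gt0 mulr_gt0 // kappa_gt0.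
Qed.

Variables (n : nat) (E : rel nat) (a : nat -> R) (mu eps : R).
Hypothesis n4 : (4 <= n)%N.
Hypothesis Esym : symmetric E.
Hypothesis Eirr : irreflexive E.
Hypothesis degE : forall p, (p < n)%N -> (d <= deg n E p)%N.
Hypothesis cut_gt0 : forall i, (0 < i < n)%N -> (0 < cut n E i)%N.
Hypothesis amono : forall i j, (i <= j)%N -> (j < n)%N -> a i <= a j.
Hypothesis asum : \sum_(i < n) a i = 0.
Hypothesis an0 : exists2 i, (i < n)%N & a i != 0.
Hypothesis harm : forall p, (p < n)%N -> \sum_(q < n) (E p q)%:R * (a p - a q) = mu * a p.
Hypothesis eps01 : 0 <= eps <= 1.
Hypothesis mu_gt0 : 0 < mu.
Hypothesis mu_le : n%:R ^+ 2 * mu <= P + eps.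

Let n0 : (0 < n)%N. Proof. by lia. Qed.

(** Some edge crosses cut [k], so the flux mu S_k through it is at least the gap. *)
Lemma gap_le m k : (forall q, (q <= n)%N -> psum a q <= psum a m) -> gap n a k <= mu * psum a m.
Proof.
move=> mM; have m0 : 0 <= psum a m by have := mM 0%N (leq0n _); rewrite psum0.
rewrite {1}/gap; case: ifP => kn; last by rewrite mulr_ge0 // ltW.
have /andP[k0 lkn] := kn.
have := flux n0 Esym harm (ltnW lkn).
rewrite (bigD1 (Ordinal (ltnW lkn : (k < n.+1)%N))) //= -/(cut n E k) => H.
have g0 := gap_ge0 n0 amono.
have H1 : gap n a k <= (cut n E k)%:R * gap n a k.
  by rewrite -[leLHS]mul1r ler_wpM2r // (ler_nat _ 1) cut_gt0.
have H2 : 0 <= \sum_(i < n.+1 | i != Ordinal (ltnW lkn : (k < n.+1)%N)) (cut2 n E k i)%:R * gap n a i.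
  by apply: sumr_ge0 => i _; rewrite mulr_ge0 ?ler0n.
have H3 : mu * psum a k <= mu * psum a m by rewrite ler_wpM2l ?(ltW mu_gt0) // mM // ltnW.
have : gap n a k = a k - a k.-1 by rewrite /gap kn.
lra.
Qed.

Lemma a_diff m i j : (forall q, (q <= n)%N -> psum a q <= psum a m) ->
  (i + j < n)%N -> a (i + j)%N - a i <= j%:R * (mu * psum a m).
Proof.
move=> mM; elim: j => [|j IH] ijn; first by rewrite addn0 subrr mul0r.
have := gap_le (i + j.+1) mM; rewrite /gap ijn addnS /= -natr1 mulrDl mul1r.
have := IH ltac:(lia); lra.
Qed.

(** As a 0 <= 0 <= a (n - 1), every |a i| is at most the total spread, a sum of fewer than n
    gaps. *)
Lemma a_norm m i : (forall q, (q <= n)%N -> psum a q <= psum a m) -> (i < n)%N ->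
  `|a i| <= n%:R * (mu * psum a m).
Proof.
move=> mM lin; have i1 : (i <= n.-1)%N by lia.
have n1 : (n.-1 < n)%N by lia.
have m0 : 0 <= psum a m by have := mM 0%N (leq0n _); rewrite psum0.
have [h0 hn] := endpoint_signs n0 amono asum.
have := @a_diff m 0 n.-1 mM; rewrite add0n => /(_ n1) H.
have N : n.-1%:R * (mu * psum a m) <= n%:R * (mu * psum a m).
  by rewrite ler_wpM2r ?mulr_ge0 ?(ltW mu_gt0) // ler_nat leq_pred.
have := @amono 0 i (leq0n _) lin; have := @amono i n.-1 i1 n1.
by rewrite ler_norml => h1 h2; apply/andP; split; lra.
Qed.

Lemma psum_lip m i g : (forall q, (q <= n)%N -> psum a q <= psum a m) ->
  (i <= n)%N -> (g <= n)%N ->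
  `|psum a g - psum a i| <= (n%:R * (mu * psum a m)) * (dist i g)%:R.
Proof.
move=> mM; have H j l : (j + l <= n)%N ->
    `|psum a (j + l) - psum a j| <= (n%:R * (mu * psum a m)) * l%:R.
  elim: l => [|l IH] jl; first by rewrite addn0 subrr normr0 mulr0.
  rewrite addnS psumS -natr1 mulrDr mulr1.
  have -> : psum a (j + l) - a (j + l)%N - psum a j = (psum a (j + l) - psum a j) - a (j + l)%N by ring.
  by apply: le_trans (ler_normB _ _) _; apply: lerD; [apply: IH; lia|apply: a_norm => //; lia].
move=> lin gn; case: (leqP i g) => ig.
  have := H i (g - i)%N; rewrite subnKC // => /(_ gn).
  by rewrite (_ : dist i g = (g - i)%N) // /dist; lia.
have := H g (i - g)%N; rewrite subnKC ?(ltnW ig) // => /(_ lin).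
by rewrite distrC (_ : dist i g = (i - g)%N) // /dist; lia.
Qed.

Lemma defect_energy : exists M : R, [/\ 0 < M,
  forall q, (q <= n)%N -> M * (minn q (n - q))%:R <= n%:R * psum a q &
  \sum_(g < n.+1 | defect n d E g) psum a g ^+ 2 <=
     defect_const * (eps + n%:R^-1) * n%:R * M ^+ 2].
Proof.
have [D3 pi0 P0 C10] := const_facts; have P10 : 0 < P + 1 by exact: addr_gt0.
have nR : 4 <= n%:R :> R by rewrite (ler_nat _ 4).
have [m mn mM] := psum_max n a; exists (psum a m); set M := psum a m in mM *.
have nM q : (q <= n)%N -> 0 <= psum a q := @psum_ge0 R n a n0 amono asum q.
have M0 : 0 < M.
  rewrite lt_neqAle nM // andbT; apply/eqP => M00.
  have Z q : (q <= n)%N -> psum a q = 0.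
    by move=> qn; apply/eqP; rewrite eq_le nM // andbT M00 mM.
  have [i lin] := an0; have := psumS a i; rewrite !Z ?(ltnW lin) // sub0r => /esym/eqP.
  by rewrite oppr_eq0 => ->.
split=> //; first by move=> q qn; apply: psum_linear.
set X := \sum_(g < n.+1 | _) _; set Q := \sum_(g < n.+1) psum a g ^+ 2.
set A := \sum_(i < n) a i ^+ 2.
have A0 : 0 < A.
  have [i lin ai] := an0; rewrite /A (bigD1 (Ordinal lin)) //=.
  by rewrite ltr_wpDr ?exprn_even_gt0 // sumr_ge0 // => j _; apply: sqr_ge0.
have X0 : 0 <= X by apply: sumr_ge0 => g _; apply: sqr_ge0.
have Q0 : 0 <= Q by apply: sumr_ge0 => g _; apply: sqr_ge0.
have QM : Q <= n.+1%:R * M ^+ 2.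
  rewrite -[X in _ <= X%:R * _]card_ord mulr_natl -sumr_const; apply: ler_sum => g _.
  have gn := ltn_ord g : (g <= n)%N.
  by rewrite ler_sqr ?nnegrE ?nM ?(ltW M0) // mM.
have Q2 : Q <= 2 * n%:R * M ^+ 2.
  apply: le_trans QM _; rewrite ler_wpM2r ?sqr_ge0 // -natr1; lra.
have W : pi ^+ 2 * (1 - pi / n%:R) * Q <= n%:R ^+ 2 * A.
  have := wirtinger n0 (psum0 a) (psumn asum); rewrite -/Q.
  have -> : \sum_(i < n) (psum a i.+1 - psum a i) ^+ 2 = A.
    by apply: eq_bigr => i _; rewrite psumS; ring.
  move=> H; have := ler_wpM2l (sqr_ge0 (n%:R : R)) H; apply: le_trans.
  by rewrite mulrA; apply: ler_wpM2r => //; apply: cos_gap.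
set Delta := n%:R * (mu * M).
have De0 : 0 <= Delta by rewrite !mulr_ge0 ?ler0n // ltW.
have := @energy_bound R n d E Esym Eirr d3 degE cut_gt0 (psum a) (gap n a) mu M Delta
  (ltW mu_gt0) De0 (ltW M0).
rewrite -/X -/Q (sum_psum_gap n0 asum) -/A => H.
have {}H : A <= mu * ((d%:R - 1)^-1 * Q +
  n.+1%:R * ((2 * d%:R + 1) * (2 * M * d%:R * Delta) + M * (d%:R * Delta)) - kappa R d * X).
  apply: H.
  - by move=> i lin; rewrite nM // mM.
  - by move=> i g lin gn; apply: psum_lip.
  - exact: gap_ge0.
  - by move=> k; rewrite /gap => /negbTE ->.
  - by move=> i lin; rewrite (flux n0 Esym harm lin).
set Er := n.+1%:R * _ in H; set k := kappa R d in H.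
have k0 : 0 < k by apply: kappa_gt0.
have /andP[e0 e1] := eps01.
have ErC : Er <= C1 * M ^+ 2.
  have -> : Er = n.+1%:R * n%:R * mu * (((2 * d%:R + 1) * (2 * d%:R) + d%:R) * M ^+ 2).
    by rewrite /Er /Delta; ring.
  have c0 : 0 <= ((2 * d%:R + 1) * (2 * d%:R) + d%:R) * M ^+ 2.
    by rewrite mulr_ge0 ?sqr_ge0 // addr_ge0 ?mulr_ge0 //; lra.
  have h : n.+1%:R * n%:R * mu <= 2 * (P + 1).
    have : n.+1%:R * n%:R * mu <= 2 * (n%:R ^+ 2 * mu).
      rewrite mulrA ler_wpM2r ?(ltW mu_gt0) // -natr1 expr2 mulrA ler_wpM2r //; lra.
    move=> hh; apply: (le_trans hh); rewrite ler_pM2l ?ltr0n //.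
    by apply: (le_trans mu_le); rewrite lerD2l.
  apply: le_trans (ler_wpM2r c0 h) _.
  by rewrite le_eqVlt; apply/orP; left; apply/eqP; rewrite /C1; ring.
set br := (_ + Er - _) in H.
(* Positivity of the bracket, forced by A > 0, is what allows mu to be replaced by its upper bound
   (P + eps) / n^2. *)
have br0 : 0 < br by rewrite -(pmulr_rgt0 _ mu_gt0) (lt_le_trans A0).
have H2 : n%:R ^+ 2 * A <= (P + eps) * br.
  apply: le_trans (_ : n%:R ^+ 2 * (mu * br) <= _).
    by rewrite ler_wpM2l ?sqr_ge0.
  by rewrite mulrA ler_wpM2r // (ltW br0).
have H3 := le_trans W H2.
have di : 0 < (d%:R - 1)^-1 :> R by rewrite invr_gt0; lra.
(* This identity cancels the leading terms pi^2 Q of both sides, so that only terms of order eps or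
   1/n remain against the defects. *)
have Pd : P * (d%:R - 1)^-1 = pi ^+ 2 by rewrite /P; field; apply/eqP; lra.
have H4 : (P + eps) * (k * X) <= eps * (d%:R - 1)^-1 * Q + pi ^+ 3 / n%:R * Q + (P + 1) * (C1 * M ^+ 2).
  have E4 : (P + eps) * br = pi ^+ 2 * Q + eps * (d%:R - 1)^-1 * Q + (P + eps) * Er - (P + eps) * (k * X).
    by rewrite -Pd /br; ring.
  have E5 : pi ^+ 2 * (1 - pi / n%:R) * Q = pi ^+ 2 * Q - pi ^+ 3 / n%:R * Q by ring.
  have Er0 : 0 <= Er.
    by rewrite /Er !(mulr_ge0, addr_ge0) ?ler0n // ltW.
  have E6 : (P + eps) * Er <= (P + 1) * (C1 * M ^+ 2).
    by apply: ler_pM => //; [rewrite addr_ge0 // ltW|rewrite lerD2l].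
  move: H3; rewrite E4 E5; lra.
have H5 : P * (k * X) <= (2 * (d%:R - 1)^-1 + 2 * pi ^+ 3 + (P + 1) * C1) * ((eps + n%:R^-1) * n%:R * M ^+ 2).
  have kX : 0 <= k * X by rewrite mulr_ge0 // ltW.
  have h1 : P * (k * X) <= (P + eps) * (k * X) by rewrite ler_wpM2r //; lra.
  have ni : 0 < n%:R^-1 :> R by rewrite invr_gt0; lra.
  have p3 : 0 < pi ^+ 3 :> R by rewrite exprn_gt0.
  have h2 : eps * (d%:R - 1)^-1 * Q <= eps * (d%:R - 1)^-1 * (2 * n%:R * M ^+ 2).
    by rewrite ler_wpM2l // mulr_ge0 // ltW.
  have h3 : pi ^+ 3 / n%:R * Q <= pi ^+ 3 / n%:R * (2 * n%:R * M ^+ 2).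
    by rewrite ler_wpM2l // mulr_ge0 // ltW.
  have M2 : 0 <= M ^+ 2 by apply: sqr_ge0.
  have nn : n%:R^-1 * n%:R = 1 :> R by rewrite mulVf ?pnatr_eq0 -?lt0n // n0.
  have -> : (eps + n%:R^-1) * n%:R * M ^+ 2 = eps * n%:R * M ^+ 2 + M ^+ 2.
    by rewrite mulrDl nn mulrDl mul1r.
  have q0 : 0 <= eps * n%:R * M ^+ 2 by rewrite mulr_ge0 // mulr_ge0 ?ler0n.
  have e3 : pi ^+ 3 / n%:R * (2 * n%:R * M ^+ 2) = 2 * pi ^+ 3 * M ^+ 2 * (n%:R^-1 * n%:R) :> R by ring.
  rewrite nn mulr1 in e3.
  have q1 : 0 <= (d%:R - 1)^-1 * M ^+ 2 :> R by rewrite mulr_ge0 // ltW.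
  have q2 : 0 <= pi ^+ 3 * (eps * n%:R * M ^+ 2) by rewrite mulr_ge0 // ltW.
  have q3 : 0 <= (P + 1) * C1 * (eps * n%:R * M ^+ 2) by rewrite mulr_ge0 // mulr_ge0 // ltW.
  apply: (le_trans h1); apply: (le_trans H4).
  rewrite mulrDr !mulrDl; lra.
have -> : defect_const * (eps + n%:R^-1) * n%:R * M ^+ 2 =
    (2 * (d%:R - 1)^-1 + 2 * pi ^+ 3 + (P + 1) * C1) * ((eps + n%:R^-1) * n%:R * M ^+ 2) / (P * k).
  by rewrite /defect_const -/k; ring.
have Pk : 0 < P * k by exact: mulr_gt0.
rewrite ler_pdivlMr //.
by have -> : X * (P * k) = P * (k * X) by ring.
Qed.

End Energy.

(** * Assembly of the estimates *)

Local Open Scope ring_scope.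

(** The constant of [bad_count] for L = 2 d + 5; the last summand absorbs its additive term, since
    eta n >= 1. *)
Definition copy_const (R : realType) (d : nat) : R :=
  (2 * (2 * d + 5) + 1)%:R * defect_const R d + 2 + (2 * (2 * d + 5) + 1)%:R.

Lemma sorted_numbering (R : realType) (T : finType) (f : T -> R) : (0 < #|T|)%N ->
  exists (v : nat -> T) (idx : T -> nat),
  [/\ forall x, (idx x < #|T|)%N, forall x, v (idx x) = x,
      forall p, (p < #|T|)%N -> idx (v p) = p &
      forall i j, (i <= j)%N -> (j < #|T|)%N -> f (v i) <= f (v j)].
Proof.
move=> /card_gt0P[x0 _]; pose s := sort (fun x y => f x <= f y) (enum T).
have ss : size s = #|T| by rewrite size_sort -cardE.
have us : uniq s by rewrite sort_uniq enum_uniq.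
have ms x : x \in s by rewrite mem_sort mem_enum.
exists (nth x0 s), (index^~ s); split.
- by move=> x; rewrite -ss index_mem.
- by move=> x; rewrite nth_index.
- by move=> p pn; rewrite index_uniq ?ss.
move=> i j ij jn; have tot : total (fun x y => f x <= f y) by move=> x y; exact: le_total.
have tr : transitive (fun x y => f x <= f y) by move=> y x z; exact: le_trans.
apply: (sorted_leq_nth tr _ x0 (sort_sorted tot _)) => //; last 2 first.
- by rewrite inE ss (leq_ltn_trans ij).
- by rewrite inE ss.
Qed.

Lemma few_bad_vertices (R : realType) (d : nat) (eps : R) (T : finType) (e : rel T) (eta : R) :
    (3 <= d)%N -> (4 <= #|T|)%N -> 0 <= eps <= 1 ->
    symmetric e -> irreflexive e -> connected_graph e ->
    (forall x : T, (d <= degree e x)%N) ->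
    #|T|%:R ^+ 2 * algebraic_connectivity R e <= (d%:R - 1) * pi ^+ 2 + eps ->
    0 < eta -> eta ^+ 3 = eps + #|T|%:R^-1 ->
  exists (v : nat -> T) (idx : T -> nat),
  [/\ forall x, (idx x < #|T|)%N, forall x, v (idx x) = x,
      forall p, (p < #|T|)%N -> idx (v p) = p &
      (\sum_(p < #|T|) bad #|T| d (adj e v #|T|) p)%N%:R <= copy_const R d * eta * #|T|%:R].
Proof.
move=> d3 n4 eps01 eC eirr econ edeg mu_le eta0 eta3.
have n1 : (1 < #|T|)%N by apply: leq_trans n4.
have n0 : (0 < #|T|)%N by apply: leq_trans n4.
have [f [[x fx] fsum fL]] := fiedler_exists R eC econ n1.
have [v [idx [idx_lt idxK vK amono]]] := sorted_numbering f n0.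
exists v, idx; split=> //.
have vb := v_bij idx_lt idxK vK.
have [En Ei] := (adjC v #|T| eC, adj_irr v #|T| eirr).
have Ed := adj_deg edeg idx_lt idxK vK.
have Ec i := @adj_cut _ _ d _ _ _ eC econ d3 erefl idx_lt idxK vK i.
have asum : \sum_(i < #|T|) f (v i) = 0.
  by rewrite -[RHS]fsum [RHS](reindex _ (onW_bij _ vb)).
have an0 : exists2 i, (i < #|T|)%N & f (v i) != 0.
  by exists (idx x); rewrite ?idxK.
have harm p : (p < #|T|)%N -> \sum_(q < #|T|) (adj e v #|T| p q)%:R * (f (v p) - f (v q)) =
    algebraic_connectivity R e * f (v p).
  move=> pn; rewrite -fL [RHS](reindex _ (onW_bij _ vb)).
  by apply: eq_bigr => q _; rewrite /adj pn ltn_ord.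
have mu0 := algebraic_connectivity_gt0 R eC econ n1.
have [M [M0 SM X]] := defect_energy d3 n4 En Ei Ed Ec amono asum an0 harm eps01 mu0 mu_le.
rewrite -eta3 in X.
have := bad_count En Ei d3 Ed Ec n0 M0 eta0 SM X.
rewrite -natr_sum => H; apply: (le_trans H).
have nR : 1 <= #|T|%:R :> R by rewrite (ler_nat _ 1).
(* From eta^3 >= 1/n one gets (eta n)^3 >= n^2 >= 1. *)
have etan : 1 <= eta * #|T|%:R.
  rewrite leNgt; apply/negP => lt1.
  have p0 : 0 <= eta * #|T|%:R by rewrite mulr_ge0 ?ler0n // ltW.
  have : (eta * #|T|%:R) ^+ 3 < 1 by apply: exprn_ilt1.
  rewrite exprMn eta3 ltNge => /negP; apply.
  have /andP[e0 _] := eps01.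
  have n3 : 0 <= #|T|%:R ^+ 3 :> R by rewrite exprn_ge0 ?ler0n.
  have -> : (eps + #|T|%:R^-1) * #|T|%:R ^+ 3 = eps * #|T|%:R ^+ 3 + #|T|%:R ^+ 2.
    by field; apply/eqP; lra.
  have := mulr_ge0 e0 n3; have : 1 <= #|T|%:R ^+ 2 :> R by rewrite exprn_ege1.
  lra.
have k0 : 0 <= (2 * (2 * d + 5) + 1)%:R :> R by rewrite ler0n.
rewrite /copy_const -mulrA [leRHS]mulrDl lerD2l.
by rewrite -[leLHS]mulr1 ler_wpM2l.
Qed.

Theorem theorem3p20 (R : realType) (d : nat) (hd : (3 <= d)%N) :
  exists (C : R) (n0 : nat), 0 < C /\
  forall (eps : R) (T : finType) (e : rel T),
    0 <= eps <= 1 ->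
    symmetric e -> irreflexive e -> connected_graph e ->
    (n0 <= #|T|)%N ->
    (forall x : T, (d <= degree e x)%N) ->
    let n : R := #|T|%:R in
    n ^+ 2 * algebraic_connectivity R e <= (d%:R - 1) * pi ^+ 2 + eps ->
    let eta : R := (eps + n^-1) `^ (3%:R^-1) in
    (exists (F : {set {ffun 'I_d.+1 -> T}})
            (chains : seq (seq {ffun 'I_d.+1 -> T})),
       [/\ {in F, forall f, induced_L e f},
           {in F &, forall f g, f != g -> [disjoint verts f & verts g]},
           #|~: \bigcup_(f in F) verts f|%:R <= C * eta * n,
           {in F, forall f, has_terminal_bridges e f}
         & [/\ uniq (flatten chains), flatten chains =i F,
               all (is_chain e) chains
             & (size chains)%:R <= C * eta * n]])
    /\ 3%:R * n / (d.+1)%:R - C * eta * n <= (diameter e)%:R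
    /\ (diameter e)%:R <= 3%:R * (#|T| %/ d.+1)%:R - 1 :> R.
Proof.
(* Order 4 is what [cos_gap] requires. *)
exists (copy_const R d), 4%N; split.
  have c0 := defect_const_gt0 R hd.
  have l0 : 0 < (2 * (2 * d + 5) + 1)%:R :> R by rewrite ltr0n; lia.
  by rewrite /copy_const addr_gt0 // addr_gt0 // mulr_gt0.
move=> eps T e eps01 eC eirr econ n4 edeg n mu_le eta.
have n0 : (0 < #|T|)%N by apply: leq_trans n4.
have nR : 0 < n by rewrite ltr0n.
have base : 0 < eps + n^-1.
  by have /andP[e0 _] := eps01; rewrite ltr_wpDl // invr_gt0.
have eta0 : 0 < eta by apply: powR_gt0.
have eta3 : eta ^+ 3 = eps + n^-1.
  by rewrite -powR_mulrn ?ltW // /eta -powRrM mulVf ?pnatr_eq0 // powRr1 ?ltW.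
have [v [idx [idx_lt idxK vK few]]] :=
  few_bad_vertices hd n4 eps01 eC eirr econ edeg mu_le eta0 eta3.
have [F [chains [FL Fd Fc Fb [Cu CF Cc Cs]]]] :=
  chain_decomposition eC eirr econ hd edeg erefl idx_lt idxK vK.
split; first exists F, chains.
  by split=> //; [apply: le_trans few; rewrite ler_nat|split=> //; apply: le_trans few; rewrite ler_nat].
have [x0 _] := card_gt0P n0.
split; last first.
  have := diameter_lt econ eC eirr x0 edeg.
  by rewrite -(ler_nat R) -natr1 natrM; lra.
have gc := goods_cover v econ hd (erefl #|T|).
have := diameter_ge eC eirr econ hd edeg erefl idx_lt idxK vK n0.
rewrite -(ler_nat R) natrM; apply: le_trans.
move: gc; rewrite -(ler_nat R) natrD natrM -/n => gc.
(* From n <= B + g (d + 1) follows 3 g >= 3 n / (d + 1) - 3 B / (d + 1), and d + 1 >= 3 turns the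
   last term into B. *)
have dR : 4 <= d.+1%:R :> R by rewrite (ler_nat _ 4).
have B0 : 0 <= copy_const R d * eta * n by apply: le_trans few; rewrite ler0n.
move: gc few; set B := copy_const R d * eta * n in B0 *; set g := (size _)%:R.
set b := (\sum_(p < _) _)%N%:R => gc few.
rewrite lerBlDr ler_pdivrMr; last by lra.
have : B * 4 <= B * d.+1%:R by rewrite ler_wpM2l.
lra.
Qed.
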